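(* Let $\Lambda\subset\mathbb{R}^d$ be a lattice as in the context and let $0<\sigma<1$. There exist constants $C_1,C_2,C_3$, depending only on $\sigma$ and the lattice, such that the following holds. Let $H=\sum_{Z} H_Z$ be a Hamiltonian on $\Lambda$ satisfying the standing assumptions of the context with constants $J$, $\alpha>d$ and $\mathcal{C}_0<\infty$, and suppose that $$\frac{d+1}{\alpha+1}<\sigma<1 .$$ Put $v=C_2\max\{J,\mathcal{C}_0\}$ and $$n^*=\left\lceil\frac{\sigma d}{\sigma\alpha-d}\right\rceil .$$ Then for every finite nonempty $X\subseteq\Lambda$ there is a function $\mathfrak{G}:[0,\infty)\to[0,\infty)$ with $$\mathfrak{G}(\tau)\le C_3\bigl(\tau+\tau^{1+d/(1-\sigma)}\bigr)|X|^{n^*+2}\qquad(\tau\ge 0),$$ such that for every nonempty $Y\subseteq\Lambda$ with $r=d(X,Y)>0$, all observables $A$ and $B$ supported on $X$ and $Y$ respectively, and all $t\ge 0$, $$\bigl\|[\tau_t^{H}(A),B]\bigr\|\le \|A\|\,\|B\|\left\{2|X|\,e^{vt-r^{1-\sigma}}+C_1\frac{\mathfrak{G}(vt)}{r^{\sigma\alpha}}\right\}.$$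
   Context: **Lattice.** $\Lambda$ is a set of sites with a metric $d(x,y)$. It is embedded in Euclidean space $\mathbb{R}^d$: each $z\in\Lambda$ has a position $\mathbf{r}_z\in\mathbb{R}^d$ with $d(x,y)=|\mathbf{r}_x-\mathbf{r}_y|$. The smallest separation is normalized to $1$: $d(x,y)\ge 1$ for all distinct $x,y\in\Lambda$. For $X,Y\subseteq\Lambda$, $d(X,Y)$ is the minimum distance between an element of $X$ and an element of $Y$; $\mathrm{diam}(Z)=\sup_{x,y\in Z}d(x,y)$; $|X|$ is the number of sites of $X$. (The letter $d$ denotes both the dimension and the metric.) **Spin system.** Each site carries a finite-dimensional Hilbert space. An observable supported on $X$ is an operator acting nontrivially only on the sites of $X$; $\|\cdot\|$ is the operator norm. The Hamiltonian is $H=\sum_{Z\subseteq\Lambda}H_Z$ with $H_Z$ self-adjoint and supported on $Z$ (no restriction on the number of sites in $Z$). The Heisenberg evolution is $\tau_t^H(O)=e^{itH}Oe^{-itH}$ (if $\Lambda$ is infinite, understood as the usual infinite-volume limit of the dynamics). **Standing assumptions on $H$.** Let $$f(R):=\sup_{z\in\Lambda}\ \sum_{Z\ni z:\ \mathrm{diam}(Z)\ge R}\|H_Z\| .$$ There are constants $J$ and $\alpha>d$ such that $f(R)\le J R^{-\alpha}$ for all $R>0$. Moreover $$\mathcal{C}_0:=\sup_{x\in\Lambda}\sum_{y\in\Lambda}\ \sum_{Z\ni x,y}\|H_Z\|<\infty .$$ *)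

(* Defs.v *)
From HB Require Import structures.
From mathcomp Require Import all_boot all_order all_algebra.
From mathcomp Require Import finmap.
From mathcomp Require Import complex.
From mathcomp Require Import all_classical all_reals all_analysis.

Set Implicit Arguments.
Unset Strict Implicit.
Unset Printing Implicit Defensive.

Import Order.TTheory GRing.Theory Num.Theory.
Import numFieldNormedType.Exports.

Local Open Scope fset_scope.
Local Open Scope classical_set_scope.
Local Open Scope ring_scope.
Local Open Scope complex_scope.

Section Geometry.
Context {R : realType} {d : nat} {L : choiceType}.
Variable pos : L -> 'rV[R]_d.

(* The library norm on 'rV[R]_d is the sup norm, so the Euclidean distance is
   written out. *)
Definition dist (x y : L) : R :=
  Num.sqrt (\sum_(i < d) (pos x 0 i - pos y 0 i) ^+ 2).

Definition unit_separated : Prop := forall x y : L, x != y -> 1 <= dist x y.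

Definition diam (Z : {fset L}) : R :=
  sup [set dist p.1 p.2 | p in [set` Z] `*` [set` Z]].

Definition set_dist (X Y : set L) : R :=
  inf [set dist p.1 p.2 | p in X `*` Y].

End Geometry.

Section SpinSystem.
Context {R : realType} {L : choiceType}.

(* q x is the dimension of the Hilbert space C^(q x) of the site x.  The
   configurations of all sites label an orthonormal basis of the Hilbert space
   l2(Conf).  When L is finite this is the tensor product of the C^(q x); when
   L is infinite it carries a faithful representation of the local matrix
   algebras, whose norm closure is the quasi-local algebra. *)
Variable q : L -> nat.

Definition Conf : Type := forall x : L, 'I_(q x).
Definition LConf (F : {fset L}) := {dffun forall x : F, 'I_(q (val x))}.

Definition restr (F : {fset L}) (s : Conf) : LConf F :=
  finfun (fun x : F => s (val x)).

Definition override (F : {fset L}) (s : Conf) (u : LConf F) : Conf := fun x =>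
  match boolP (x \in F) with
  | AltTrue h => u (FSetSub h)
  | AltFalse _ => s x
  end.

Definition vec := Conf -> R[i].

(* Operators are functions on all of vec, but only their values on square
   summable vectors are meaningful: every notion below ignores the others. *)
Definition op := vec -> vec.

Definition l2norm (psi : vec) : \bar R :=
  ((\esum_(s in [set: Conf])
      (complex.Re (psi s) ^+ 2 + complex.Im (psi s) ^+ 2)%:E) `^ 2^-1)%E.

(* Stated as the least bound over all of l2 rather than as a supremum over the
   unit ball because an element of op need not be homogeneous. *)
Definition opnorm (T : op) : \bar R :=
  ereal_inf [set c%:E | c in [set c : R | 0 <= c /\
    forall psi : vec, (l2norm psi < +oo)%E ->
      (l2norm (T psi) <= c%:E * l2norm psi)%E]].

Definition subop (T S : op) : op := fun psi s => T psi s - S psi s.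
Definition commutator (T S : op) : op := subop (T \o S) (S \o T).

(* M (x) 1: the matrix M acts on the sites of F. *)
Definition local_op (F : {fset L}) (M : 'M[R[i]]_#|LConf F|) : op :=
  fun psi s => \sum_(u : LConf F)
    M (enum_rank (restr F s)) (enum_rank u) * psi (override s u).

(* The norm closure of the operators local in a finite subset of Y.  For
   finite Y the local operators form a finite-dimensional, hence closed,
   algebra and this means T = local_op M on l2 for some matrix M on Y. *)
Definition supported (Y : set L) (T : op) : Prop :=
  forall e : R, 0 < e -> exists F : {fset L}, [set` F] `<=` Y /\
    exists M : 'M[R[i]]_#|LConf F|, (opnorm (subop T (local_op M)) <= e%:E)%E.

(* The library puts no topology on R[i]. *)
Definition clim (u : nat -> R[i]) : R[i] :=
  lim ((fun n => complex.Re (u n)) @ \oo)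
    +i* lim ((fun n => complex.Im (u n)) @ \oo).

(* exp (z T) as a power series. *)
Definition expop (z : R[i]) (T : op) : op := fun psi s =>
  clim (fun n => \sum_(k < n) z ^+ k / k`!%:R * iter k T psi s).

(* An infinite Z has infinite diameter, and the decay assumption on the
   interaction would force H_Z = 0, so only finite Z are represented. *)
Definition interaction := forall Z : {fset L}, 'M[R[i]]_#|LConf Z|.

Variable H : interaction.

Definition self_adjoint : Prop := forall Z : {fset L}, H Z \is hermsymmx.

Definition finite_hamiltonian (V : {fset L}) : op := fun psi s =>
  \sum_(Z <- fpowerset V) local_op (H Z) psi s.

Definition finite_evolution (V : {fset L}) (t : R) (A : op) : op :=
  expop (0 +i* t) (finite_hamiltonian V) \o A
    \o expop (0 +i* (- t)) (finite_hamiltonian V).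

Definition norm_limit (u : {fset L} -> op) (T : op) : Prop :=
  forall e : R, 0 < e -> exists V0 : {fset L}, forall V : {fset L},
    (V0 `<=` V)%fset -> (opnorm (subop T (u V)) <= e%:E)%E.

(* The norm limit along the finite volumes ordered by inclusion; for finite L
   this is the evolution in the largest volume.  The default value 0 is taken
   if there is no limit.  The limit is unique on l2. *)
Definition evolution (t : R) (A : op) : op :=
  xget (fun _ _ => 0 : R[i])
       [set T | norm_limit (fun V => finite_evolution V t A) T].

Definition total_strength : \bar R :=
  ereal_sup [set (\esum_(y in [set: L])
      \esum_(Z in [set Z : {fset L} | x \in Z /\ y \in Z]) opnorm (local_op (H Z)))%E
    | x in [set: L]].

Definition range_tail (d : nat) (pos : L -> 'rV[R]_d) (r : R) : \bar R :=
  ereal_sup [set (\esum_(Z in [set Z : {fset L} | z \in Z /\ (r <= diam pos Z)%R])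
      opnorm (local_op (H Z)))%E
    | z in [set: L]].

End SpinSystem.

(* Main.v *)
Require Import Defs.
From HB Require Import structures.
From mathcomp Require Import all_boot all_order all_algebra.
From mathcomp Require Import finmap.
From mathcomp Require Import complex.
From mathcomp Require Import all_classical all_reals all_analysis.
From mathcomp Require Import ring lra.

Set Implicit Arguments.
Unset Strict Implicit.
Unset Printing Implicit Defensive.

Import Order.TTheory GRing.Theory Num.Theory.
Import numFieldNormedType.Exports.

Local Open Scope classical_set_scope.
Local Open Scope ring_scope.

(** The idea. Cut the interaction at diameter rho^sigma, rho being the distance
between the two supports. The truncated dynamics has a linear light cone, with
tail exp(vt - rho^(1-sigma)) at distance rho. By Duhamel's formula the discarded
terms H_Z contribute at most t * sum_Z ||[H_Z, tau_t(A)]||, a sum over Z of diameter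
at least rho^sigma in which the commutators are again controlled by a
Lieb-Robinson bound for the truncated dynamics. An a priori decay of these
commutators like (radius / rho)^e, with radius = max(1, vt)^(1/(1-sigma)), is
thereby improved to a larger exponent. Starting from the trivial bound (e = 0),
ceil(sigma d / (sigma alpha - d)) + 1 rounds lift e above d, each at the price of
one factor |X|; once e > d the sum over the lattice is of order radius^d and one
last round yields the exponent sigma alpha. The condition
(d+1)/(alpha+1) < sigma is what keeps the bounds functions of radius / rho.

Time is discretised throughout: evolving by a small x changes A by x[iH, A] up to
an error of order x^2, and these errors vanish in the limit of small steps, so no
operator-valued integral is needed. *)

(** The obstacle is summability. The discarded terms can be summed over the lattice only against a
    decay of exponent [p = d + eta], while the bound at hand has some [e <= p]. The missing exponent
    is borrowed from the Lieb-Robinson tail of the same truncated dynamics: it decays faster than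
    any power, but on the larger scale [front t * rg], and a geometric mean of the two bounds has
    exponent exactly [p]. The loan costs about the power [p - e] of [front t * rg / radius t]. With
    [rg = rho^sigma], a round therefore multiplies the deficit [p - e] by [sigma] and lowers it by
    [sigma * alpha - d], up to multiples of [eta].

    The constants must not depend on [alpha]. The condition on [sigma] gives
    [sigma * alpha - d >= 1 - sigma], which bounds the number of rounds in terms of [sigma] and [d]
    alone; [eta] is then chosen small against that number.

    The analysis runs in an abstract ring with a seminorm, later instantiated by the matrices of one
    finite volume containing the supports of both observables. Infinite volume enters only at the
    end, by norm approximation. *)

Definition comm {T : pzRingType} (a b : T) : T := a * b - b * a.

Section Comm.
Context {T : pzRingType}.
Implicit Types a b c : T.

Lemma commDl a b c : comm (a + b) c = comm a c + comm b c.
Proof. by rewrite /comm mulrDl mulrDr opprD addrACA. Qed.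

Lemma comm_suml (I : Type) (r : seq I) (P : pred I) (F : I -> T) b :
  comm (\sum_(i <- r | P i) F i) b = \sum_(i <- r | P i) comm (F i) b.
Proof. by rewrite /comm mulr_suml mulr_sumr -sumrB. Qed.

Lemma comm_jacobi a b c :
  comm (comm a b) c = comm a (comm b c) - comm b (comm a c).
Proof.
have sub_addA (x y z : T) : (x - y) + (y - z) = x - z.
  by rewrite addrA subrK.
rewrite /comm !mulrBl !mulrBr !mulrA !opprB.
rewrite [RHS]addrACA !sub_addA [RHS]addrACA [LHS]addrACA; congr (_ + _).
exact: addrC.
Qed.

End Comm.

(* [s r] stands for the real scalar [r] seen inside the ring. *)
Record is_ring_norm (R : realType) (T : pzRingType) (nrm : T -> R) (s : R -> T)
  : Prop := IsRingNorm {
  rnrm_ge0 : forall a, 0 <= nrm a;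
  rnrm0 : nrm 0 = 0;
  rnrmD : forall a b, nrm (a + b) <= nrm a + nrm b;
  rnrmN : forall a, nrm (- a) <= nrm a;
  rnrmM : forall a b, nrm (a * b) <= nrm a * nrm b;
  rnrm_scalar : forall r, nrm (s r) <= `|r|;
  scalarC : forall r a, s r * a = a * s r;
  scalarN : forall r, s (- r) = - s r }.

(** An axiomatic stand-in for [exp (x k)] with [k] anti-Hermitian: since [flow_nrm] holds at [x] and
    at [- x], conjugation preserves the norm. [flow_expand] is the only link between the flow and
    its generator. *)
Record is_flow (R : realType) (T : pzRingType) (nrm : T -> R) (s : R -> T)
  (K : R) (k : T) (U : R -> T) : Prop := IsFlow {
  flow0 : U 0 = 1;
  flowD : forall x y, U (x + y) = U x * U y;
  flow_nrm : forall x, nrm (U x) <= 1;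
  flow_expand : forall x, nrm (U x - (1 + s x * k)) <= K * x ^+ 2 }.

Definition evolve {R : realType} {T : pzRingType} (U : R -> T) (t : R) (a : T) :=
  U t * a * U (- t).

(** * Evolution by conjugation in a seminormed ring *)

Section Norm.
Context {R : realType} {T : pzRingType} {nrm : T -> R} {s : R -> T}.
Hypothesis N : is_ring_norm nrm s.

Lemma rnrmB a b : nrm (a - b) <= nrm a + nrm b.
Proof. by apply: le_trans (rnrmD N _ _) _; rewrite lerD2l (rnrmN N). Qed.

Lemma rnrm_distC a b : nrm (a - b) = nrm (b - a).
Proof.
by apply/le_anti; rewrite -[X in nrm X <= _]opprB (rnrmN N) /= -[X in nrm X <= _]opprB (rnrmN N).
Qed.

Lemma rnrm_sum (I : Type) (r : seq I) (P : pred I) (F : I -> T) :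
  nrm (\sum_(i <- r | P i) F i) <= \sum_(i <- r | P i) nrm (F i).
Proof.
elim/big_ind2: _ => [|x y z w xy zw|i _]; rewrite ?(rnrm0 N)//.
by apply: le_trans (rnrmD N _ _) _; exact: lerD.
Qed.

Lemma rnrm_comm a b : nrm (comm a b) <= 2 * nrm a * nrm b.
Proof.
apply: le_trans (rnrmB _ _) _; rewrite -mulrA mulr_natl mulr2n.
by apply: lerD; last rewrite [leRHS]mulrC; exact: (rnrmM N).
Qed.

Lemma rnrm_sM r a : nrm (s r * a) <= `|r| * nrm a.
Proof.
apply: le_trans (rnrmM N _ _) _.
by rewrite ler_wpM2r ?(rnrm_ge0 N)// (rnrm_scalar N).
Qed.

Lemma rnrm_le_sub a b : nrm a <= nrm b + nrm (a - b).
Proof. by rewrite -{1}[a](subrK b) addrC (rnrmD N). Qed.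

Lemma rnrmM_le a b x y : nrm a <= x -> nrm b <= y -> nrm (a * b) <= x * y.
Proof.
by move=> ax bY; apply: le_trans (rnrmM N _ _) _; apply: ler_pM; rewrite ?(rnrm_ge0 N).
Qed.

Section Flow.
Context {K : R} {k : T} {U : R -> T}.
Hypothesis FU : is_flow nrm s K k U.

Lemma flowK x : U (- x) * U x = 1.
Proof. by rewrite -(flowD FU) addNr (flow0 FU). Qed.

Lemma evolve0 a : evolve U 0 a = a.
Proof. by rewrite /evolve oppr0 (flow0 FU) mul1r mulr1. Qed.

Lemma evolve_evolve t u a : evolve U t (evolve U u a) = evolve U (t + u) a.
Proof. by rewrite /evolve opprD (addrC (- t)) !(flowD FU) !mulrA. Qed.

Lemma evolveM t a b : evolve U t (a * b) = evolve U t a * evolve U t b.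
Proof.
by rewrite /evolve !mulrA -[_ * a * U (- t) * U t]mulrA flowK mulr1.
Qed.

Lemma evolveD t a b : evolve U t (a + b) = evolve U t a + evolve U t b.
Proof. by rewrite /evolve mulrDr mulrDl. Qed.

Lemma evolveN t a : evolve U t (- a) = - evolve U t a.
Proof. by rewrite /evolve mulrN mulNr. Qed.

Lemma evolve_comm t a b :
  evolve U t (comm a b) = comm (evolve U t a) (evolve U t b).
Proof. by rewrite /comm evolveD evolveN !evolveM. Qed.

Lemma evolve_s t r a : evolve U t (s r * a) = s r * evolve U t a.
Proof. by rewrite /evolve !mulrA (scalarC N). Qed.

Lemma evolve_sum t (I : Type) (r : seq I) (P : pred I) (F : I -> T) :
  evolve U t (\sum_(i <- r | P i) F i) = \sum_(i <- r | P i) evolve U t (F i).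
Proof. by rewrite /evolve mulr_sumr mulr_suml. Qed.

Lemma rnrm_evolve t a : nrm (evolve U t a) <= nrm a.
Proof.
rewrite -[leRHS]mulr1 -[X in X * 1]mul1r.
apply: rnrmM_le (flow_nrm FU _); apply: rnrmM_le => //; exact: (flow_nrm FU).
Qed.

Lemma flow_error_ge0 : 0 <= K.
Proof.
have := le_trans (rnrm_ge0 N _) (flow_expand FU 1).
by rewrite expr1n mulr1.
Qed.

(* [U a V - a - x[k,a]] with [U = p + r], [V = p' + r'], [p = 1 + xk],
   [p' = 1 - xk] equals [- (xk) a (xk) + r a V + (U - r) a r'] *)
Lemma evolve_expand (B x : R) a : nrm k <= B -> `|x| <= 1 ->
  nrm (evolve U x a - (a + s x * comm k a))
    <= (B ^+ 2 + K + (1 + K) * K) * x ^+ 2 * nrm a.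
Proof.
move=> kB x1; set y := s x * k.
set r := U x - (1 + y); set r' := U (- x) - (1 - y).
have K0 := flow_error_ge0.
have B0 : 0 <= B by apply: le_trans kB; exact: (rnrm_ge0 N).
have a0 := rnrm_ge0 N a.
have nr : nrm r <= K * x ^+ 2 by exact: (flow_expand FU).
have nr' : nrm r' <= K * x ^+ 2.
  have := flow_expand FU (- x); rewrite sqrrN; congr (_ <= _).
  by rewrite (scalarN N) mulNr.
have ny : nrm y <= B * `|x|.
  rewrite mulrC; apply: rnrmM_le => //; exact: (rnrm_scalar N).
have nUr : nrm (U x - r) <= 1 + K.
  apply: le_trans (rnrmB _ _) _; apply: lerD; first exact: (flow_nrm FU).
  by apply: le_trans nr _; rewrite ler_piMr// -real_normK ?num_real// exprn_ile1.
have -> : evolve U x a - (a + s x * comm k a) =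
    (- (y * a * y) + r * a * U (- x)) + (U x - r) * a * r'.
  have Ur : U x - r = 1 + y by rewrite /r opprB addrC subrK.
  have -> : s x * comm k a = y * a - a * y.
    by rewrite /comm mulrBr !mulrA -/y -(scalarC N x a).
  have Q : (1 + y) * a * (1 - y) = a + (y * a - a * y) - y * a * y.
    by rewrite mulrBr mulr1 mulrDl mul1r mulrDl opprD !addrA.
  have Z : r * a * U (- x) + (1 + y) * a * r' =
      U x * a * U (- x) - (1 + y) * a * (1 - y).
    by rewrite /r' [in LHS]mulrBr /r !mulrBl addrA subrK.
  rewrite Ur -addrA Z Q opprB addrC -!addrA; congr (_ + _).
  by rewrite addrCA addrN addr0.
apply: le_trans (rnrmD N _ _) _.
apply: le_trans (lerD (rnrmD N _ _) (lexx _)) _.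
rewrite [leRHS](_ : _ = B ^+ 2 * x ^+ 2 * nrm a + K * x ^+ 2 * nrm a
    + (1 + K) * (K * x ^+ 2) * nrm a); last by ring.
apply: lerD; first apply: lerD.
- apply: le_trans (rnrmN N _) _.
  apply: le_trans (rnrmM_le (rnrmM_le ny (lexx _)) ny) _.
  by rewrite -(real_normK (num_real x)) le_eqVlt; apply/orP; left; apply/eqP; ring.
- have := rnrmM_le (rnrmM_le nr (lexx (nrm a))) (flow_nrm FU (- x)).
  by rewrite mulr1.
- apply: le_trans (rnrmM_le (rnrmM_le nUr (lexx _)) nr') _.
  by rewrite le_eqVlt; apply/orP; left; apply/eqP; ring.
Qed.

End Flow.
End Norm.
(** Across one term of the truncated interaction the exponential weight of a site changes by at most
    a factor e. This crude bound for e is the origin of the velocity condition [8 * C0 <= v], the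
    other factor 2 coming from the norm of a commutator. *)
Lemma expR1_le4 {R : realType} : expR 1 <= 4 :> R.
Proof.
have h : 2^-1 <= expR (- 2^-1) :> R.
  by apply: le_trans (expR_ge1Dx _); lra.
have h2 : expR (2^-1) <= 2 :> R.
  by rewrite -[2^-1]opprK expRN -[leRHS]invrK lef_pV2// posrE ?invr_gt0// expR_gt0.
rewrite [X in expR X](_ : 1 = 2^-1 + 2^-1); last lra.
rewrite expRD (_ : 4 = 2 * 2); last lra.
by apply: ler_pM; rewrite ?expR_ge0.
Qed.

(** * Lieb-Robinson bounds for truncated interactions *)

Section LiebRobinson.
Context {R : realType} {L : choiceType} {T : pzRingType}.
(* [h Z] stands for [i H_Z], [S X] for the observables supported on [X], and [U P]
   for the propagator of the terms selected by [P]: all bounds are uniform in [P]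
   because they are applied to truncations. *)
Variables (nrm : T -> R) (s : R -> T) (S : {fset L} -> T -> Prop).
Variables (fV : seq {fset L}) (h : {fset L} -> T).
Variables (U : pred {fset L} -> R -> T) (K : R).
Hypothesis N : is_ring_norm nrm s.
Hypothesis Scomm : forall X Y a b, S X a -> S Y b -> [disjoint X & Y]%fset ->
  nrm (comm a b) = 0.
Hypothesis Sh : forall Z, Z \in fV -> S Z (h Z).
Hypothesis FU : forall P : pred {fset L},
  is_flow nrm s K (\sum_(Z <- fV | P Z) h Z) (U P).

Local Notation gen P := (\sum_(Z <- fV | P Z) h Z).
Local Notation ev P := (evolve (U P)).
Local Notation B := (\sum_(Z <- fV) nrm (h Z)).
Local Notation K' := (B ^+ 2 + K + (1 + K) * K).

Lemma sum_meets_le (P : pred {fset L}) (X : {fset L}) (w : {fset L} -> R) :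
  (forall Z, 0 <= w Z) ->
  \sum_(Z <- fV | P Z && ~~ [disjoint Z & X]%fset) w Z <=
  \sum_(x <- X) \sum_(Z <- fV | P Z && (x \in Z)) w Z.
Proof.
move=> w0; rewrite big_mkcond /=.
under [leRHS]eq_bigr do rewrite big_mkcond /=.
rewrite exchange_big /= ler_sum// => Z _.
case: ifPn => [/andP[PZ]|_]; last by apply: sumr_ge0 => x _; case: ifP.
case: (boolP (has (fun x => x \in Z) X)) => [/hasP[x xX xZ] _|no].
  by rewrite (big_rem x)//= PZ xZ /= lerDl; apply: sumr_ge0 => y _; case: ifP.
case/negP; apply/fdisjointP => x xZ; apply: contra no => xX.
by apply/hasP; exists x.
Qed.

Lemma gen_le (P : pred {fset L}) : nrm (gen P) <= B.
Proof.
apply: le_trans (rnrm_sum N _ _ _) _.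
by rewrite big_mkcond ler_sum// => Z _; case: ifP => _ //; exact: (rnrm_ge0 N).
Qed.

Lemma evolve_gen_expand (P : pred {fset L}) (x : R) a : `|x| <= 1 ->
  nrm (ev P x a - (a + s x * comm (gen P) a)) <= K' * x ^+ 2 * nrm a.
Proof. by move=> x1; exact: (evolve_expand N (FU P)) (gen_le P) x1. Qed.

Lemma flow_constant_ge0 : 0 <= K.
Proof. exact: (flow_error_ge0 N (FU predT)). Qed.

Lemma expand_constant_ge0 : 0 <= K'.
Proof.
have K0 := flow_constant_ge0.
exact: addr_ge0 (addr_ge0 (sqr_ge0 _) K0) (mulr_ge0 (addr_ge0 ler01 K0) K0).
Qed.

(** Only the norm of the difference is claimed to vanish, because [nrm] is a seminorm: commutation
    of disjoint supports is itself known only up to norm zero. *)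
Lemma comm_gen_local (P : pred {fset L}) (X : {fset L}) a : S X a ->
  nrm (comm (gen P) a -
    comm (gen [pred Z | P Z && ~~ [disjoint Z & X]%fset]) a) = 0.
Proof.
move=> Xa; rewrite !comm_suml.
rewrite (bigID (fun Z => [disjoint Z & X]%fset)) /= addrK.
apply/le_anti; rewrite (rnrm_ge0 N) andbT.
apply: le_trans (rnrm_sum N _ _ _) _.
rewrite big_seq_cond big1// => Z /andP[ZV /andP[_ ZX]].
exact: Scomm (Sh ZV) Xa ZX.
Qed.

(* The Jacobi identity splits the increment into a norm preserving rotation of
   [comm (ev P t a) b] and a source term. *)
Lemma comm_increment (P : pred {fset L}) (X : {fset L}) a b (t x : R) :
  S X a -> 0 <= x <= 1 ->
  nrm (comm (ev P (t + x) a) b) <= nrm (comm (ev P t a) b)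
   + 2 * x * nrm a * (\sum_(Z <- fV | P Z && ~~ [disjoint Z & X]%fset)
                        nrm (comm (ev P t (h Z)) b))
   + 4 * K' * x ^+ 2 * nrm a * nrm b.
Proof.
move=> Xa /andP[x0 x1].
have nx1 : `|x| <= 1 by rewrite ger0_norm.
have a0 := rnrm_ge0 N a; have b0 := rnrm_ge0 N b; have K'0 := expand_constant_ge0.
set P' := [pred Z | P Z && ~~ [disjoint Z & X]%fset].
pose a1 := a + s x * comm (gen P') a.
have ea1 : nrm (ev P x a - a1) <= K' * x ^+ 2 * nrm a.
  apply: le_trans (evolve_gen_expand P a nx1); rewrite /a1.
  set c1 := comm (gen P) a; set c2 := comm (gen P') a.
  have -> : ev P x a - (a + s x * c2) =
     (ev P x a - (a + s x * c1)) + s x * (c1 - c2).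
    by rewrite mulrBr !opprD !addrA subrK.
  apply: le_trans (rnrmD N _ _) _; rewrite gerDl.
  by apply: le_trans (rnrmM N _ _) _; rewrite comm_gen_local// mulr0.
pose a' := ev P t a; pose h' := ev P t (gen P'); pose c := comm a' b.
have na' : nrm a' <= nrm a by exact: (rnrm_evolve N (FU P)).
have nc : nrm c <= 2 * nrm a * nrm b.
  by apply: le_trans (rnrm_comm N _ _) _; rewrite ler_wpM2r// ler_pM2l.
have -> : comm (ev P (t + x) a) b =
    (c + s x * comm h' c) - s x * comm a' (comm h' b)
    + comm (ev P t (ev P x a - a1)) b.
  rewrite -(evolve_evolve (FU P)) -[in LHS](subrK a1 (ev P x a)).
  rewrite (evolveD _ (ev P x a - a1) a1) commDl addrC; congr (_ + _).
  rewrite evolveD commDl -[RHS]addrA; congr (_ + _).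
  rewrite (evolve_s N) (evolve_comm (FU P)) -/h' -/a'.
  have -> : comm (s x * comm h' a') b = s x * comm (comm h' a') b.
    by move: (comm h' a') => q; rewrite /comm mulrBr !mulrA (scalarC N x b).
  by rewrite comm_jacobi mulrBr.
rewrite -addrA.
apply: le_trans (rnrmD N _ _) _; rewrite [leRHS](_ : _ =
  (nrm c + K' * x ^+ 2 * (2 * nrm a * nrm b)) +
  ((2 * x * nrm a *
    (\sum_(Z <- fV | P Z && ~~ [disjoint Z & X]%fset)
        nrm (comm (ev P t (h Z)) b))) +
   2 * (K' * x ^+ 2 * nrm a) * nrm b)); last first.
  by rewrite -/c; ring.
apply: lerD.
  (* Pulled back to time 0, [c + s x * comm h' c] is the first-order expansion of the evolution of
     [c0] under the terms in [P'], hence no larger than [c] up to order x^2. This is one reason to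
     have a flow for every predicate. *)
  pose c0 := ev P (- t) c.
  have cE : c = ev P t c0.
    by rewrite /c0 (evolve_evolve (FU P)) addrN (evolve0 (FU P)).
  have -> : c + s x * comm h' c = ev P t (c0 + s x * comm (gen P') c0).
    by rewrite evolveD (evolve_s N) (evolve_comm (FU P)) -cE.
  apply: le_trans (rnrm_evolve N (FU P) _ _) _.
  have nc0 : nrm c0 <= nrm c by exact: (rnrm_evolve N (FU P)).
  apply: le_trans (rnrm_le_sub N _ (ev P' x c0)) _; apply: lerD.
    by apply: le_trans nc0; exact: (rnrm_evolve N (FU P')).
  rewrite (rnrm_distC N).
  apply: le_trans (evolve_gen_expand P' c0 nx1) _.
  rewrite ler_wpM2l ?mulr_ge0 ?sqr_ge0//.
  exact: le_trans nc0 nc.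
apply: le_trans (rnrmD N _ _) _; apply: lerD; last first.
  apply: le_trans (rnrm_comm N _ _) _; rewrite ler_wpM2r// ler_wpM2l//.
  by apply: le_trans (rnrm_evolve N (FU P) _ _) _.
apply: le_trans (rnrmN N _) _.
apply: le_trans (rnrm_sM N _ _) _; rewrite ger0_norm//.
rewrite [leRHS](_ : _ = x * (2 * nrm a * \sum_(Z <- fV | P' Z)
        nrm (comm (ev P t (h Z)) b))); last by ring.
rewrite ler_wpM2l//.
apply: le_trans (rnrm_comm N _ _) _.
rewrite ler_pM ?mulr_ge0 ?(rnrm_ge0 N) ?ler_pM2l//.
by rewrite /h' evolve_sum comm_suml; exact: (rnrm_sum N).
Qed.

Section Propagation.
Variables (P : pred {fset L}) (D : L -> R) (rg v C0 : R) (Y : {fset L}) (b : T).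
Hypothesis rg0 : 0 < rg.
Hypothesis vC0 : 8 * C0 <= v.
Hypothesis Yb : S Y b.
Hypothesis DY : forall y, y \in Y -> D y <= 0.
Hypothesis Dlip : forall Z, Z \in fV -> P Z ->
  forall x z, x \in Z -> z \in Z -> D x - rg <= D z.
Hypothesis hC0 : forall x, \sum_(Z <- fV | P Z && (x \in Z))
  nrm (h Z) * #|` Z|%:R <= C0.

Local Notation phi t x := (expR (v * t - D x / rg)).

Lemma source_le (X : {fset L}) (t : R) :
  \sum_(Z <- fV | P Z && ~~ [disjoint Z & X]%fset)
    nrm (h Z) * (\sum_(z <- Z) phi t z) <= 4 * C0 * \sum_(x <- X) phi t x.
Proof.
apply: le_trans (sum_meets_le _ _ _) _.
  by move=> Z; rewrite mulr_ge0 ?(rnrm_ge0 N) ?sumr_ge0// => z _; exact: expR_ge0.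
rewrite mulr_sumr ler_sum// => x _.
rewrite [leRHS](_ : _ = C0 * (4 * phi t x)); last by ring.
apply: le_trans (ler_wpM2r _ (hC0 x)); last by rewrite mulr_ge0 ?expR_ge0.
rewrite mulr_suml big_seq_cond [leRHS]big_seq_cond ler_sum// => Z.
move=> /andP[ZV /andP[PZ xZ]].
rewrite -mulrA ler_wpM2l ?(rnrm_ge0 N)//.
have -> : #|` Z|%:R * (4 * phi t x) = \sum_(z <- Z) 4 * phi t x.
  by rewrite big_const_seq count_predT iter_addr_0 mulr_natl.
rewrite big_seq [leRHS]big_seq ler_sum// => z zZ.
apply: le_trans (_ : expR (1 + (v * t - D x / rg)) <= _).
  have := Dlip ZV PZ xZ zZ; have rgV : 0 < rg^-1 by rewrite invr_gt0.
  rewrite -(ler_pM2r rgV) mulrBl divff ?gt_eqF// => ?.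
  by rewrite ler_expR; lra.
by rewrite expRD ler_wpM2r ?expR_ge0// expR1_le4.
Qed.

(* The bound without its error term is a supersolution of [comm_increment]:
   this is [source_le] together with [1 + vx <= expR (vx)]. *)
Lemma lieb_robinson_discrete (x : R) (j : nat) (X : {fset L}) a :
  0 <= x <= 1 -> S X a ->
  nrm (comm (ev P (x *+ j) a) b) <= nrm a * nrm b *
    (2 * (\sum_(z <- X) phi (x *+ j) z)
     + 4 * K' * x ^+ 2 * j%:R * (1 + 2 * B * x) ^+ j).
Proof.
move=> x01; have /andP[x0 x1] := x01.
have b0 := rnrm_ge0 N b; have K'0 := expand_constant_ge0.
have B0 : 0 <= B by apply: sumr_ge0 => Z _; exact: (rnrm_ge0 N).
have Bx0 : 0 <= 2 * B * x by rewrite !mulr_ge0.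
elim: j X a => [|j IH] X a Xa; have a0 := rnrm_ge0 N a.
  rewrite [4 * K' * x ^+ 2 * _]mulr0 [0 * _]mul0r addr0 mulr0n (evolve0 (FU P)).
  have [XY|] := boolP [disjoint X & Y]%fset.
    rewrite (Scomm Xa Yb XY) !mulr_ge0// sumr_ge0// => z _; exact: expR_ge0.
  move=> XY; apply: le_trans (rnrm_comm N _ _) _.
  rewrite -mulrA [leLHS]mulrC ler_wpM2l ?mulr_ge0//.
  rewrite ler_peMr//.
  (* A common site has [D z <= 0], hence weight at least 1 at time 0, and the trivial bound
     [2 * nrm a * nrm b] suffices. *)
  have [z zX zY] : exists2 z, z \in X & z \in Y.
    apply/hasP; apply: contraNT XY => /hasPn no; apply/fdisjointP => z zX.
    exact: no.
  rewrite (big_rem z)//= mulr0 add0r.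
  apply: le_trans (_ : expR (- (D z / rg)) <= _); last first.
    by rewrite lerDl sumr_ge0// => ? _; exact: expR_ge0.
  rewrite -[leLHS]expR0 ler_expR oppr_ge0 pmulr_lle0 ?invr_gt0//.
  exact: DY.
rewrite mulrSr.
apply: le_trans (comm_increment _ _ _ Xa x01) _.
set t := x *+ j; set eps := 4 * K' * x ^+ 2 * j%:R * (1 + 2 * B * x) ^+ j.
set ph := \sum_(z <- X) phi t z.
have ph0 : 0 <= ph by apply: sumr_ge0 => z _; exact: expR_ge0.
have eps0 : 0 <= eps.
  by rewrite /eps !mulr_ge0 ?ler0n ?sqr_ge0 ?exprn_ge0// addr_ge0.
have Hsrc : \sum_(Z <- fV | P Z && ~~ [disjoint Z & X]%fset)
    nrm (comm (ev P t (h Z)) b) <= nrm b * (2 * (4 * C0 * ph) + B * eps).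
  apply: le_trans (_ : \sum_(Z <- fV | P Z && ~~ [disjoint Z & X]%fset)
    (nrm b * (2 * (nrm (h Z) * \sum_(z <- Z) phi t z)) + nrm b * (nrm (h Z) * eps)) <= _).
    rewrite big_seq_cond [leRHS]big_seq_cond ler_sum// => Z /andP[ZV _].
    apply: le_trans (IH _ _ (Sh ZV)) _.
    by rewrite le_eqVlt; apply/orP; left; apply/eqP; rewrite /eps; ring.
  rewrite big_split /= -!mulr_sumr mulrDr -!mulr_suml lerD//.
    by rewrite ler_wpM2l// ler_pM2l// source_le.
  rewrite ler_wpM2l// ler_wpM2r//.
  by rewrite big_mkcond ler_sum// => Z _; case: ifP => _ //; exact: (rnrm_ge0 N).
apply: le_trans (lerD (lerD (IH _ _ Xa) (ler_wpM2l _ Hsrc)) (lexx _)) _.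
  by rewrite !mulr_ge0.
rewrite -/t -/ph -/eps.
rewrite [leLHS](_ : _ = nrm a * nrm b *
  (2 * ((1 + 8 * C0 * x) * ph) + (eps * (1 + 2 * B * x) + 4 * K' * x ^+ 2))); last by ring.
rewrite ler_wpM2l ?mulr_ge0// lerD//.
  rewrite ler_pM2l// mulr_sumr ler_sum// => z _.
  rewrite mulrDr addrAC [leRHS]expRD mulrC ler_wpM2l ?expR_ge0//.
  apply: le_trans (expR_ge1Dx _); rewrite lerD2l ler_wpM2r//.
(* The error follows the recursion [e' = q e + 4 K' x^2]; since [q >= 1], the new summand may be
   multiplied by [q ^+ j.+1], which gives the closed form with factor [j.+1]. *)
set q := 1 + 2 * B * x; have q1 : 1 <= q by rewrite lerDl.
rewrite [leRHS](_ : _ = eps * q + 4 * K' * x ^+ 2 * q ^+ j.+1); last first.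
  by rewrite /eps -/q -[j.+1%:R]natr1 [q ^+ j.+1]exprSr; ring.
by rewrite lerD2l ler_peMr ?mulr_ge0 ?sqr_ge0// exprn_ege1.
Qed.

(** With n steps of length t/n the accumulated error is 4 K' (t^2 / n) (1 + 2 B t / n)^n, at most
    [M / n] because (1 + y/n)^n <= e^y; then n grows. *)
Lemma lieb_robinson (t : R) (X : {fset L}) a : 0 <= t -> S X a ->
  nrm (comm (ev P t a) b) <=
    nrm a * nrm b * (2 * \sum_(z <- X) phi t z).
Proof.
move=> t0 Xa.
have b0 := rnrm_ge0 N b; have K'0 := expand_constant_ge0; have a0 := rnrm_ge0 N a.
have B0 : 0 <= B by apply: sumr_ge0 => Z _; exact: (rnrm_ge0 N).
set M := 4 * K' * t ^+ 2 * expR (2 * B * t).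
have M0 : 0 <= M by rewrite !mulr_ge0 ?sqr_ge0 ?expR_ge0.
apply/ler_addgt0Pr => e e0.
have c0 : 0 < nrm a * nrm b * M + 1 by rewrite ltr_wpDl// !mulr_ge0.
pose n := (Num.truncn (Num.max t ((nrm a * nrm b * M + 1) / e))).+1.
have nn : Num.max t ((nrm a * nrm b * M + 1) / e) < n%:R.
  by rewrite /n truncnS_gt.
have n0 : 0 < n%:R :> R by rewrite ltr0n.
have tn : t <= n%:R by apply: le_trans (ltW nn); rewrite le_max lexx.
have en : nrm a * nrm b * M / n%:R <= e.
  rewrite ler_pdivrMr// -ler_pdivrMl// mulrC.
  apply: le_trans (ltW nn); rewrite le_max; apply/orP; right.
  by rewrite ler_pM2r ?invr_gt0// lerDl.
have x01 : 0 <= t / n%:R <= 1.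
  by rewrite divr_ge0 ?ler0n//= ler_pdivrMr// mul1r.
have := lieb_robinson_discrete n x01 Xa.
rewrite -[(t / n%:R) *+ n]mulr_natr divfK ?gt_eqF// => /le_trans; apply.
rewrite mulrDr lerD2l; apply: le_trans en.
rewrite -[leRHS]mulrA ler_wpM2l ?mulr_ge0//.
rewrite /M [leRHS](_ : _ = 4 * K' * (t / n%:R) ^+ 2 * n%:R * expR (2 * B * t)); last first.
  by rewrite expr_div_n; field; rewrite gt_eqF.
rewrite ler_wpM2l ?mulr_ge0 ?sqr_ge0 ?ler0n//.
rewrite [X in expR X](_ : _ = 2 * B * (t / n%:R) * n%:R); last first.
  by rewrite -!mulrA mulVf ?mulr1// gt_eqF.
rewrite expRM_natr; apply: lerXn2r; rewrite ?nnegrE ?expR_ge0 ?expR_ge1Dx//.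
by rewrite addr_ge0// !mulr_ge0//; case/andP: x01.
Qed.

End Propagation.

(** * Duhamel comparison of two truncations *)

Section Duhamel.
Variables (P Q : pred {fset L}) (a : T) (M : R).
Local Notation P1 := [pred Z | P Z && Q Z].

(** A telescoping sum: the difference accumulated so far is carried along by [ev P] without growth,
    and each new step adds the action of the discarded terms on the already truncated evolution. *)
Lemma duhamel_discrete (x : R) (j : nat) : 0 <= x <= 1 ->
  (forall u, 0 <= u <= x *+ j ->
    nrm (\sum_(Z <- fV | P Z && ~~ Q Z) comm (h Z) (ev P1 u a)) <= M) ->
  nrm (ev P (x *+ j) a - ev P1 (x *+ j) a)
    <= j%:R * (x * M + 2 * K' * x ^+ 2 * nrm a).
Proof.
move=> x01; have /andP[x0 x1] := x01.
have nx1 : `|x| <= 1 by rewrite ger0_norm.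
have K'0 := expand_constant_ge0.
elim: j => [|j IH] HM.
  by rewrite mulr0n (evolve0 (FU P)) (evolve0 (FU P1)) subrr (rnrm0 N) mul0r.
rewrite mulrS -(evolve_evolve (FU P)) -(evolve_evolve (FU P1)).
set E := ev P (x *+ j) a; set F := ev P1 (x *+ j) a.
have nF : nrm F <= nrm a by exact: (rnrm_evolve N (FU P1)).
have -> : ev P x E - ev P1 x F = ev P x (E - F) + (ev P x F - ev P1 x F).
  by rewrite evolveD evolveN addrA subrK.
apply: le_trans (rnrmD N _ _) _.
rewrite -[j.+1%:R]natr1 mulrDl mul1r; apply: lerD.
  apply: le_trans (rnrm_evolve N (FU P) _ _) _; apply: IH => u /andP[u0 uj].
  by apply: HM; rewrite u0 mulrSr (le_trans uj)// lerDl.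
set c := comm (gen P) F; set c1 := comm (gen P1) F.
have -> : ev P x F - ev P1 x F = s x * (c - c1) +
    ((ev P x F - (F + s x * c)) - (ev P1 x F - (F + s x * c1))).
  rewrite mulrBr; move: (ev P x F) (ev P1 x F) (s x * c) (s x * c1) => p q y z.
  have zy : (F + z) - (F + y) = z - y by rewrite opprD addrACA subrr add0r.
  rewrite opprB (addrC (F + z) (- q)) [X in _ = _ + X]addrACA.
  by rewrite (addrC (- _) (F + z)) zy addrCA [X in _ = _ + X]addrA subrK subrr addr0.
apply: le_trans (rnrmD N _ _) _; apply: lerD.
  apply: le_trans (rnrm_sM N _ _) _; rewrite ger0_norm// ler_wpM2l//.
  have -> : c - c1 = \sum_(Z <- fV | P Z && ~~ Q Z) comm (h Z) F.
    by rewrite /c /c1 !comm_suml (bigID Q) /= addrC addrK.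
  by apply: HM; rewrite mulrn_wge0//= mulrSr lerDl.
apply: le_trans (rnrmB N _ _) _.
apply: le_trans (lerD (evolve_gen_expand _ _ nx1) (evolve_gen_expand _ _ nx1)) _.
rewrite -mulr2n -[leLHS]mulr_natl !mulrA -!mulrA !ler_wpM2l ?sqr_ge0//.
Qed.

Lemma duhamel (t : R) : 0 <= t ->
  (forall u, 0 <= u <= t ->
    nrm (\sum_(Z <- fV | P Z && ~~ Q Z) comm (h Z) (ev P1 u a)) <= M) ->
  nrm (ev P t a - ev P1 t a) <= t * M.
Proof.
move=> t0 HM; have K'0 := expand_constant_ge0; have a0 := rnrm_ge0 N a.
set D := 2 * K' * t ^+ 2 * nrm a.
have D0 : 0 <= D by rewrite !mulr_ge0 ?sqr_ge0.
apply/ler_addgt0Pr => e e0.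
pose n := (Num.truncn (Num.max t (D / e))).+1.
have nn : Num.max t (D / e) < n%:R by rewrite /n truncnS_gt.
have n0 : 0 < n%:R :> R by rewrite ltr0n.
have x01 : 0 <= t / n%:R <= 1.
  rewrite divr_ge0 ?ler0n//= ler_pdivrMr// mul1r.
  by apply: le_trans (ltW nn); rewrite le_max lexx.
have tE : (t / n%:R) *+ n = t by rewrite -[LHS]mulr_natr divfK ?gt_eqF.
have := duhamel_discrete x01 (j := n); rewrite tE => /(_ HM) /le_trans; apply.
rewrite mulrDr mulrA [n%:R * _]mulrC divfK ?gt_eqF// lerD2l.
rewrite [leLHS](_ : _ = D / n%:R); last by rewrite /D; field; rewrite gt_eqF.
rewrite ler_pdivrMr// -ler_pdivrMl// mulrC.
by apply: le_trans (ltW nn); rewrite le_max lexx orbT.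
Qed.

(** In the error [b] enters only through its norm. What has to decay is the commutator of the
    truncated evolution with the discarded terms, so a bound for the truncated dynamics feeds one
    for the full dynamics. *)
Lemma truncation (w : {fset L} -> R) (t : R) b : 0 <= t ->
  (forall u Z, 0 <= u <= t -> Z \in fV -> P Z -> ~~ Q Z ->
    nrm (comm (ev P1 u a) (h Z)) <= nrm a * nrm (h Z) * w Z) ->
  M = nrm a * \sum_(Z <- fV | P Z && ~~ Q Z) nrm (h Z) * w Z ->
  nrm (comm (ev P t a) b) <= nrm (comm (ev P1 t a) b) + 2 * (t * M) * nrm b.
Proof.
move=> t0 Hw EM.
rewrite -[in leLHS](subrK (ev P1 t a) (ev P t a)) commDl addrC.
apply: le_trans (rnrmD N _ _) _; rewrite lerD2l.
apply: le_trans (rnrm_comm N _ _) _.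
rewrite ler_wpM2r ?(rnrm_ge0 N)// ler_pM2l//; apply: duhamel => // u u0t.
apply: le_trans (rnrm_sum N _ _ _) _.
rewrite EM mulr_sumr big_seq_cond [leRHS]big_seq_cond ler_sum// => Z.
move=> /andP[ZV /andP[PZ QZ]].
rewrite /comm (rnrm_distC N) mulrA; exact: Hw.
Qed.

End Duhamel.
End LiebRobinson.

(** * Lattice sums *)

Section Lattice.
Context {R : realType} {d : nat} {L : choiceType}.
Variable pos : L -> 'rV[R]_d.
Hypothesis sep : unit_separated pos.
Local Notation dist := (dist pos).

Lemma dist_coord x z i : `|pos x 0 i - pos z 0 i| <= dist x z.
Proof.
rewrite /dist -sqrtr_sqr ler_wsqrtr// (bigD1 i)//= lerDl.
by apply: sumr_ge0 => j _; exact: sqr_ge0.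
Qed.

(** Such coordinates give a squared distance of at most d/(d+1) < 1, against the unit separation.
    Using d+1 keeps the inequality strict and covers d = 0. *)
Lemma close_coord_eq x z :
  (forall i, `|pos x 0 i - pos z 0 i| * d.+1%:R < 1) -> x = z.
Proof.
move=> H; apply/eqP; apply: contraT => /sep; rewrite leNgt => /negP[].
rewrite -sqrtr1 /dist ltr_sqrt// .
have d1 : 0 < d.+1%:R :> R by rewrite ltr0n.
apply: le_lt_trans (_ : \sum_(i < d) (d.+1%:R^-1 : R) < _).
  apply: ler_sum => i _; rewrite -real_normK ?num_real//.
  have Hi : `|pos x 0 i - pos z 0 i| <= d.+1%:R^-1.
    by rewrite -[leRHS]mul1r ler_pdivlMr// ltW.
  apply: le_trans (_ : d.+1%:R^-1 ^+ 2 <= _); first by rewrite lerXn2r ?nnegrE ?invr_ge0 ?ler0n.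
  by rewrite expr2 ler_piMr ?invr_ge0 ?ler0n// invf_le1// ler1n.
rewrite sumr_const card_ord -[ltLHS]mulr_natl ltr_pdivrMr// mul1r ltr_nat.
exact: ltnSn.
Qed.

(** Pigeonhole: a cubic cell of side 1/(d+1) holds at most one site, and the ball meets at most [n]
    cells per direction. The hypothesis [1 <= rho] absorbs the additive 1 of the rounding. *)
Lemma card_ball (V : {fset L}) x (rho : R) : 1 <= rho ->
  #|` [fset z in V | dist x z <= rho]%fset|%:R <= ((2 * d.+1%:R + 1) * rho) ^+ d.
Proof.
move=> rho1; set s : R := d.+1%:R.
have s0 : 0 < s by rewrite ltr0n.
have rho0 : 0 <= rho by apply: le_trans rho1.
set n := (Num.truncn (2 * rho * s)).+1.
set W := [fset z in V | dist x z <= rho]%fset.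
pose c (z : W) (i : 'I_d) := (pos (val z) 0 i - pos x 0 i + rho) * s.
have Wc (z : W) i : 0 <= c z i <= 2 * rho * s.
  have : val z \in W by exact: valP.
  rewrite !inE => /andP[_ /= zr].
  have := le_trans (dist_coord x (val z) i) zr.
  rewrite ler_norml => /andP[h1 h2]; apply/andP; split.
    by rewrite mulr_ge0 ?(ltW s0)//; lra.
  by rewrite ler_pM2r//; lra.
pose f (z : W) : {ffun 'I_d -> 'I_n} := [ffun i => inord (Num.truncn (c z i))].
have finj : injective f.
  move=> z z' /ffunP ff; apply: val_inj; apply: close_coord_eq => i.
  have := ff i; rewrite !ffunE => /(congr1 val) /=.
  have tn (y : W) : (Num.truncn (c y i) < n)%N.
    rewrite ltnS; apply: le_truncn; by case/andP: (Wc y i).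
  rewrite !inordK// => e.
  have /andP[c0 _] := Wc z i; have /andP[c0' _] := Wc z' i.
  have /andP[a1 a2] := truncn_itv c0; have /andP[b1 b2] := truncn_itv c0'.
  have -> : `|pos (val z) 0 i - pos (val z') 0 i| * s = `|c z i - c z' i|.
    by rewrite -[s in LHS]gtr0_norm// -normrM; congr (`| _ |); rewrite /c; ring.
  rewrite ltr_norml; rewrite e in a1 a2.
  rewrite -natr1 in a2 b2; apply/andP; split; lra.
have := leq_card f finj; rewrite card_ffun !card_ord -cardfE => cW.
apply: le_trans (_ : n%:R ^+ d <= _); first by rewrite -natrX ler_nat.
apply: lerXn2r; rewrite ?nnegrE ?ler0n ?mulr_ge0 ?addr_ge0 ?ler0n//.
  by rewrite mulr_ge0 ?ltW.
rewrite /n -natr1 [leRHS]mulrDl [1 * rho]mul1r. rewrite lerD//.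
by rewrite mulrAC truncn_le !mulr_ge0// ltW.
Qed.

Definition tail_weight (l p r : R) : R := if r <= l then 1 else (l / r) `^ p.

Lemma tail_weight_ge0 l p r : 0 <= tail_weight l p r.
Proof. by rewrite /tail_weight; case: ifP => // _; exact: powR_ge0. Qed.

(** On the shell 2^(j-1) l < r <= 2^j l the weight is at most 2^p 2^(-pj), which is the j-th summand
    on the right. The weight is thus dominated by indicators of balls, for which a count of sites is
    available. *)
Lemma tail_weight_dyadic l p r (J : nat) : 0 < l -> 0 <= p -> r <= 2 ^+ J * l ->
  tail_weight l p r <=
    2 `^ p * \sum_(j < J.+1) (if r <= 2 ^+ j * l then (2 `^ (- p)) ^+ j else 0).
Proof.
move=> l0 p0; have p2 : 1 <= 2 `^ p :> R.
  by have := @ler_powR R 2 (ler1n _ 2) _ _ p0; rewrite powRr0.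
elim: J => [|J IH] rJ.
  rewrite big_ord1 /= rJ expr0 mulr1 /tail_weight.
  by rewrite expr0 mul1r in rJ; rewrite rJ.
rewrite big_ord_recr /= rJ.
have [rJ'|rJ'] := leP r (2 ^+ J * l).
  apply: le_trans (IH rJ') _; rewrite ler_pM2l ?(lt_le_trans ltr01 p2)//.
  by rewrite lerDl exprn_ge0// powR_ge0.
rewrite mulrDr; apply: le_trans (_ : 2 `^ p * (2 `^ (- p)) ^+ J.+1 <= _); last first.
  rewrite lerDr mulr_ge0 ?powR_ge0// sumr_ge0// => j _.
  by case: ifP => // _; rewrite exprn_ge0 ?powR_ge0.
have lr : l < r.
  by apply: le_lt_trans rJ'; rewrite ler_peMl ?(ltW l0)// exprn_ege1// ler1n.
have r0 : 0 < r by exact: lt_trans lr.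
rewrite /tail_weight ifN -?ltNge//.
rewrite exprS mulrA -powRD ?subrr ?powRr0 ?mul1r; last by rewrite pnatr_eq0 implybT.
have -> : (2 `^ (- p)) ^+ J = (2 `^ (- J%:R)) `^ p :> R.
  rewrite -powR_mulrn; last exact: powR_ge0.
  by rewrite -!powRrM mulNr [p * _]mulrC mulNr.
rewrite ge0_ler_powR ?nnegrE ?powR_ge0 ?divr_ge0 ?(ltW l0) ?(ltW r0)//.
rewrite powRN powR_mulrn ?ler0n// ler_pdivrMr// ler_pdivlMl// ?exprn_gt0//.
exact: ltW.
Qed.

(** The ball of radius 2^j l has at most c (2^j l)^d sites, each of weight about 2^(-pj). This
    leaves a geometric series of ratio 2^(-eta), uniformly in the finite set [V]. *)
Lemma sum_tail_weight (eta : R) : 0 < eta -> exists2 C : R, 1 <= C &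
  forall (V : {fset L}) x (l : R), 1 <= l ->
    \sum_(z <- V) tail_weight l (d%:R + eta) (dist x z) <= C * l `^ d%:R.
Proof.
move=> eta0; set p := d%:R + eta.
have p0 : 0 <= p by rewrite addr_ge0 ?ler0n ?ltW.
set q : R := 2 `^ (- eta).
have q1 : q < 1.
  rewrite /q powRN invf_lt1 ?powR_gt0//.
  by have := @gt0_ltr_powR R eta eta0 1 2; rewrite powR1;
    apply; rewrite ?nnegrE ?ler01 ?ler0n ?ltr1n.
have q0 : 0 <= q by exact: powR_ge0.
have p2 : 1 <= 2 `^ p :> R by have := @ler_powR R 2 (ler1n _ 2) _ _ p0; rewrite powRr0.
set c : R := (2 * d.+1%:R + 1) ^+ d.
have c1 : 1 <= c by rewrite exprn_ege1// lerDr mulr_ge0.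
exists (2 `^ p * c / (1 - q)).
  rewrite ler_pdivlMr ?subr_gt0// mul1r.
  by rewrite (le_trans (_ : _ <= 1))// ?gerBl// (le_trans p2)// ler_peMr// powR_ge0.
move=> V x l l1; have l0 : 0 < l by exact: lt_le_trans l1.
have [J HJ] : exists J : nat, forall z, z \in V -> dist x z <= 2 ^+ J * l.
  exists (Num.truncn (\sum_(z <- V) dist x z)).+1 => z zV.
  apply: le_trans (_ : \sum_(z <- V) dist x z <= _).
    rewrite (big_rem z)//= lerDl; apply: sumr_ge0 => y _; exact: sqrtr_ge0.
  apply: le_trans (ltW (truncnS_gt _)) _.
  set n := _.+1; apply: le_trans (_ : 2 ^+ n <= _); last by rewrite ler_peMr// exprn_ge0.
  by rewrite -natrX ler_nat ltnW// ltn_expl.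
apply: le_trans (_ : \sum_(z <- V) 2 `^ p * \sum_(j < J.+1)
    (if dist x z <= 2 ^+ j * l then (2 `^ (- p)) ^+ j else 0) <= _).
  rewrite big_seq [leRHS]big_seq ler_sum// => z zV.
  exact: tail_weight_dyadic (HJ _ zV).
rewrite -mulr_sumr -!mulrA ler_wpM2l ?powR_ge0// exchange_big /=.
apply: le_trans (_ : \sum_(j < J.+1) c * l ^+ d * q ^+ j <= _).
  apply: ler_sum => j _.
  rewrite -big_mkcond /= big_const_seq iter_addr_0 -[leLHS]mulr_natr.
  set cnt := count _ _.
  have -> : cnt = #|` [fset z in V | dist x z <= 2 ^+ j * l]%fset|.
    rewrite /cnt -size_filter; apply/perm_size/uniq_perm.
    - exact: filter_uniq.
    - exact: fset_uniq.
    - by move=> z; rewrite mem_filter !inE /= andbC.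
  have j1 : 1 <= 2 ^+ j * l by rewrite -[leLHS]mul1r ler_pM// exprn_ege1// ler1n.
  apply: le_trans (ler_wpM2l _ (card_ball V x j1)) _; first by rewrite exprn_ge0// powR_ge0.
  rewrite !exprMn -/c.
  rewrite [leLHS](_ : _ = c * l ^+ d * ((2 `^ (- p)) ^+ j * (2 ^+ j) ^+ d)); last by ring.
  rewrite ler_wpM2l ?mulr_ge0 ?exprn_ge0 ?(le_trans ler01 c1) ?(ltW l0)//.
  rewrite -exprM mulnC exprM -exprMn -powR_mulrn ?ler0n// -powRD.
    by rewrite /p opprD addrAC addNr add0r.
  by rewrite pnatr_eq0 implybT.
rewrite -mulr_sumr powR_mulrn ?(ltW l0)// -[leLHS]mulrA ler_wpM2l ?(le_trans ler01 c1)//.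
rewrite mulrC ler_wpM2r ?exprn_ge0 ?(ltW l0)//.
rewrite -[leRHS]mul1r ler_pdivlMr ?subr_gt0//.
have := subrX1 q J.+1; have := exprn_ge0 J.+1 q0.
by move: (q ^+ J.+1) (\sum_(_ < _) _) => a b a0 e; lra.
Qed.

End Lattice.

(** For A', B' > 0, convexity gives (f + g)^2 <= (A'+B')/A' f^2 + (A'+B')/B' g^2 termwise, and
    summing is enough. Possibly vanishing [A] or [B] are reached by adding e/2 to each. *)
Lemma minkowski2 {R : realType} (I : Type) (r : seq I) (f g : I -> R) (A B : R) :
  0 <= A -> 0 <= B ->
  \sum_(i <- r) f i ^+ 2 <= A ^+ 2 -> \sum_(i <- r) g i ^+ 2 <= B ^+ 2 ->
  \sum_(i <- r) (f i + g i) ^+ 2 <= (A + B) ^+ 2.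
Proof.
move=> A0 B0 fA gB.
have pos (A' B' : R) : 0 < A' -> 0 < B' -> A <= A' -> B <= B' ->
    \sum_(i <- r) (f i + g i) ^+ 2 <= (A' + B') ^+ 2.
  move=> A'0 B'0 AA' BB'.
  apply: le_trans (_ : \sum_(i <- r) ((A' + B') / A' * f i ^+ 2 + (A' + B') / B' * g i ^+ 2) <= _).
    apply: ler_sum => i _; rewrite -subr_ge0.
    rewrite (_ : _ - _ = (B' * f i - A' * g i) ^+ 2 / (A' * B')).
      by rewrite divr_ge0 ?sqr_ge0// mulr_ge0// ltW.
    by field; rewrite !gt_eqF.
  rewrite big_split /= -!mulr_sumr.
  have fA' : \sum_(i <- r) f i ^+ 2 <= A' ^+ 2.
    by apply: le_trans fA _; rewrite lerXn2r ?nnegrE// (le_trans A0).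
  have gB' : \sum_(i <- r) g i ^+ 2 <= B' ^+ 2.
    by apply: le_trans gB _; rewrite lerXn2r ?nnegrE// (le_trans B0).
  have AB0 : 0 < A' + B' by exact: addr_gt0.
  apply: le_trans (lerD (ler_wpM2l _ fA') (ler_wpM2l _ gB')) _.
  - by rewrite divr_ge0 ?ltW.
  - by rewrite divr_ge0 ?ltW.
  rewrite le_eqVlt; apply/orP; left; apply/eqP.
  by field; rewrite !gt_eqF.
have S0 : 0 <= \sum_(i <- r) (f i + g i) ^+ 2 by apply: sumr_ge0 => i _; exact: sqr_ge0.
rewrite -(sqr_sqrtr S0) lerXn2r ?nnegrE ?sqrtr_ge0 ?addr_ge0//.
apply/ler_addgt0Pr => e e0.
have e2 : 0 < e / 2 by rewrite divr_gt0.
have := @pos (A + e / 2) (B + e / 2); rewrite !ltr_wpDl// !lerDl ltW// => /(_ isT isT isT isT) h.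
rewrite -(ler_sqr (x := Num.sqrt _)) ?nnegrE ?sqrtr_ge0 ?addr_ge0 ?(ltW e0)//.
rewrite sqr_sqrtr// (le_trans h)// le_eqVlt; apply/orP; left; apply/eqP.
by congr (_ ^+ 2); lra.
Qed.

Lemma argmin_fset {R : realType} {L : choiceType} (Z : {fset L}) (g : L -> R) :
  Z != fset0 -> exists2 z, z \in Z & forall y, y \in Z -> g z <= g y.
Proof.
move=> /fset0Pn[z0 z0Z].
pose z1 := [arg min_(i < FSetSub z0Z) g (val i)]%O.
exists (val z1); first exact: valP.
rewrite /z1; case: Order.TotalTheory.arg_minP => //= i _ Hi y yZ.
exact: (Hi (FSetSub yZ)).
Qed.

(** * Euclidean distance and distance to a finite set *)

Section Distance.
Context {R : realType} {d : nat} {L : choiceType}.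
Variable pos : L -> 'rV[R]_d.
Local Notation dist := (dist pos).

Lemma dist_ge0 x y : 0 <= dist x y. Proof. exact: sqrtr_ge0. Qed.

Lemma dist_triangle x y z : dist x z <= dist x y + dist y z.
Proof.
have sq u w : \sum_(i < d) (pos u 0 i - pos w 0 i) ^+ 2 <= dist u w ^+ 2.
  by rewrite sqr_sqrtr// sumr_ge0// => i _; exact: sqr_ge0.
have := minkowski2 (dist_ge0 x y) (dist_ge0 y z) (sq x y) (sq y z).
under eq_bigr do rewrite addrA subrK.
move=> h; rewrite -(ler_sqr (x := dist x z)) ?nnegrE ?addr_ge0 ?dist_ge0//.
by rewrite sqr_sqrtr// sumr_ge0// => i _; exact: sqr_ge0.
Qed.

Lemma dist_le_diam (Z : {fset L}) x y : x \in Z -> y \in Z -> dist x y <= diam pos Z.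
Proof.
move=> xZ yZ; apply: ub_le_sup; last by exists (x, y).
exists (\sum_(p <- Z) \sum_(q <- Z) dist p q) => _ [[p q] [/= pZ qZ] <-].
rewrite (big_rem p)//= (big_rem q)//= -addrA lerDl addr_ge0 ?sumr_ge0// => i _.
  exact: dist_ge0.
by apply: sumr_ge0 => j _; exact: dist_ge0.
Qed.

Lemma diam_fset0 : diam pos fset0 = 0.
Proof.
rewrite /diam; have -> : [set dist p.1 p.2 | p in [set` fset0] `*` [set` fset0]] = set0.
  by apply/seteqP; split => // z [p [/= + _] _]; rewrite in_fset0.
exact: sup0.
Qed.

Definition fdist (Z : {fset L}) (x : L) : R := inf [set dist x z | z in [set` Z]].

Lemma fdist_le (Z : {fset L}) x z : z \in Z -> fdist Z x <= dist x z.
Proof.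
move=> zZ; apply: ge_inf; last by exists z.
by exists 0 => _ [y _ <-]; exact: dist_ge0.
Qed.

Lemma fdist_attained (Z : {fset L}) x : Z != fset0 ->
  exists2 z, z \in Z & fdist Z x = dist x z.
Proof.
move=> Z0; have [z zZ zmin] := argmin_fset (dist x) Z0.
exists z => //; apply/le_anti; rewrite fdist_le//=.
by apply: lb_le_inf => [|_ [y yZ <-]]; [exists (dist x z), z|exact: zmin].
Qed.

Lemma fdist_lipschitz (Z : {fset L}) x y : Z != fset0 ->
  fdist Z x <= dist x y + fdist Z y.
Proof.
move=> /(fdist_attained y)[z zZ ->].
by apply: le_trans (fdist_le x zZ) _; exact: dist_triangle.
Qed.

End Distance.

Lemma expR_decay {R : realType} (p w : R) : 0 < p -> 0 < w ->
  expR (- w) <= p `^ p * w `^ (- p).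
Proof.
move=> p0 w0; have wp0 : 0 < w / p by exact: divr_gt0.
have h : (w / p) `^ p <= expR w.
  rewrite -{2}(divfK (lt0r_neq0 p0) w) expRM ge0_ler_powR ?nnegrE ?(ltW p0) ?(ltW wp0) ?expR_ge0//.
  by apply: le_trans (expR_ge1Dx _); rewrite lerDr.
have e : w `^ p = (w / p) `^ p * p `^ p.
  by rewrite -powRM ?(ltW p0) ?(ltW wp0)// divfK// gt_eqF.
rewrite expRN powRN e invfM mulrCA divff ?mulr1 ?gt_eqF ?powR_gt0//.
by rewrite lef_pV2 ?posrE ?expR_gt0 ?powR_gt0.
Qed.

(** Here tau - m w <= m (1 - w) <= 1 - w, so the time disappears and only a power of the rescaled
    distance [w] remains; the factor 4 bounds e. *)
Lemma expR_decay_scaled {R : realType} (p tau m w : R) :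
  0 < p -> tau <= m -> 1 <= m -> 1 <= w ->
  expR (tau - m * w) <= 4 * p `^ p * w `^ (- p).
Proof.
move=> p0 tm m1 w1.
apply: le_trans (_ : expR (1 - w) <= _); first by rewrite ler_expR; nra.
rewrite expRD -mulrA ler_pM ?expR_ge0 ?expR1_le4//.
by apply: expR_decay => //; exact: lt_le_trans w1.
Qed.

Lemma le_interpolate {R : realType} (x a b c : R) : 0 <= x -> x <= a -> x <= b ->
  0 <= c <= 1 -> x <= a `^ c * b `^ (1 - c).
Proof.
rewrite le_eqVlt => /predU1P[<- *|x0 xa xb /andP[c0 c1]].
  by rewrite mulr_ge0 ?powR_ge0.
apply: le_trans (_ : x `^ c * x `^ (1 - c) <= _).
  rewrite -powRD; last by rewrite (gt_eqF x0) implybT.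
  by rewrite (_ : c + (1 - c) = 1) ?powRr1 ?(ltW x0)//; lra.
have x0' := ltW x0.
by apply: ler_pM; rewrite ?powR_ge0// ge0_ler_powR ?nnegrE ?subr_ge0//;
  exact: le_trans x0' _.
Qed.

(** * Improving the decay by truncation *)

Section Iteration.
Context {R : realType} {d : nat} {L : choiceType} {T : pzRingType}.
Variables (pos : L -> 'rV[R]_d) (nrm : T -> R) (s : R -> T).
Variables (S : {fset L} -> T -> Prop).
Variables (fV : seq {fset L}) (h : {fset L} -> T).
Variables (U : pred {fset L} -> R -> T) (K : R).
Hypothesis N : is_ring_norm nrm s.
Hypothesis Scomm : forall X Y a b, S X a -> S Y b -> [disjoint X & Y]%fset ->
  nrm (comm a b) = 0.
Hypothesis Sh : forall Z, Z \in fV -> S Z (h Z).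
Hypothesis FU : forall P : pred {fset L},
  is_flow nrm s K (\sum_(Z <- fV | P Z) h Z) (U P).

Variables (V : {fset L}) (J C0 v alpha sigma eta Cl : R).
Hypothesis fV_sub : forall Z, Z \in fV -> (Z `<=` V)%fset.
Hypothesis J0 : 0 <= J.
Hypothesis vC0 : 8 * C0 <= v.
Hypothesis vJ : 2 * J <= v.
Hypothesis sigma0 : 0 < sigma.
Hypothesis sigma1 : sigma < 1.
Hypothesis eta0 : 0 < eta.
Hypothesis eta1 : eta <= 1.
Hypothesis Cl1 : 1 <= Cl.
Hypothesis exponents : d%:R + 1 - sigma <= sigma * alpha.
Hypothesis hJ : forall x r, 0 < r ->
  \sum_(Z <- fV | (x \in Z) && (r <= diam pos Z)) nrm (h Z) <= J * r `^ (- alpha).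
Hypothesis hC0 : forall x,
  \sum_(Z <- fV | x \in Z) nrm (h Z) * #|` Z|%:R <= C0.
Hypothesis lattice : forall x l, 1 <= l ->
  \sum_(z <- V) tail_weight l (d%:R + eta) (dist pos x z) <= Cl * l `^ d%:R.

Variables (X : {fset L}) (a : T).
Hypothesis X0 : X != fset0.
Hypothesis Xa : S X a.

Local Notation ev P := (evolve (U P)).
Local Notation p := (d%:R + eta).
Local Notation cut P r := [pred Z | P Z && (diam pos Z < r)].

Lemma trivial_comm (P : pred {fset L}) t b :
  nrm (comm (ev P t a) b) <= nrm a * nrm b * 2.
Proof.
apply: le_trans (rnrm_comm N _ _) _; rewrite -mulrA mulrC ler_pM2r//.
by rewrite ler_wpM2r ?(rnrm_ge0 N)// (rnrm_evolve N (FU P)).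
Qed.

(** The distance to [Y] serves as the function [D]: it is 1-Lipschitz, hence varies by at most [rg]
    on a set of diameter below [rg]. *)
Lemma lieb_robinson_cut (P : pred {fset L}) (rg t : R) Y b :
  0 < rg -> 0 <= t -> S Y b -> Y != fset0 ->
  nrm (comm (ev (cut P rg) t a) b) <=
    nrm a * nrm b * (2 * \sum_(x <- X) expR (v * t - fdist pos Y x / rg)).
Proof.
move=> rg0 t0 Yb Y0.
apply: (lieb_robinson (P := cut P rg) N Scomm Sh FU rg0 vC0 Yb) => //.
- move=> y yY; apply: le_trans (fdist_le pos y yY) _.
  by rewrite /dist big1 ?sqrtr0// => i _; rewrite subrr expr0n.
- move=> Z _ /andP[_ Zr] x z xZ zZ; rewrite lerBlDl.
  apply: le_trans (fdist_lipschitz pos x z Y0) _.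
  by rewrite lerD2r ltW// (le_lt_trans (dist_le_diam pos xZ zZ)).
- move=> x; apply: le_trans (hC0 x); rewrite big_mkcond [leRHS]big_mkcond.
  apply: ler_sum => Z _; case: (x \in Z); rewrite ?andbF// andbT.
  by case: ifP => // _; rewrite mulr_ge0 ?(rnrm_ge0 N).
Qed.

Lemma lieb_robinson_far (P : pred {fset L}) (rg t r : R) Y b :
  0 < rg -> 0 <= t -> S Y b -> Y != fset0 ->
  (forall x, x \in X -> r <= fdist pos Y x) ->
  nrm (comm (ev (cut P rg) t a) b) <=
    nrm a * nrm b * (2 * #|` X|%:R * expR (v * t - r / rg)).
Proof.
move=> rg0 t0 Yb Y0 far; apply: le_trans (lieb_robinson_cut P rg0 t0 Yb Y0) _.
rewrite ler_wpM2l ?mulr_ge0 ?(rnrm_ge0 N)// -mulrA ler_pM2l//.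
rewrite [leRHS](_ : _ = \sum_(x <- X) expR (v * t - r / rg)).
  rewrite big_seq [leRHS]big_seq ler_sum// => x xX.
  by rewrite ler_expR lerD2l lerN2 ler_pM2r ?invr_gt0// far.
by rewrite big_const_seq count_predT iter_addr_0 mulr_natl.
Qed.

(** The weight of [Z] seen from [x] is that of its nearest site, hence at most the sum over all its
    sites. After exchanging sums, the terms through a fixed [z] give [J * rg^(-alpha)] and the sum
    over [z] is the lattice sum. *)
Lemma tail_sum_le (P : pred {fset L}) (rg l : R) : 0 < rg -> 1 <= l ->
  \sum_(Z <- fV | P Z && ~~ (diam pos Z < rg))
     nrm (h Z) * (\sum_(x <- X) tail_weight l p (fdist pos Z x))
  <= J * rg `^ (- alpha) * #|` X|%:R * (Cl * l `^ d%:R).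
Proof.
move=> rg0 l1.
apply: le_trans (_ : \sum_(Z <- fV | rg <= diam pos Z) \sum_(x <- X) \sum_(z <- V)
   (if z \in Z then nrm (h Z) * tail_weight l p (dist pos x z) else 0) <= _).
  rewrite big_mkcond [leRHS]big_mkcond /= big_seq [leRHS]big_seq ler_sum// => Z ZV.
  rewrite -leNgt; case: (leP rg) => dZ; rewrite ?andbF// andbT.
  have Z0 : Z != fset0.
    by apply: contraTN rg0 => /eqP Z0; rewrite Z0 diam_fset0 in dZ; rewrite -leNgt.
  case: ifP => _; last first.
    apply: sumr_ge0 => x _; apply: sumr_ge0 => z _.
    by case: ifP => // _; rewrite mulr_ge0 ?(rnrm_ge0 N) ?tail_weight_ge0.
  rewrite mulr_sumr ler_sum// => x _.
  have [z zZ ->] := fdist_attained pos x Z0.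
  have zV : z \in V by exact: (fsubsetP (fV_sub ZV)).
  rewrite (big_rem z)//= zZ lerDl; apply: sumr_ge0 => y _.
  by case: ifP => // _; rewrite mulr_ge0 ?(rnrm_ge0 N) ?tail_weight_ge0.
rewrite exchange_big /=.
rewrite [leRHS](_ : _ = \sum_(x <- X) J * rg `^ (- alpha) * (Cl * l `^ d%:R)); last first.
  by rewrite big_const_seq count_predT iter_addr_0 -[RHS]mulr_natr; ring.
apply: ler_sum => x _; rewrite exchange_big /=.
have Jr0 : 0 <= J * rg `^ (- alpha) by rewrite mulr_ge0 ?powR_ge0.
apply: le_trans (ler_wpM2l Jr0 (lattice x l1)).
rewrite mulr_sumr; apply: ler_sum => z _.
rewrite -big_mkcondr -mulr_suml ler_wpM2r ?tail_weight_ge0//.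
apply: le_trans (hJ z rg0); rewrite le_eqVlt; apply/orP; left; apply/eqP.
by apply: eq_bigl => Z; rewrite andbC.
Qed.

(** The sum over the sites of [X] supplies the factor |X| that each round costs. The factor 2 of the
    commutator with [b] is absorbed by [2 * J <= v]. *)
Lemma truncation_step (P : pred {fset L}) (t rg l c : R) b :
  0 <= t -> 0 < rg -> 1 <= l -> 0 <= c ->
  (forall u Z, 0 <= u <= t -> Z \in fV -> P Z -> Z != fset0 ->
    nrm (comm (ev (cut P rg) u a) (h Z)) <= nrm a * nrm (h Z) *
       (c * \sum_(x <- X) tail_weight l p (fdist pos Z x))) ->
  nrm (comm (ev P t a) b) <= nrm (comm (ev (cut P rg) t a) b)
    + nrm a * nrm b * (v * t * rg `^ (- alpha) * c * #|` X|%:R * (Cl * l `^ d%:R)).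
Proof.
move=> t0 rg0 l1 c0 Hw.
have a0 := rnrm_ge0 N a; have b0 := rnrm_ge0 N b.
have := truncation N FU (P := P) (Q := fun Z => diam pos Z < rg) (a := a)
  (w := fun Z => c * \sum_(x <- X) tail_weight l p (fdist pos Z x)) b t0 _ erefl.
have step u Z : 0 <= u <= t -> Z \in fV -> P Z -> ~~ (diam pos Z < rg) ->
  nrm (comm (ev (cut P rg) u a) (h Z)) <= nrm a * nrm (h Z) *
       (c * \sum_(x <- X) tail_weight l p (fdist pos Z x)).
  move=> ut ZV PZ; rewrite -leNgt => dZ; apply: Hw => //.
  by apply: contraTN rg0 => /eqP Z0; rewrite Z0 diam_fset0 in dZ; rewrite -leNgt.
move=> /(_ step) /le_trans; apply; rewrite lerD2l.
under eq_bigr do rewrite mulrCA.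
rewrite -mulr_sumr.
have tn := tail_sum_le P rg0 l1.
apply: le_trans (_ : 2 * (t * (nrm a *
  (c * (J * rg `^ (- alpha) * #|` X|%:R * (Cl * l `^ d%:R))))) * nrm b <= _).
  by rewrite ler_wpM2r// ler_pM2l// ler_wpM2l// ler_wpM2l// ler_wpM2l.
set q := Cl * l `^ d%:R; have q0 : 0 <= q.
  by rewrite mulr_ge0 ?powR_ge0 ?(le_trans ler01).
rewrite [leLHS](_ : _ = 2 * J *
  (t * nrm a * nrm b * (rg `^ (- alpha) * c * #|` X|%:R * q))); last by ring.
rewrite [leRHS](_ : _ = v *
  (t * nrm a * nrm b * (rg `^ (- alpha) * c * #|` X|%:R * q))); last by ring.
apply: ler_wpM2r => //; apply: mulr_ge0; first by rewrite !mulr_ge0.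
by apply: mulr_ge0 => //; rewrite !mulr_ge0 ?powR_ge0.
Qed.

(** The exponent [v * t - rho^(1 - sigma)] changes sign where [rho] is the power 1/(1 - sigma) of
    [v * t]. The maximum with 1 keeps [radius] at least 1, as the lattice sums require. *)
Definition front (t : R) : R := Num.max 1 (v * t).
Definition radius (t : R) : R := front t `^ (1 - sigma)^-1.

Lemma front_ge1 t : 1 <= front t. Proof. by rewrite le_max lexx. Qed.

Lemma front_gt0 t : 0 < front t. Proof. exact: lt_le_trans (front_ge1 t). Qed.

Lemma v_ge0 : 0 <= v. Proof. by apply: le_trans vJ; rewrite mulr_ge0. Qed.

Lemma le_front u t : u <= t -> v * u <= front t.
Proof. by move=> ut; rewrite le_max ler_wpM2l ?orbT// v_ge0. Qed.

Lemma radius_ge1 t : 1 <= radius t.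
Proof.
have s1 : 0 <= (1 - sigma)^-1 by rewrite invr_ge0 subr_ge0 ltW.
by have := ler_powR (front_ge1 t) s1; rewrite powRr0.
Qed.

Lemma radius_gt0 t : 0 < radius t. Proof. exact: lt_le_trans (radius_ge1 t). Qed.

Lemma radius_le u t : u <= t -> radius u <= radius t.
Proof.
move=> ut; rewrite ge0_ler_powR ?nnegrE ?(ltW (front_gt0 _))//.
  by rewrite invr_ge0 subr_ge0 ltW.
by rewrite /front ge_max le_max lexx /= le_front.
Qed.

(* [radius t / rho] measures how far outside the light cone one is. *)
Definition decays (c : R) (k : nat) (e : R) : Prop :=
  forall (P : pred {fset L}) t Y b rho, 0 <= t -> 1 <= rho -> S Y b ->
    Y != fset0 -> (forall x, x \in X -> rho <= fdist pos Y x) ->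
    nrm (comm (ev P t a) b)
      <= nrm a * nrm b * (c * #|` X|%:R ^+ k * (radius t / rho) `^ e).

(* The input of [truncation_step]: a bound on the discarded terms whose sum over
   the lattice converges uniformly. *)
Definition weighted (c : R) (k : nat) (e : R) : Prop :=
  forall (P : pred {fset L}) t rg u Z, 0 < rg -> radius t <= front t * rg ->
    0 <= u <= t -> Z \in fV -> Z != fset0 ->
    nrm (comm (ev (cut P rg) u a) (h Z)) <= nrm a * nrm (h Z) *
      (c * #|` X|%:R ^+ k * (front t * rg / radius t) `^ e *
       \sum_(x <- X) tail_weight (radius t) p (fdist pos Z x)).

Lemma cardX_ge1 : 1 <= #|` X|%:R :> R.
Proof. by rewrite ler1n lt0n cardfs_eq0. Qed.

Lemma powR_invE (x e : R) : 0 < x -> x^-1 `^ e = x `^ (- e).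
Proof. by move=> x0; rewrite -powR_inv1 ?(ltW x0)// -powRrM mulN1r. Qed.

Lemma powR_ge1 (x e : R) : 1 <= x -> 0 <= e -> 1 <= x `^ e.
Proof. by move=> x1 e0; have := ler_powR x1 e0; rewrite powRr0. Qed.

Lemma cutoff_tail (n tau m rg r : R) : 0 < n -> tau <= m -> 1 <= m -> 0 < rg ->
  m * rg <= r -> expR (tau - r / rg) <= 4 * n `^ n * (m * rg / r) `^ n.
Proof.
move=> n0 tm m1 rg0 mr.
have mrg0 : 0 < m * rg by rewrite mulr_gt0// (lt_le_trans _ m1).
have r0 : 0 < r by exact: lt_le_trans mr.
have w1 : 1 <= r / (m * rg) by rewrite ler_pdivlMr// mul1r.
have := expR_decay_scaled n0 tm m1 w1.
rewrite -powR_invE ?(lt_le_trans _ w1)// invf_div.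
suff -> : m * (r / (m * rg)) = r / rg by [].
by field; rewrite !gt_eqF// (lt_le_trans _ m1).
Qed.

Lemma tail_exponent_gt0 : 0 < p. Proof. by rewrite ltr_wpDl. Qed.

Lemma tail_term_le (l r : R) (x : L) (g : L -> R) : x \in X ->
  tail_weight l r (g x) <= \sum_(y <- X) tail_weight l r (g y).
Proof.
move=> xX; rewrite (big_rem x)//= lerDl; apply: sumr_ge0 => y _.
exact: tail_weight_ge0.
Qed.

(* The sum over [x] inside the Lieb-Robinson bound is kept here, which saves the
   factor |X| of the first round. *)
Lemma weighted0 (n : R) : p <= n -> weighted (2 + 2 * (4 * n `^ n)) 0 p.
Proof.
move=> pn P t rg u Z rg0 lrg /andP[u0 ut] ZV Z0.
have n0 : 0 < n by apply: lt_le_trans pn; exact: tail_exponent_gt0.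
have p0 := ltW tail_exponent_gt0.
set l := radius t in lrg *; set q := front t * rg in lrg *.
have l0 : 0 < l by exact: radius_gt0.
have q0 : 0 < q by exact: lt_le_trans lrg.
have ql1 : 1 <= q / l by rewrite ler_pdivlMr// mul1r.
rewrite expr0 mulr1; set cB := 4 * n `^ n.
have cB0 : 0 <= cB by rewrite mulr_ge0 ?powR_ge0.
have [/hasP[x xX xq]|/hasPn far] := boolP (has (fun x => fdist pos Z x <= q) X).
  apply: le_trans (trivial_comm _ _ _) _.
  rewrite ler_wpM2l ?mulr_ge0 ?(rnrm_ge0 N)//.
  (* With r the distance from [x] to [Z], the product is (q/r)^p for l < r <= q and (q/l)^p for r <=
     l: within the truncated light cone a single site already dominates the trivial bound. *)
  have big : 1 <= (q / l) `^ p * tail_weight l p (fdist pos Z x).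
    rewrite /tail_weight; case: (leP _ l) => xl; first by rewrite mulr1 powR_ge1.
    have x0 : 0 < fdist pos Z x by exact: lt_trans xl.
    rewrite -powRM ?divr_ge0 ?(ltW l0) ?(ltW q0) ?(ltW x0)//.
    by apply: powR_ge1 => //; rewrite mulrA divfK ?gt_eqF// ler_pdivlMr// mul1r.
  have := tail_term_le l p (fdist pos Z) xX; set Sm := \sum_(_ <- _) _ => tS.
  have := ler_wpM2l (powR_ge0 (q / l) p) tS; move: big.
  set A := (q / l) `^ p * _; set B := (q / l) `^ p * Sm => A1 AB.
  by rewrite -mulrA -/B; nra.
apply: le_trans (lieb_robinson_cut _ rg0 u0 (Sh ZV) Z0) _.
rewrite ler_wpM2l ?mulr_ge0 ?(rnrm_ge0 N)//.
rewrite mulr_sumr mulr_sumr big_seq [leRHS]big_seq ler_sum// => x xX.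
have xq : q < fdist pos Z x by rewrite ltNge far.
have xl : l < fdist pos Z x by exact: le_lt_trans xq.
have x0 : 0 < fdist pos Z x by exact: lt_trans xl.
rewrite /tail_weight ifN -?ltNge// -mulrA.
rewrite -powRM ?divr_ge0 ?(ltW l0) ?(ltW q0) ?(ltW x0)// mulrA divfK ?gt_eqF//.
have := cutoff_tail n0 (le_front ut) (front_ge1 t) rg0 (ltW xq); rewrite -/q -/cB => h1.
have h2 : (q / fdist pos Z x) `^ n <= (q / fdist pos Z x) `^ p.
  by rewrite ger_powR ?divr_gt0//= ler_pdivrMr// mul1r ltW.
by have := ler_wpM2l cB0 h2; have := powR_ge0 (q / fdist pos Z x) p; lra.
Qed.

(** Two bounds compete: the Lieb-Robinson tail (q/r)^n on the scale q = [front t * rg], and the a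
    priori decay (l/r)^e on the better scale l = [radius t]. Their geometric mean of weight [lam]
    falls off like r^(-p) and equals (q/l)^(lam n) (l/r)^p. The index is [k.+1] because the
    Lieb-Robinson bound brings one factor |X|. *)
Lemma weighted1 (n lam c e : R) (k : nat) : 0 < n -> 0 <= c -> 0 <= e ->
  0 <= lam <= 1 -> lam * n + (1 - lam) * e = p ->
  decays c k.+1 e -> weighted (2 + 2 * (4 * n `^ n) + c) k.+1 (lam * n).
Proof.
move=> n0 c0 e0 lam01 Ep dec P t rg u Z rg0 lrg /andP[u0 ut] ZV Z0.
have /andP[lam0 lam1] := lam01.
set l := radius t in lrg *; set q := front t * rg in lrg *.
have l0 : 0 < l by exact: radius_gt0.
have l1 : 1 <= l by exact: radius_ge1.
have q0 : 0 < q by exact: lt_le_trans lrg.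
have ql1 : 1 <= q / l by rewrite ler_pdivlMr// mul1r.
set cB := 4 * n `^ n; have cB0 : 0 <= cB by rewrite mulr_ge0 ?powR_ge0.
have Xk : 1 <= #|` X|%:R ^+ k.+1 :> R by rewrite exprn_ege1// cardX_ge1.
have XXk : #|` X|%:R <= #|` X|%:R ^+ k.+1 :> R.
  by rewrite exprS ler_peMr// exprn_ege1// cardX_ge1.
have [x xX xmin] := argmin_fset (fdist pos Z) X0.
set ck := 2 + 2 * cB + c; have ck0 : 0 <= ck by rewrite !addr_ge0// mulr_ge0.
have ah0 : 0 <= nrm a * nrm (h Z) by rewrite mulr_ge0 ?(rnrm_ge0 N).
have ln0 : 0 <= lam * n by rewrite mulr_ge0 ?(ltW n0).
suff suf : nrm (comm (ev (cut P rg) u a) (h Z)) <= nrm a * nrm (h Z) *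
    (ck * #|` X|%:R ^+ k.+1 * ((q / l) `^ (lam * n) * tail_weight l p (fdist pos Z x))).
  apply: le_trans suf _; rewrite ler_wpM2l// -[leRHS]mulrA ler_wpM2l//.
    by rewrite mulr_ge0// (le_trans ler01).
  by rewrite ler_wpM2l ?powR_ge0// tail_term_le.
rewrite /tail_weight; case: (leP _ l) => xl.
  apply: le_trans (trivial_comm _ _ _) _; rewrite ler_wpM2l// mulr1 -mulrA.
  have h1 := powR_ge1 ql1 ln0.
  apply: le_trans (_ : ck * 1 <= _); first by rewrite mulr1 /ck; lra.
  by rewrite ler_wpM2l// -[leLHS]mulr1 ler_pM.
set r := fdist pos Z x in xl xmin *.
have r0 : 0 < r by exact: lt_trans xl.
have nB : nrm (comm (ev (cut P rg) u a) (h Z)) <=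
    nrm a * nrm (h Z) * (ck * #|` X|%:R ^+ k.+1 * (l / r) `^ e).
  apply: le_trans (dec (cut P rg) _ _ _ _ u0 (le_trans l1 (ltW xl)) (Sh ZV) Z0 xmin) _.
  have Xk0 := le_trans ler01 Xk.
  apply: (ler_wpM2l ah0); apply: ler_pM.
  - exact: mulr_ge0.
  - exact: powR_ge0.
  - apply: (ler_wpM2r Xk0); rewrite /ck lerDr; apply: addr_ge0 => //.
    exact: mulr_ge0.
  - rewrite ge0_ler_powR ?nnegrE ?divr_ge0 ?(ltW r0) ?(ltW l0) ?(ltW (radius_gt0 _))//.
    by rewrite ler_pM2r ?invr_gt0// radius_le.
have split_p : (q / l) `^ (lam * n) * (l / r) `^ p =
    (q / r) `^ (lam * n) * (l / r) `^ ((1 - lam) * e).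
  rewrite -Ep powRD; last by rewrite (gt_eqF (divr_gt0 l0 r0)) implybT.
  rewrite mulrA -powRM ?divr_ge0 ?(ltW r0) ?(ltW l0) ?(ltW q0)//.
  by rewrite mulrA divfK// gt_eqF.
rewrite split_p.
have lr1 : 0 < l / r <= 1 by rewrite divr_gt0//= ler_pdivrMr// mul1r ltW.
have e1 : (1 - lam) * e <= e by rewrite ler_piMl// gerBl.
have le_e := ger_powR lr1 e1.
(* For r <= q the tail is useless, but (q/r)^(lam n) >= 1 and the a priori bound alone suffices;
   beyond q both bounds hold and are interpolated. *)
case: (leP r q) => rq.
  apply: le_trans nB _; rewrite ler_wpM2l// ler_wpM2l//.
    by rewrite mulr_ge0// (le_trans ler01).
  apply: le_trans le_e _; rewrite ler_peMl ?powR_ge0// powR_ge1//.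
  by rewrite ler_pdivlMr// mul1r.
have nA : nrm (comm (ev (cut P rg) u a) (h Z)) <=
    nrm a * nrm (h Z) * (ck * #|` X|%:R ^+ k.+1 * (q / r) `^ n).
  apply: le_trans (lieb_robinson_far _ rg0 u0 (Sh ZV) Z0 xmin) _.
  rewrite ler_wpM2l//.
  have := cutoff_tail n0 (le_front ut) (front_ge1 t) rg0 (ltW rq).
  rewrite -/q -/cB => h1.
  apply: le_trans (_ : 2 * #|` X|%:R * (cB * (q / r) `^ n) <= _).
    by rewrite ler_wpM2l// mulr_ge0.
  rewrite mulrA ler_wpM2r ?powR_ge0// mulrAC.
  by apply: ler_pM => //; [exact: mulr_ge0|rewrite /ck; lra].
set D := nrm a * nrm (h Z) * (ck * #|` X|%:R ^+ k.+1).
have D0 : 0 <= D by rewrite !mulr_ge0 ?(rnrm_ge0 N)// (le_trans ler01).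
rewrite mulrA -/D in nA; rewrite mulrA -/D in nB; rewrite [leRHS]mulrA -/D.
have [D00|Dpos] := eqVneq D 0.
  by move: nA; rewrite D00 !mul0r.
have Dgt : 0 < D by rewrite lt_def Dpos.
rewrite -ler_pdivrMl// mulrC; rewrite -ler_pdivrMl// mulrC in nA.
rewrite -ler_pdivrMl// mulrC in nB.
rewrite [lam * n]mulrC [(1 - lam) * e]mulrC !powRrM.
by apply: le_interpolate => //; rewrite divr_ge0 ?(rnrm_ge0 N).
Qed.

(* Here the condition on sigma enters: since [front t] is
   [radius t `^ (1 - sigma)], the two sides differ by the power
   [d + 1 - sigma - sigma * alpha <= 0] of [radius t]. *)
Lemma cutoff_scaling (t rho e : R) : radius t <= rho ->
  front t * (rho `^ sigma) `^ (- alpha) *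
    (front t * rho `^ sigma / radius t) `^ e * radius t `^ d%:R
  <= (radius t / rho) `^ (sigma * alpha - sigma * e).
Proof.
move=> lr; have l0 := radius_gt0 t; have r0 := lt_le_trans l0 lr.
have m0 := front_gt0 t; have m1 := front_ge1 t.
rewrite /radius -(lnK m0) -(lnK r0); set A := ln (front t); set r := ln rho.
have A0 : 0 <= A by rewrite ln_ge0.
set th := (1 - sigma)^-1.
have s1 : 0 < 1 - sigma by rewrite subr_gt0.
have thE : th = 1 + th * sigma by rewrite /th; field; rewrite gt_eqF.
have th0 : 0 < th by rewrite invr_gt0.
rewrite -!expRM -!expRN -!expRD -!expRM -!expRD ler_expR.
clearbody A r th.
have := mulr_ge0 A0 (mulr_ge0 (ltW th0) (_ : 0 <= sigma * alpha - (d%:R + 1 - sigma))).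
rewrite subr_ge0 => /(_ exponents).
have /(congr1 (fun x => A * x)) := thE; have /(congr1 (fun x => e * A * x)) := thE.
lra.
Qed.

(** Since [front t] is [radius t] to the power 1 - sigma, the right side is at least
    radius^(1-sigma) radius^sigma. This makes the cut at rho^sigma admissible in [weighted]. *)
Lemma cutoff_radius (t rho : R) : radius t <= rho ->
  radius t <= front t * rho `^ sigma.
Proof.
move=> lr; have l0 := radius_gt0 t; have r0 := lt_le_trans l0 lr.
have m0 := front_gt0 t; have m1 := front_ge1 t.
have s1 : 0 < 1 - sigma by rewrite subr_gt0.
have frontE : front t = radius t `^ (1 - sigma).
  by rewrite /radius -powRrM mulVf ?powRr1 ?gt_eqF// ltW.
apply: le_trans (_ : front t * radius t `^ sigma <= _); last first.
  by rewrite ler_pM2l// ge0_ler_powR ?nnegrE ?(ltW sigma0) ?(ltW l0) ?(ltW r0).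
rewrite frontE -powRD ?subrK ?powRr1 ?(ltW l0)//.
by rewrite gt_eqF ?implybT.
Qed.

Lemma decays0 : decays 2 0 0.
Proof.
move=> P t Y b rho t0 rho1 Yb Y0 far.
by rewrite powRr0 expr0 !mulr1; exact: trivial_comm.
Qed.

Lemma error_term_le (vt m A Xk x q C B w c : R) :
  0 <= A -> 0 <= q -> 0 <= B -> 0 <= Xk -> 0 <= x -> 0 <= C -> 0 <= c ->
  vt <= m -> m * A * q * B <= w ->
  vt * A * (c * Xk * q) * x * (C * B) <= c * C * (x * Xk) * w.
Proof.
move=> A0 q0 B0 Xk0 x0 C1 c0 vtm le_w.
have D0 : 0 <= c * C * (x * Xk) by rewrite !mulr_ge0.
apply: le_trans (ler_wpM2l D0 le_w).
rewrite [leLHS](_ : _ = vt * (c * C * (x * Xk) * (A * q * B))); last by ring.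
rewrite [leRHS](_ : _ = m * (c * C * (x * Xk) * (A * q * B))); last by ring.
by rewrite ler_wpM2r// !mulr_ge0.
Qed.

(** One round. For [rho < radius t] the claim exceeds the trivial bound. Otherwise, cutting at
    rho^sigma, the truncated part decays with exponent [p] and the discarded part with exponent
    [sigma * alpha - sigma * e] by [cutoff_scaling]; [e'] lies below both. *)
Lemma weighted_decays (c e e' : R) (k : nat) : 0 <= c -> 0 <= e' <= p ->
  e' <= sigma * alpha - sigma * e -> weighted c k e ->
  decays (2 + 2 * (4 * (p / (1 - sigma)) `^ (p / (1 - sigma))) + c * Cl) k.+1 e'.
Proof.
move=> c0 /andP[e'0 e'p] e'le wt P t Y b rho t0 rho1 Yb Y0 far.
have s1 : 0 < 1 - sigma by rewrite subr_gt0.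
set n := p / (1 - sigma); have n0 : 0 < n by rewrite divr_gt0// tail_exponent_gt0.
set cA := 4 * n `^ n; have cA0 : 0 <= cA by rewrite mulr_ge0 ?powR_ge0.
have Cl0 : 0 <= Cl by exact: le_trans Cl1.
have ab0 : 0 <= nrm a * nrm b by rewrite mulr_ge0 ?(rnrm_ge0 N).
have rho0 : 0 < rho by exact: lt_le_trans rho1.
have Xk : 1 <= #|` X|%:R ^+ k.+1 :> R by rewrite exprn_ege1// cardX_ge1.
have XXk : #|` X|%:R <= #|` X|%:R ^+ k.+1 :> R.
  by rewrite exprS ler_peMr// exprn_ege1// cardX_ge1.
have l0 := radius_gt0 t.
have m0 := front_gt0 t.
case: (leP (radius t) rho) => lr; last first.
  apply: le_trans (trivial_comm _ _ _) _; rewrite ler_wpM2l// -mulrA.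
  have h1 : 1 <= (radius t / rho) `^ e'.
    by rewrite powR_ge1// ler_pdivlMr// mul1r ltW.
  apply: le_trans (_ : (2 + 2 * cA + c * Cl) * 1 <= _).
    by have := mulr_ge0 c0 Cl0; rewrite mulr1; lra.
  apply: ler_wpM2l; first by have := mulr_ge0 c0 Cl0; lra.
  by rewrite -[leLHS]mulr1 ler_pM.
have rg0 : 0 < rho `^ sigma by rewrite powR_gt0.
set rg := rho `^ sigma in rg0 *.
set q := (front t * rg / radius t) `^ e.
have step := @truncation_step P t rg (radius t) (c * #|` X|%:R ^+ k * q) b t0 rg0
  (radius_ge1 t) _ (fun u Z ut ZV _ Z0 => wt P t rg u Z rg0 (cutoff_radius lr) ut ZV Z0).
apply: le_trans (step _) _; first by rewrite !mulr_ge0 ?powR_ge0// exprn_ge0.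
apply: le_trans (lerD (lieb_robinson_far P rg0 t0 Yb Y0 far) (lexx _)) _.
rewrite -mulrDr ler_wpM2l//.
rewrite [leRHS](_ : _ = (2 + 2 * cA) * #|` X|%:R ^+ k.+1 * (radius t / rho) `^ e'
   + c * Cl * #|` X|%:R ^+ k.+1 * (radius t / rho) `^ e'); last by ring.
have lr1 : 0 < radius t / rho <= 1 by rewrite divr_gt0//= ler_pdivrMr// mul1r.
apply: lerD.
  apply: le_trans (_ : 2 * #|` X|%:R * (cA * (radius t / rho) `^ p) <= _).
    rewrite ler_wpM2l ?mulr_ge0//.
    (* For w = (rho / radius)^(1-sigma) the product [front t * w] is rho^(1-sigma) = rho / rg. A
       decay w^(-n) with n = p/(1-sigma) is thus the power [p] of radius/rho. *)
    have w1 : 1 <= (rho / radius t) `^ (1 - sigma).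
      by rewrite powR_ge1 ?(ltW s1)// ler_pdivlMr// mul1r.
    have := expR_decay_scaled n0 (le_front (lexx t)) (front_ge1 t) w1.
    rewrite -/cA -powRrM mulrN /n mulrCA divff ?gt_eqF// mulr1 -powR_invE ?divr_gt0// invf_div.
    suff -> : front t * (rho / radius t) `^ (1 - sigma) = rho / rg by [].
    rewrite powRM ?invr_ge0 ?(ltW rho0) ?(ltW l0)// powR_invE// powRN /radius.
    rewrite -powRrM mulVf ?gt_eqF// powRr1 ?(ltW m0)// mulrCA divff ?gt_eqF// mulr1.
    by rewrite powRB ?powRr1 ?(ltW rho0)// gt_eqF ?implybT.
  apply: le_trans (_ : 2 * #|` X|%:R * (cA * (radius t / rho) `^ e') <= _).
    apply: ler_wpM2l; first exact: mulr_ge0.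
    by apply: (ler_wpM2l cA0); exact: ger_powR.
  rewrite mulrA ler_wpM2r ?powR_ge0// mulrAC.
  by apply: ler_pM => //; [exact: mulr_ge0|rewrite lerDr].
rewrite exprS; apply: (@error_term_le _ (front t)) => //.
- exact: powR_ge0.
- exact: powR_ge0.
- exact: powR_ge0.
- exact: le_front (lexx t).
- by apply: le_trans (cutoff_scaling e lr) _; exact: ger_powR.
Qed.

(** The last round: a weight of exponent 0 costs no power of [rho], so the full rho^(-sigma alpha)
    survives, and the exponential is kept as it is. The time factor v t radius^d is at most v t when
    v t < 1, and is (v t)^(1 + d/(1-sigma)) otherwise. *)
Lemma weighted_bound (c : R) (k : nat) : 0 <= c -> weighted c k 0 ->
  forall (P : pred {fset L}) t Y b rho, 0 <= t -> 1 <= rho -> S Y b ->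
    Y != fset0 -> (forall x, x \in X -> rho <= fdist pos Y x) ->
    nrm (comm (ev P t a) b) <= nrm a * nrm b *
      (2 * #|` X|%:R * expR (v * t - rho `^ (1 - sigma)) +
       c * Cl * (v * t + (v * t) `^ (1 + d%:R / (1 - sigma))) * #|` X|%:R ^+ k.+1
         / rho `^ (sigma * alpha)).
Proof.
move=> c0 wt P t Y b rho t0 rho1 Yb Y0 far.
have s1 : 0 < 1 - sigma by rewrite subr_gt0.
have Cl0 : 0 <= Cl by exact: le_trans Cl1.
have ab0 : 0 <= nrm a * nrm b by rewrite mulr_ge0 ?(rnrm_ge0 N).
have rho0 : 0 < rho by exact: lt_le_trans rho1.
have l0 := radius_gt0 t; have m0 := front_gt0 t.
have vt0 : 0 <= v * t by rewrite mulr_ge0 ?v_ge0.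
case: (leP (radius t) rho) => lr; last first.
  apply: le_trans (trivial_comm _ _ _) _; rewrite ler_wpM2l//.
  rewrite -[leLHS]addr0; apply: lerD; last first.
    rewrite divr_ge0 ?powR_ge0// mulr_ge0 ?exprn_ge0// mulr_ge0 ?mulr_ge0//.
    by rewrite addr_ge0 ?powR_ge0.
  rewrite -mulrA ler_peMr// -[leLHS]mulr1 ler_pM ?cardX_ge1//.
  rewrite -[leLHS]expR0 ler_expR subr_ge0.
  have : rho `^ (1 - sigma) <= front t.
    apply: le_trans (_ : radius t `^ (1 - sigma) <= _).
      by rewrite ge0_ler_powR ?nnegrE ?(ltW s1) ?(ltW l0) ?(ltW rho0) ?(ltW lr).
    by rewrite /radius -powRrM mulVf ?powRr1 ?gt_eqF// ltW.
  (* If [v * t < 1] then the radius is 1, which contradicts [1 <= rho < radius t]; so [front t] is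
     [v * t] and the exponential is at least 1. *)
  rewrite /front; case: (leP 1 (v * t)) => // vt1 _.
  have : radius t = 1 by rewrite /radius /front max_l ?powR1// ltW.
  by move=> l1; move: lr; rewrite l1 ltNge rho1.
have rg0 : 0 < rho `^ sigma by rewrite powR_gt0.
set rg := rho `^ sigma in rg0 *.
have step := @truncation_step P t rg (radius t)
  (c * #|` X|%:R ^+ k * (front t * rg / radius t) `^ 0) b t0 rg0 (radius_ge1 t) _
  (fun u Z ut ZV _ Z0 => wt P t rg u Z rg0 (cutoff_radius lr) ut ZV Z0).
apply: le_trans (step _) _; first by rewrite !mulr_ge0 ?powR_ge0// exprn_ge0.
apply: le_trans (lerD (lieb_robinson_far P rg0 t0 Yb Y0 far) (lexx _)) _.
rewrite -mulrDr ler_wpM2l//; apply: lerD.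
  rewrite /rg (_ : rho / rho `^ sigma = rho `^ (1 - sigma))//.
  by rewrite powRB ?powRr1 ?(ltW rho0)// (gt_eqF rho0) implybT.
rewrite powRr0 mulr1 /rg -powRrM mulrN powRN.
have e0 : 0 <= d%:R / (1 - sigma) by rewrite divr_ge0 ?ler0n ?(ltW s1).
have le_w : v * t * radius t `^ d%:R
    <= v * t + (v * t) `^ (1 + d%:R / (1 - sigma)).
  rewrite /radius -powRrM [_^-1 * _]mulrC /front.
  case: (leP 1 (v * t)) => vt1; last by rewrite powR1 mulr1 lerDl powR_ge0.
  rewrite -[X in X * _]powRr1// -powRD ?lerDr//.
  by rewrite (gt_eqF (lt_le_trans ltr01 vt1)) implybT.
move: le_w (powR_gt0 (sigma * alpha) rho0) (powR_ge0 (radius t) d%:R).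
rewrite exprS.
move: (_ `^ (1 + _)) (rho `^ _) (radius t `^ _) (#|` X|%:R ^+ k) (exprn_ge0 k (ler0n R #|` X|)).
move=> w r B Xk Xk0 le_w r0 B0.
have r0' : 0 <= r^-1 by rewrite invr_ge0 ltW.
rewrite [leLHS](_ : _ = c * Cl * (#|` X|%:R * Xk) / r * (v * t * B)); last by ring.
rewrite [leRHS](_ : _ = c * Cl * (#|` X|%:R * Xk) / r * (v * t + w)); last by ring.
by rewrite ler_wpM2l// !mulr_ge0.
Qed.

Lemma weighted_le (c c' e : R) (k : nat) : c <= c' -> weighted c k e -> weighted c' k e.
Proof.
move=> cc' wt P t rg u Z rg0 lrg ut ZV Z0.
apply: le_trans (wt P t rg u Z rg0 lrg ut ZV Z0) _.
rewrite ler_wpM2l ?mulr_ge0 ?(rnrm_ge0 N)// -!mulrA ler_wpM2r// mulr_ge0 ?exprn_ge0//.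
by rewrite mulr_ge0 ?powR_ge0 ?sumr_ge0// => x _; exact: tail_weight_ge0.
Qed.

Local Notation dR := (d%:R : R).
(* Large enough for the interpolation between the exponential tail and an
   a priori decay to lose only [eta] in the exponent. *)
Definition interp_exponent : R := (dR + 1) + (dR + 1) ^+ 2 / eta.
Local Notation n := interp_exponent.
(** The constants produced by interpolation and by one full round. Neither involves [alpha], [J] or
    the index of the round, so a bounded number of iterations stays within the allowed
    dependence. *)
Definition weight_constant (c : R) : R := 2 + 2 * (4 * n `^ n) + c.
Definition next_constant (c : R) : R :=
  2 + 2 * (4 * (p / (1 - sigma)) `^ (p / (1 - sigma))) + weight_constant c * Cl.

Lemma interp_exponent_gt : p < n.
Proof.
have d1 : 0 < dR + 1 by rewrite ltr_wpDl.
rewrite -[ltLHS]addr0 ler_ltD//; first by rewrite lerD2l.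
by rewrite divr_gt0// exprn_gt0.
Qed.

Lemma interp_exponent_gt0 : 0 < n.
Proof. exact: lt_trans tail_exponent_gt0 interp_exponent_gt. Qed.

Lemma weight_constant_ge0 c : 0 <= c -> 0 <= weight_constant c.
Proof. by move=> c0; rewrite !addr_ge0 ?mulr_ge0 ?powR_ge0. Qed.

Lemma next_constant_le c c' : 0 <= c -> c <= c' ->
  c <= next_constant c /\ next_constant c <= next_constant c'.
Proof.
move=> c0 cc'.
have q0 : 0 <= 4 * (p / (1 - sigma)) `^ (p / (1 - sigma)) by rewrite mulr_ge0 ?powR_ge0.
have n0 : 0 <= 4 * n `^ n by rewrite mulr_ge0 ?powR_ge0.
have Cl0 := le_trans ler01 Cl1.
rewrite /next_constant; split; last by rewrite lerD2l ler_wpM2r// lerD2l.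
have wc : c <= weight_constant c by rewrite lerDr addr_ge0// mulr_ge0.
apply: le_trans (le_trans wc _) _; first exact: (ler_peMr (le_trans c0 wc) Cl1).
by rewrite lerDr addr_ge0// mulr_ge0.
Qed.

(** The weight [lam = (p - e)/(n - e)] solves the interpolation equation, so that lam n = p - e +
    lam e; the size of [n] makes lam e at most [eta]. Round 0 has no a priori decay and uses
    [weighted0]. *)
Lemma decays_weighted (c e : R) (k : nat) : 0 <= c -> 0 <= e <= p ->
  (k == 0%N) ==> (e == 0) -> decays c k e ->
  exists2 kap, 0 <= kap <= p - e + eta & weighted (weight_constant c) k kap.
Proof.
move=> c0 /andP[e0 ep]; have pn := interp_exponent_gt.
case: k => [/eqP -> _|k _ dec].
  exists p; first by rewrite subr0 lerDl !ltW// tail_exponent_gt0.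
  by apply: weighted_le (weighted0 (ltW pn)); rewrite lerDl.
have ne0 : 0 < n - e by rewrite subr_gt0 (le_lt_trans ep).
set lam := (p - e) / (n - e).
have lam0 : 0 <= lam by rewrite divr_ge0 ?subr_ge0// (le_trans ep) ?ltW.
have lam1 : lam <= 1 by rewrite ler_pdivrMr// mul1r lerD2r ltW.
have lamE : lam * n + (1 - lam) * e = p.
  by rewrite /lam; field; rewrite gt_eqF.
exists (lam * n); last first.
  by apply: (weighted1 interp_exponent_gt0 c0 e0 _ lamE dec); rewrite lam0.
rewrite mulr_ge0 ?(ltW interp_exponent_gt0)//=.
have -> : lam * n = p - e + lam * e by rewrite -lamE; ring.
rewrite lerD2l /lam mulrAC ler_pdivrMr//.
have d0 : 0 <= dR by rewrite ler0n.
have pd : p <= dR + 1 by rewrite lerD2l.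
have he : eta * ((dR + 1) ^+ 2 / eta) = (dR + 1) ^+ 2 by rewrite mulrCA divff ?mulr1 ?gt_eqF.
have h1 : (p - e) * e <= (dR + 1) ^+ 2.
  rewrite expr2; apply: ler_pM => //; first by rewrite subr_ge0.
    by apply: le_trans pd; rewrite gerBl.
  exact: le_trans pd.
have h2 : e <= dR + 1 by exact: le_trans pd.
apply: le_trans h1 _; rewrite /n mulrBr mulrDr he.
have := ltW eta0; move: h2; nra.
Qed.

(* [p] minus the decay exponent reached after [k] truncations. *)
Fixpoint deficit (k : nat) : R :=
  if k is k'.+1 then
    Num.max 0 (- (sigma * alpha - dR) + 2 * eta + sigma * deficit k')
  else p.

Lemma deficit_ge0 k : 0 <= deficit k.
Proof. by case: k => [|k] /=; rewrite ?le_max ?lexx// ltW// tail_exponent_gt0. Qed.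

Lemma deficit_le k : 2 * eta <= 1 - sigma -> deficit k <= p.
Proof.
move=> eta2; elim: k => [|k IH] /=; first exact: lexx.
rewrite ge_max (ltW tail_exponent_gt0) /=.
have : sigma * deficit k <= sigma * p by rewrite ler_pM2l.
have : sigma * p <= p by rewrite ger_pMl ?(ltW sigma1)// tail_exponent_gt0.
by have := exponents; have := sigma1; have := eta0; lra.
Qed.

(** The contraction by [sigma] is used only in the first round, where it turns d into sigma d; later
    rounds just subtract [sigma * alpha - d]. This is where the numerator of the round count comes
    from. *)
Lemma deficit_bound k : (sigma * alpha - dR) >= 0 ->
  deficit k.+1 <= Num.max 0 (sigma * dR - k.+1%:R * (sigma * alpha - dR))
    + (2 * k.+1%:R + 3) * eta.
Proof.
set D := sigma * alpha - dR => D0.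
have bound x y z : x <= z -> y <= z -> Num.max x y <= z :> R by rewrite ge_max => -> ->.
elim: k => [|k IH].
  rewrite /= -/D mul1r; apply: (bound _ _ _).
    by rewrite addr_ge0 ?le_max ?lexx// mulr_ge0 ?(ltW eta0).
  have hm : sigma * dR - D <= Num.max 0 (sigma * dR - D) by rewrite le_max lexx orbT.
  have he : sigma * eta <= eta by rewrite ger_pMl// ltW.
  by move: (Num.max _ _) hm he eta0 => w; lra.
rewrite [deficit _]/= -/D; apply: (bound _ _ _).
  by rewrite addr_ge0 ?le_max ?lexx// mulr_ge0 ?(ltW eta0).
have h1 : sigma * deficit k.+1 <= deficit k.+1.
  by rewrite ler_piMl ?deficit_ge0// ltW.
have k0 : 0 <= k.+1%:R :> R by [].
have kS : k.+2%:R = k.+1%:R + 1 :> R by rewrite natr1.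
move: IH h1; rewrite kS -/(deficit k.+1); move: (deficit k.+1) (k.+1%:R : R) k0 => E K0 K00 IH h1.
have : - D + Num.max 0 (sigma * dR - K0 * D) <= Num.max 0 (sigma * dR - (K0 + 1) * D).
  rewrite -lerBrDl opprK; apply: (bound _ _ _).
    by apply: addr_ge0 => //; rewrite le_max lexx.
  by rewrite -lerBlDr le_max; apply/orP; right; lra.
by lra.
Qed.

(** After [ns] rounds only (2 ns + 3) eta is left. One more round adds 2 eta and subtracts at least
    1 - sigma, whence the 5 in the hypothesis on [eta]. *)
Lemma deficit_eq0 (ns : nat) : (0 < ns)%N ->
  sigma * dR <= ns%:R * (sigma * alpha - dR) ->
  (2 * ns%:R + 5) * eta <= 1 - sigma -> deficit ns.+1 = 0.
Proof.
case: ns => // k _ le_ns le_eta /=.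
have D0 : 0 <= sigma * alpha - dR by have := exponents; have := sigma1; have := eta0; lra.
have := deficit_bound k D0.
rewrite max_l ?subr_le0// add0r => hd.
have h1 : sigma * deficit k.+1 <= deficit k.+1.
  by rewrite ler_piMl ?deficit_ge0// ltW.
by apply/max_l; have := exponents; have := sigma1; have := eta0; move: hd h1; rewrite /=; lra.
Qed.

(** The 2 eta in the recursion for [deficit] is accounted for here: one comes from p = d + eta, the
    other from the interpolation loss, reduced by [sigma]. *)
Lemma iterated_decays k : 2 * eta <= 1 - sigma ->
  decays (iter k next_constant 2) k (p - deficit k).
Proof.
move=> eta2.
have c0 m : 0 <= iter m next_constant 2.
  elim: m => [|m IH] //=; exact: le_trans IH (next_constant_le IH (lexx _)).1.
have range m : 0 <= p - deficit m <= p.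
  by rewrite subr_ge0 deficit_le//= gerBl deficit_ge0.
elim: k => [|k IH]; first by rewrite /= subrr; exact: decays0.
have k0 : (k == 0%N) ==> (p - deficit k == 0).
  by case: (k) => //=; rewrite subrr.
have [kap /andP[kap0 kaple] wt] := decays_weighted (c0 k) (range k) k0 IH.
rewrite iterS; apply: weighted_decays wt => //; first exact: weight_constant_ge0.
have h1 : sigma * kap <= sigma * (deficit k + eta).
  by rewrite ler_pM2l//; apply: le_trans kaple _; rewrite subKr.
have h2 : sigma * eta <= eta by rewrite ger_pMl// ltW.
have h3 : - (sigma * alpha - dR) + 2 * eta + sigma * deficit k <= deficit k.+1.
  by rewrite /= le_max lexx orbT.
by move: (deficit k) (deficit k.+1) h1 h2 h3 => D1 D2; lra.
Qed.

(** After [ns.+1] rounds the exponent is [p], the interpolation weight 0 is allowed and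
    [weighted_bound] applies, adding the last factor |X|. Iterating the constant [M.+1] times
    instead makes it independent of [ns]. *)
Lemma iterated_bound (ns M : nat) : (0 < ns)%N -> (ns <= M)%N ->
  sigma * dR <= ns%:R * (sigma * alpha - dR) ->
  (2 * ns%:R + 5) * eta <= 1 - sigma ->
  forall (P : pred {fset L}) t Y b rho, 0 <= t -> 1 <= rho -> S Y b ->
    Y != fset0 -> (forall x, x \in X -> rho <= fdist pos Y x) ->
    nrm (comm (ev P t a) b) <= nrm a * nrm b *
      (2 * #|` X|%:R * expR (v * t - rho `^ (1 - sigma)) +
       weight_constant (iter M.+1 next_constant 2) * Cl *
         (v * t + (v * t) `^ (1 + d%:R / (1 - sigma))) * #|` X|%:R ^+ ns.+2
         / rho `^ (sigma * alpha)).
Proof.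
move=> ns0 nsM le_ns le_eta.
have eta2 : 2 * eta <= 1 - sigma.
  apply: le_trans le_eta; rewrite ler_pM2r//.
  have : 0 <= ns%:R :> R by []. 
  by lra.
have c0 m : 0 <= iter m next_constant 2.
  elim: m => [|m IH] //=; exact: le_trans IH (next_constant_le IH (lexx _)).1.
have mono m m' : (m <= m')%N -> iter m next_constant 2 <= iter m' next_constant 2.
  move=> /subnK <-; elim: (m' - m)%N => //= j IH.
  exact: le_trans IH (next_constant_le (c0 _) (lexx _)).1.
have := iterated_decays ns.+1 eta2; rewrite (deficit_eq0 ns0 le_ns le_eta) subr0.
move=> /(weighted1 (lam := 0) interp_exponent_gt0 (c0 _) (ltW tail_exponent_gt0)).
rewrite lexx ler01 !mul0r subr0 mul1r add0r => /(_ isT erefl) wt.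
apply: weighted_bound; first by rewrite weight_constant_ge0.
by apply: weighted_le wt; rewrite lerD2l mono.
Qed.

End Iteration.

(** * Operators on l2 *)

Section OperatorNorm.
Context {R : realType} {L : choiceType} {q : L -> nat}.
Local Notation vec := (@vec R L q).
Local Notation op := (@op R L q).
Implicit Types (phi psi : vec) (T : op).

Definition sqmod (z : R[i]) : R := complex.Re z ^+ 2 + complex.Im z ^+ 2.

Lemma sqmod_ge0 z : 0 <= sqmod z.
Proof. by rewrite addr_ge0 ?sqr_ge0. Qed.

Definition energy psi : \bar R := (\esum_(s in [set: Conf q]) (sqmod (psi s))%:E)%E.

Lemma energy_ge0 psi : (0 <= energy psi)%E.
Proof. by apply: esum_ge0 => s _; rewrite lee_fin sqmod_ge0. Qed.

Lemma l2normE psi : l2norm psi = (energy psi `^ 2^-1)%E.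
Proof. by []. Qed.

Lemma l2norm_ge0 psi : (0 <= l2norm psi)%E.
Proof. exact: poweR_ge0. Qed.

Lemma l2norm_le psi (c : R) : 0 <= c -> (l2norm psi <= c%:E)%E = (energy psi <= (c ^+ 2)%:E)%E.
Proof.
move=> c0; rewrite l2normE; have := energy_ge0 psi; case: (energy psi) => [e| |] //.
  rewrite poweR_EFin !lee_fin => e0; rewrite powR12_sqrt//.
  by rewrite -(ler_sqr (x := Num.sqrt e)) ?nnegrE ?sqrtr_ge0// sqr_sqrtr.
by rewrite poweRyr ?invr_eq0 ?pnatr_eq0//.
Qed.

Lemma energy_le psi (c : R) :
  (forall r : seq (Conf q), uniq r -> \sum_(s <- r) sqmod (psi s) <= c) ->
  (energy psi <= c%:E)%E.
Proof.
move=> H; apply: ge_ereal_sup => _ [F [finF _] <-].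
rewrite fsbig_finite//= sumEFin lee_fin; apply: H; exact: fset_uniq.
Qed.

Lemma sum_le_energy psi (r : seq (Conf q)) : uniq r ->
  ((\sum_(s <- r) sqmod (psi s))%:E <= energy psi)%E.
Proof.
move=> ur; apply: esum_ge; exists [set` r].
  by split => //; exact: finite_seq.
by rewrite -sumEFin -fsbig_seq.
Qed.

Lemma l2norm_triangle phi psi :
  (l2norm (fun s => (phi s + psi s)%R) <= l2norm phi + l2norm psi)%E.
Proof.
have := l2norm_ge0 phi; have := l2norm_ge0 psi.
case Ephi: (l2norm phi) => [a| |] //; last first.
  by move=> p0 _; rewrite addye ?leey//; apply: contraTneq p0 => ->.
case Epsi: (l2norm psi) => [b| |] //; last by rewrite addey ?leey.
rewrite !lee_fin => b0 a0; rewrite -EFinD l2norm_le ?addr_ge0//.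
have ha : (energy phi <= (a ^+ 2)%:E)%E by rewrite -l2norm_le// Ephi.
have hb : (energy psi <= (b ^+ 2)%:E)%E by rewrite -l2norm_le// Epsi.
apply: energy_le => r ur.
have := le_trans (sum_le_energy phi ur) ha; have := le_trans (sum_le_energy psi ur) hb.
rewrite !lee_fin => hb' ha'.
(* Real and imaginary parts form one real family over two copies of [r], which reduces the claim to
   the real Minkowski inequality. *)
pose r' := map inl r ++ map inr r : seq (Conf q + Conf q).
pose part (chi : vec) (i : Conf q + Conf q) : R :=
  match i with inl s => complex.Re (chi s) | inr s => complex.Im (chi s) end.
have partE chi : \sum_(i <- r') part chi i ^+ 2 = \sum_(s <- r) sqmod (chi s).
  by rewrite big_cat !big_map [RHS]big_split.
have := @minkowski2 R _ r' (part phi) (part psi) a b a0 b0.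
rewrite !partE => /(_ ha' hb'); congr (_ <= _).
rewrite -partE; apply: eq_bigr => -[s|s] _ /=.
  by case: (phi s) (psi s) => [x y] [z w].
by case: (phi s) (psi s) => [x y] [z w].
Qed.

Lemma l2norm_opp psi : l2norm (fun s => - psi s) = l2norm psi.
Proof.
congr (_ `^ _)%E; apply: eq_esum => s _; congr EFin.
by case: (psi s) => x y /=; rewrite !sqrrN.
Qed.

Definition op_bound T (c : R) : Prop :=
  0 <= c /\ forall psi, (l2norm psi < +oo)%E -> (l2norm (T psi) <= c%:E * l2norm psi)%E.

Lemma opnorm_ge0 T : (0 <= opnorm T)%E.
Proof. by apply: le_ereal_inf_tmp => _ [c [c0 _] <-]; rewrite lee_fin. Qed.

Lemma opnorm_le T c : op_bound T c -> (opnorm T <= c%:E)%E.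
Proof. by move=> Tc; apply: ereal_inf_lbound; exists c. Qed.

Lemma op_bound_le T c c' : c <= c' -> op_bound T c -> op_bound T c'.
Proof.
move=> cc' [c0 H]; split; first exact: le_trans cc'.
by move=> psi fpsi; apply: le_trans (H _ fpsi) _; rewrite lee_wpmul2r ?lee_fin ?l2norm_ge0.
Qed.

(** The infimum is attained because the condition can be checked vector by vector: for a given [psi]
    a slack of e / (norm of psi + 1) costs at most e. *)
Lemma op_bound_opnorm T : (opnorm T < +oo)%E -> op_bound T (fine (opnorm T)).
Proof.
move=> fT; have T0 := opnorm_ge0 T.
have Tfin : opnorm T \is a fin_num by rewrite ge0_fin_numE.
split; first exact: fine_ge0.
move=> psi fpsi.
have pfin : l2norm psi \is a fin_num by rewrite ge0_fin_numE ?l2norm_ge0.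
have near (e : R) : 0 < e -> op_bound T (fine (opnorm T) + e).
  move=> e0; have := lb_ereal_inf_adherent e0 Tfin.
  move=> [_ [c cT <-]]; rewrite -/(opnorm T) -[X in (_ < X + _)%E]fineK// lte_fin => /ltW h.
  exact: op_bound_le h cT.
apply/lee_addgt0Pr => e e0.
have a0 : 0 < fine (l2norm psi) + 1 by rewrite ltr_wpDl// fine_ge0// l2norm_ge0.
have e'0 : 0 < e / (fine (l2norm psi) + 1) by rewrite divr_gt0.
have [_ /(_ _ fpsi)] := near _ e'0.
move=> /le_trans; apply; rewrite -(fineK pfin) -!EFinM -EFinD lee_fin mulrDl lerD2l.
by rewrite mulrAC ler_pdivrMr// ler_wpM2l ?(ltW e0)// lerDl.
Qed.

Lemma op_bound_sub T S a b : op_bound T a -> op_bound S b -> op_bound (subop T S) (a + b).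
Proof.
move=> [a0 Ta] [b0 Sb]; split; first exact: addr_ge0.
move=> psi fpsi; apply: le_trans (l2norm_triangle (T psi) (fun s => - S psi s)%R) _.
rewrite (l2norm_opp (S psi)) EFinD ge0_muleDl ?lee_fin//.
by apply: leeD; [exact: Ta|exact: Sb].
Qed.

Lemma op_bound_comp T S a b : op_bound T a -> op_bound S b -> op_bound (T \o S) (a * b).
Proof.
move=> [a0 Ta] [b0 Sb]; split; first exact: mulr_ge0.
move=> psi fpsi; have h := Sb _ fpsi.
have fS : (l2norm (S psi) < +oo)%E.
  by apply: le_lt_trans h _; rewrite lte_mul_pinfty ?lee_fin.
apply: le_trans (Ta _ fS) _; rewrite EFinM -muleA.
by rewrite lee_wpmul2l ?lee_fin.
Qed.

End OperatorNorm.

Lemma alt_trueE (b c : bool) (a : alt_spec b b c) (T : Type) (f : b -> T) (y : T) (hb : b) :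
  match a with AltTrue h => f h | AltFalse _ => y end = f hb.
Proof. by case: a => [h|/negP//]; congr f; exact: bool_irrelevance. Qed.

Lemma alt_falseE (b c : bool) (a : alt_spec b b c) (T : Type) (f : b -> T) (y : T) :
  ~~ b -> match a with AltTrue h => f h | AltFalse _ => y end = y.
Proof. by case: a => [h /negP|]. Qed.

Section LocalOperators.
Local Open Scope sesquilinear_scope.
Context {R : realType} {L : choiceType} {q : L -> nat}.
Local Notation C := R[i].
Local Notation vec := (@vec R L q).
Local Notation op := (@op R L q).
Local Notation Conf := (Conf q).
Local Notation LConf := (LConf q).
Implicit Types (F G W : {fset L}) (s : Conf).

Lemma override_in F s (u : LConf F) (x : F) : override s u (val x) = u x.
Proof.
by case: x => x xF; exact: (alt_trueE _ _ _ xF).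
Qed.

Lemma override_notin F s (u : LConf F) (x : L) : x \notin F -> override s u x = s x.
Proof.
move=> xF.
exact: alt_falseE.
Qed.

Lemma conf_ext s s' : (forall x, s x = s' x) -> s = s'.
Proof. exact: functional_extensionality_dep. Qed.

Lemma restrE F s (x : F) : restr F s x = s (val x).
Proof. by rewrite ffunE. Qed.

Lemma restr_override F s (u : LConf F) : restr F (override s u) = u.
Proof. by apply/ffunP => x; rewrite restrE override_in. Qed.

Lemma override_restr F s : override s (restr F s) = s.
Proof.
apply: conf_ext => x; have [xF|xF] := boolP (x \in F); last by rewrite override_notin.
by rewrite -[x]/(val (FSetSub xF)) override_in restrE.
Qed.

Lemma override_override F s (u v : LConf F) : override (override s u) v = override s v.
Proof.
apply: conf_ext => x; have [xF|xF] := boolP (x \in F); last by rewrite !override_notin.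
by rewrite -[x]/(val (FSetSub xF)) !override_in.
Qed.

Lemma restr_override_disjoint F G s (u : LConf F) : [disjoint F & G]%fset ->
  restr G (override s u) = restr G s.
Proof.
move=> FG; apply/ffunP => x; rewrite !restrE override_notin//.
by apply: contraL (valP x); exact: (fdisjointP FG).
Qed.

Lemma override_comm F G s (u : LConf F) (v : LConf G) : [disjoint F & G]%fset ->
  override (override s u) v = override (override s v) u.
Proof.
move=> FG; apply: conf_ext => x; have [xF|xF] := boolP (x \in F).
  have xG : x \notin G by exact: (fdisjointP FG).
  by rewrite override_notin// -[x]/(val (FSetSub xF)) !override_in.
rewrite [RHS]override_notin//; have [xG|xG] := boolP (x \in G).
  by rewrite -[x]/(val (FSetSub xG)) !override_in.
by rewrite !override_notin.
Qed.

(** A configuration is a pair of its exterior part and its restriction to [F]. Exterior parts are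
    represented by the configurations that equal [u0] on [F], and the rest is summation over a
    product. *)
Lemma esum_blocks F (u0 : LConf F) (g : Conf -> \bar R) : (forall s, (0 <= g s)%E) ->
  (\esum_(s in [set: Conf]) g s =
   \esum_(s in [set s | restr F s = u0]) \sum_(u : LConf F) g (override s u))%E.
Proof.
move=> g0.
set D := [set s | restr F s = u0].
have sumE s : (\esum_(u in [set: LConf F]) g (override s u) =
    \sum_(u : LConf F) g (override s u))%E.
  rewrite esum_fset//; last by exact: finite_finset.
  rewrite (_ : [set: LConf F] = [set` index_enum (LConf F)]).
    by rewrite -fsbig_seq ?index_enum_uniq.
  by apply/seteqP; split => u //= _; rewrite mem_index_enum.
rewrite [RHS](eq_esum (b := fun s => (\esum_(u in [set: LConf F]) g (override s u))%E)); last first.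
  by move=> s _; rewrite sumE.
have dsum := @esum_esum R _ _ D (fun=> [set: LConf F]) (fun s u => g (override s u))
  (fun s u _ _ => g0 _).
apply: etrans (esym dsum).
apply: (@reindex_esum _ _ _ (D `*`` (fun=> [set: LConf F])) _ (fun p => override p.1 p.2)).
split.
- by [].
- move=> [s u] [s' u']; rewrite !inE /= => -[/= su _] [/= su' _] e.
  have uu : u = u' by rewrite -(restr_override s u) e restr_override.
  rewrite uu -[s](override_restr F) -[s'](override_restr F) su su'.
  by rewrite -(override_override s u u0) e override_override.
- move=> s _; exists (override s u0, restr F s) => /=.
    by split => //=; rewrite /D /= restr_override.
  by rewrite override_override override_restr.
Qed.

Definition contracts n (M : 'M[C]_n) (c : R) : Prop :=
  0 <= c /\ forall v : 'I_n -> C,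
    \sum_i sqmod (\sum_j M i j * v j) <= c ^+ 2 * \sum_j sqmod (v j).

Lemma esumZl_le (T : choiceType) (D : set T) (a : T -> \bar R) (c : R) : 0 <= c ->
  (forall x, (0 <= a x)%E) ->
  (\esum_(x in D) (c%:E * a x) <= c%:E * \esum_(x in D) a x)%E.
Proof.
move=> c0 a0; apply: ge_ereal_sup => _ [F [finF FD] <-].
rewrite fsbig_finite// -ge0_sume_distrr//.
rewrite lee_wpmul2l ?lee_fin//; apply: esum_ge; exists F => //.
by rewrite fsbig_finite.
Qed.

Lemma sum_LConf F (V : nmodType) (f : 'I_#|LConf F| -> V) :
  \sum_(u : LConf F) f (enum_rank u) = \sum_i f i.
Proof. by rewrite [RHS](reindex enum_rank)//; apply: onW_bij; exact: enum_rank_bij. Qed.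

Lemma local_op_bound F (M : 'M[C]_#|LConf F|) c : contracts M c ->
  op_bound (local_op M) c.
Proof.
move=> [c0 HM]; split=> // psi fpsi.
have pfin : l2norm psi \is a fin_num by rewrite ge0_fin_numE ?l2norm_ge0.
have psiE : (energy psi <= (fine (l2norm psi) ^+ 2)%:E)%E.
  by rewrite -l2norm_le ?fineK// fine_ge0// l2norm_ge0.
rewrite -(fineK pfin) -EFinM l2norm_le ?mulr_ge0 ?fine_ge0 ?l2norm_ge0//.
rewrite exprMn EFinM; apply: le_trans (lee_wpmul2l _ psiE); last by rewrite lee_fin sqr_ge0.
(* Some [q x] may be 0, and then there is no configuration at all and both sides vanish. Otherwise
   [s0] fixes the representative of each block, on which the operator acts as the matrix [M]. *)
have [[s0]|noconf] := pselect (inhabited Conf); last first.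
  rewrite /energy esum1; last by move=> s; case: noconf.
  by rewrite mule_ge0 ?energy_ge0// lee_fin sqr_ge0.
rewrite /energy !(esum_blocks (restr F s0)); try by move=> s; rewrite lee_fin sqmod_ge0.
apply: le_trans (esumZl_le _ _ _); rewrite ?sqr_ge0//; last first.
  by move=> s; apply: sume_ge0 => u _; rewrite lee_fin sqmod_ge0.
apply: le_esum => s _; rewrite !sumEFin -EFinM lee_fin.
have := HM (fun i => psi (override s (enum_val i))).
rewrite -[X in X <= _]sum_LConf -[X in _ <= _ * X]sum_LConf => hM.
apply: le_trans (le_trans _ hM) _; last first.
  by rewrite le_eqVlt; apply/orP; left; apply/eqP; congr (_ * _);
    apply: eq_bigr => u _; rewrite enum_rankK.
rewrite le_eqVlt; apply/orP; left; apply/eqP; apply: eq_bigr => u _; congr sqmod.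
rewrite /local_op restr_override -[RHS]sum_LConf; apply: eq_bigr => w _.
by rewrite enum_rankK override_override.
Qed.

Lemma local_opM F (M N : 'M[C]_#|LConf F|) :
  local_op (M *m N) = local_op M \o local_op N :> op.
Proof.
apply: funext => psi; apply: funext => s /=; rewrite /local_op.
under [RHS]eq_bigr => u _.
  rewrite restr_override mulr_sumr.
  under eq_bigr do rewrite override_override mulrA.
  over.
rewrite exchange_big /=; apply: eq_bigr => w _.
rewrite mxE -mulr_suml; congr (_ * _).
by rewrite -[LHS](sum_LConf (fun j => M (enum_rank (restr F s)) j * N j (enum_rank w))).
Qed.

Lemma local_opD F (M N : 'M[C]_#|LConf F|) psi s :
  local_op (M + N) psi s = local_op M psi s + local_op N psi s.
Proof. by rewrite /local_op -big_split; apply: eq_bigr => u _; rewrite mxE mulrDl. Qed.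

Lemma local_opZ F (c : C) (M : 'M[C]_#|LConf F|) psi s :
  local_op (c *: M) psi s = c * local_op M psi s.
Proof. by rewrite /local_op mulr_sumr; apply: eq_bigr => u _; rewrite mxE mulrA. Qed.

Lemma local_opN F (M : 'M[C]_#|LConf F|) psi s :
  local_op (- M) psi s = - local_op M psi s.
Proof. by rewrite -scaleN1r local_opZ mulN1r. Qed.

Lemma local_op0 F psi s : local_op (0 : 'M[C]_#|LConf F|) psi s = 0.
Proof. by rewrite -(scale0r (0 : 'M[C]_#|LConf F|)) local_opZ mul0r. Qed.

Lemma local_op_sum F (I : Type) (r : seq I) (P : pred I) (M : I -> 'M[C]_#|LConf F|) psi s :
  local_op (\sum_(i <- r | P i) M i) psi s = \sum_(i <- r | P i) local_op (M i) psi s.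
Proof.
by elim/big_rec2: _ => [|i y1 y2 _ <-]; rewrite ?local_op0// local_opD.
Qed.

Lemma local_op1 F : local_op (1%:M : 'M[C]_#|LConf F|) = id :> op.
Proof.
apply: funext => psi; apply: funext => s; rewrite /local_op (bigD1 (restr F s))//=.
rewrite mxE eqxx mul1r override_restr big1 ?addr0// => u us.
by rewrite mxE (inj_eq enum_rank_inj) eq_sym (negbTE us) mul0r.
Qed.

Lemma local_op_linear F (M : 'M[C]_#|LConf F|) phi psi s :
  local_op M (fun s => phi s - psi s) s = local_op M phi s - local_op M psi s.
Proof. by rewrite /local_op -sumrB; apply: eq_bigr => u _; rewrite mulrBr. Qed.

Lemma local_op_disjoint F G (M : 'M[C]_#|LConf F|) (N : 'M[C]_#|LConf G|) :
  [disjoint F & G]%fset ->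
  local_op M \o local_op N = local_op N \o local_op M :> op.
Proof.
move=> FG; apply: funext => psi; apply: funext => s; rewrite /= /local_op.
under eq_bigr do rewrite mulr_sumr.
under [RHS]eq_bigr do rewrite mulr_sumr.
rewrite exchange_big /=; apply: eq_bigr => w _; apply: eq_bigr => u _.
rewrite restr_override_disjoint// restr_override_disjoint; last by rewrite fdisjoint_sym.
by rewrite mulrCA override_comm.
Qed.

Lemma sqmodM (x y : C) : sqmod (x * y) = sqmod x * sqmod y.
Proof. by case: x y => [a b] [c d]; rewrite /sqmod /=; ring. Qed.

Lemma sqmodD_le (x y : C) : sqmod (x + y) <= 2 * (sqmod x + sqmod y).
Proof.
case: x y => [a b] [c d]; rewrite /sqmod /= -subr_ge0.
rewrite (_ : _ - _ = (a - c) ^+ 2 + (b - d) ^+ 2); last by ring.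
by rewrite addr_ge0 ?sqr_ge0.
Qed.

Lemma sqmod0 : sqmod (0 : C) = 0.
Proof. by rewrite /sqmod /= expr0n addr0. Qed.

Lemma sqmod_sum_le (I : Type) (r : seq I) (z : I -> C) :
  sqmod (\sum_(i <- r) z i) <= 2 ^+ size r * \sum_(i <- r) sqmod (z i).
Proof.
elim: r => [|i r IH]; first by rewrite !big_nil sqmod0 mulr0.
rewrite !big_cons /= exprS -mulrA; apply: le_trans (sqmodD_le _ _) _.
rewrite ler_pM2l// mulrDr lerD// ler_peMl ?sqmod_ge0//.
by rewrite exprn_ege1// ler1n.
Qed.

Lemma contracts_exists n (M : 'M[C]_n) : exists c, contracts M c.
Proof.
set K := 2 ^+ size (index_enum 'I_n) * \sum_i \sum_j sqmod (M i j) : R.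
have sq0 (I : Type) (r : seq I) (z : I -> C) : 0 <= \sum_(i <- r) sqmod (z i).
  by apply: sumr_ge0 => i _; exact: sqmod_ge0.
have K0 : 0 <= K by rewrite mulr_ge0 ?exprn_ge0// sumr_ge0.
exists (Num.sqrt K); split=> [|v]; first exact: sqrtr_ge0.
rewrite sqr_sqrtr// -mulrA mulr_suml mulr_sumr ler_sum// => i _.
apply: le_trans (sqmod_sum_le _ _) _; rewrite ler_wpM2l ?exprn_ge0//.
rewrite mulr_suml ler_sum// => j _; rewrite sqmodM ler_wpM2l ?sqmod_ge0//.
by rewrite (bigD1 j)//= lerDl sumr_ge0// => k _; exact: sqmod_ge0.
Qed.

Lemma contracts_diag n (d : 'rV[C]_n) (c : R) : 0 <= c ->
  (forall i, sqmod (d 0 i) <= c ^+ 2) -> contracts (diag_mx d) c.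
Proof.
move=> c0 dc; split=> // v; rewrite mulr_sumr ler_sum// => i _.
rewrite (bigD1 i)//= big1 ?addr0 => [|j ji].
  by rewrite mxE eqxx mulr1n sqmodM ler_wpM2r ?sqmod_ge0.
by rewrite mxE eq_sym (negbTE ji) mulr0n mul0r.
Qed.

Lemma sqmodE (z : C) : (sqmod z)%:C%C = z^* * z.
Proof. by rewrite -normCKC -add_Re2_Im2. Qed.

Lemma contracts_unitary n (M : 'M[C]_n) : M^t* *m M = 1%:M -> contracts M 1.
Proof.
move=> MM; split=> // v; rewrite expr1n mul1r le_eqVlt; apply/orP; left; apply/eqP.
apply: (@complexI R); rewrite !raddf_sum /=.
under eq_bigr do rewrite sqmodE.
under [RHS]eq_bigr do rewrite sqmodE.
pose w : 'cV[C]_n := \col_j v j.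
have dotE (x : 'cV[C]_n) : (x^t* *m x) 0 0 = \sum_i (x i 0)^* * x i 0.
  by rewrite mxE; apply: eq_bigr => i _; rewrite !mxE.
transitivity (((M *m w)^t* *m (M *m w)) 0 0).
  rewrite dotE; apply: eq_bigr => i _.
  have -> // : (M *m w) i 0 = \sum_j M i j * v j.
  by rewrite mxE; apply: eq_bigr => j _; rewrite mxE.
rewrite trmx_mul map_mxM -mulmxA (mulmxA _ M w) MM mul1mx dotE.
by apply: eq_bigr => i _; rewrite mxE.
Qed.

End LocalOperators.

(** * Unitary dynamics in a finite volume *)

Section UnitPhase.
Context {R : realType}.
Local Notation C := R[i].
Implicit Types (x y : R).

Definition expi x : C := (cos x +i* sin x)%C.

Lemma expi0 : expi 0 = 1.
Proof. by rewrite /expi cos0 sin0. Qed.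

Lemma expiD x y : expi (x + y) = expi x * expi y.
Proof.
rewrite /expi cosD sinD; apply/eqP; rewrite eq_complex /=.
by apply/andP; split; apply/eqP; ring.
Qed.

Lemma sqmod_expi x : sqmod (expi x) = 1.
Proof. by rewrite /sqmod /= cos2Dsin2. Qed.

Lemma cos_ge_quadratic x : `|cos x - 1| <= x ^+ 2 / 2 /\ `|sin x| <= `|x|.
Proof.
have sin_le y : `|sin y| <= `|y|.
  wlog y0 : y / 0 <= y.
    move=> W; case: (leP 0 y) => [|/ltW y0]; first exact: W.
    by have := W (- y); rewrite sinN !normrN oppr_ge0; apply.
  have [c _] := MVT_segment y0 (fun z _ => is_derive_sin z)
    (continuous_subspaceT (@continuous_sin R)).
  rewrite sin0 !subr0 => ->; rewrite normrM ler_piMl//; exact: cos_max.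
split=> //.
have -> : cos x - 1 = - (2 * sin (x / 2) ^+ 2).
  have := cosD (x / 2) (x / 2); have := cos2Dsin2 (x / 2).
  by rewrite -splitr -!expr2 => h ->; lra.
rewrite normrN normrM ger0_norm// normrX.
apply: le_trans (_ : 2 * `|x / 2| ^+ 2 <= _).
  by rewrite ler_pM2l// lerXn2r ?nnegrE.
by rewrite real_normK ?num_real//; lra.
Qed.

Lemma sin_linear x : `|sin x - x| <= x ^+ 2.
Proof.
wlog x0 : x / 0 <= x.
  move=> W; case: (leP 0 x) => [|/ltW x0]; first exact: W.
  by have := W (- x); rewrite sinN oppr_ge0 sqrrN -opprD normrN; apply.
have [c] := MVT_segment x0 (fun z _ => is_derive_sin z)
  (continuous_subspaceT (@continuous_sin R)).
rewrite in_itv /= => /andP[c0 cx].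
rewrite sin0 !subr0 => e.
have -> : sin x - x = (cos c - 1) * x by rewrite {1}e; ring.
rewrite normrM (ger0_norm x0) expr2 ler_wpM2r//.
apply: le_trans cx.
have [c2 _] := cos_ge_quadratic c.
have [cle|cgt] := leP c 2; first by apply: le_trans c2 _; nra.
apply: le_trans (ltW cgt).
have := cos_max c; rewrite ler_norml => /andP[h1 h2].
by rewrite ler_norml; apply/andP; split; lra.
Qed.

Lemma expi_expand x : sqmod (expi x - (1 + (0 +i* x)%C)) <= (2 * x ^+ 2) ^+ 2.
Proof.
have [hc _] := cos_ge_quadratic x; have hs := sin_linear x.
rewrite /sqmod /expi /= !(oppr0, addr0, add0r).
have x2 := sqr_ge0 x.
have h1 : (cos x - 1) ^+ 2 <= (x ^+ 2) ^+ 2.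
  rewrite -real_normK ?num_real// lerXn2r ?nnegrE//.
  by apply: le_trans hc _; lra.
have h2 : (sin x - x) ^+ 2 <= (x ^+ 2) ^+ 2.
  by rewrite -real_normK ?num_real// lerXn2r ?nnegrE.
rewrite exprMn; have := sqr_ge0 (x ^+ 2); lra.
Qed.

Definition complex_cvg (u : nat -> C) (l : C) : Prop :=
  (complex.Re (u n) @[n --> \oo] --> complex.Re l) /\
  (complex.Im (u n) @[n --> \oo] --> complex.Im l).

Lemma complex_cvg_clim (u : nat -> C) l : complex_cvg u l -> clim u = l.
Proof.
by move=> [hr hi]; rewrite /clim (cvg_lim _ hr)// (cvg_lim _ hi)//; case: l hr hi.
Qed.

Lemma complex_cvgMl (b : C) (u : nat -> C) l : complex_cvg u l ->
  complex_cvg (fun n => u n * b) (l * b).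
Proof.
case: b => b1 b2; case: l => l1 l2 [/= hr hi]; split => /=.
  rewrite [X in X @ \oo --> _](_ : _ = fun n => complex.Re (u n) * b1 - complex.Im (u n) * b2).
    by apply: cvgB; apply: cvgMr_tmp.
  by apply/funext => n; case: (u n).
rewrite [X in X @ \oo --> _](_ : _ = fun n => complex.Re (u n) * b2 + complex.Im (u n) * b1).
  by apply: cvgD; apply: cvgMr_tmp.
by apply/funext => n; case: (u n).
Qed.

Lemma complex_cvg_sum (I : Type) (r : seq I) (u : I -> nat -> C) (l : I -> C) :
  (forall i, complex_cvg (u i) (l i)) ->
  complex_cvg (fun n => \sum_(i <- r) u i n) (\sum_(i <- r) l i).
Proof.
move=> H; elim: r => [|i r [IHr IHi]].
  by split; rewrite big_nil; under eq_cvg do rewrite big_nil; exact: cvg_cst.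
have [hr hi] := H i.
split; rewrite big_cons raddfD /=.
  rewrite [X in X @ \oo --> _](_ : _ =
      fun n => complex.Re (u i n) + complex.Re (\sum_(j <- r) u j n)).
    exact: cvgD.
  by apply/funext => n; rewrite big_cons raddfD.
rewrite [X in X @ \oo --> _](_ : _ =
    fun n => complex.Im (u i n) + complex.Im (\sum_(j <- r) u j n)).
  exact: cvgD.
by apply/funext => n; rewrite big_cons raddfD.
Qed.

Lemma expi_term x k :
  (0 +i* x)%C ^+ k / k`!%:R = (cos_coeff x k +i* sin_coeff x k)%C.
Proof.
have pw m : (0 +i* x)%C ^+ m.*2 = ((-1) ^+ m * x ^+ m.*2)%:C%C.
  rewrite -mul2n !exprM -exprMn rmorphXn; congr (_ ^+ _).
  apply/eqP; rewrite expr2 eq_complex /=; apply/andP; split; apply/eqP; ring.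
have fact j : (j`!%:R : C)^-1 = ((j`!%:R)^-1)%:C%C by rewrite fmorphV rmorph_nat.
rewrite fact; have [m [->|->]] : exists m, k = m.*2 \/ k = m.*2.+1.
  by exists k./2; have := odd_double_half k; case: (odd k) => e; [right|left]; rewrite -[LHS]e.
- by rewrite pw -cos_coeff'E sin_coeff_even -rmorphM.
- rewrite exprS pw cos_coeff_odd -sin_coeff'E -mulrA -rmorphM /sin_coeff' -exprnP.
  apply/eqP; rewrite eq_complex /= exprS; apply/andP; split; apply/eqP; ring.
Qed.

End UnitPhase.

(** * Functional calculus of a Hermitian matrix *)

Section Spectral.
Context {R : realType}.
Local Open Scope sesquilinear_scope.
Local Notation C := R[i].

Lemma contracts_mul n (M N : 'M[C]_n) a b :
  contracts M a -> contracts N b -> contracts (M *m N) (a * b).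
Proof.
move=> [a0 Ma] [b0 Nb]; split=> [|v]; first exact: mulr_ge0.
have := Ma (fun j => \sum_k N j k * v k).
have -> : \sum_i sqmod (\sum_j M i j * \sum_k N j k * v k) =
    \sum_i sqmod (\sum_j (M *m N) i j * v j).
  apply: eq_bigr => i _; congr sqmod; under eq_bigr do rewrite mulr_sumr.
  rewrite exchange_big; apply: eq_bigr => k _; rewrite mxE mulr_suml.
  by apply: eq_bigr => j _; rewrite mulrA.
move/le_trans; apply; rewrite exprMn -[leRHS]mulrA ler_wpM2l ?sqr_ge0//; exact: Nb.
Qed.

Section Mode.
Context {n : nat}.
Variable M : 'M[C]_n.
Hypothesis herm : M \is hermsymmx.

Local Notation P := (spectralmx M).
Definition eigenval (i : 'I_n) : R := complex.Re (spectral_diag M 0 i).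
(** The functional calculus f(M), with [f] indexed by the positions in the spectrum instead of the
    eigenvalues. The flow exp(itM) and the spectral projections are both instances. *)
Definition mode (f : 'I_n -> C) : 'M[C]_n := P^t* *m diag_mx (\row_i f i) *m P.

Lemma spectral_left : P^t* *m P = 1%:M.
Proof. by rewrite -invmx_unitary ?spectral_unitarymx// mulVmx// spectral_unit. Qed.

Lemma spectral_right : P *m P^t* = 1%:M.
Proof. exact/unitarymxP/spectral_unitarymx. Qed.

Lemma mode_mul f g : mode f *m mode g = mode (fun i => f i * g i).
Proof.
transitivity (P^t* *m (diag_mx (\row_i f i) *m (P *m P^t*) *m diag_mx (\row_i g i)) *m P).
  by rewrite /mode !mulmxA.
rewrite spectral_right mulmx1 mulmx_diag /mode.
have -> // : \row_j ((\row_i f i) 0 j * (\row_i g i) 0 j) = \row_i (f i * g i).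
by apply/rowP => i; rewrite !mxE.
Qed.

Lemma mode_lin (a b : C) f g :
  mode (fun i => a * f i + b * g i) = a *: mode f + b *: mode g.
Proof.
have sc (c : C) (X : 'M[C]_n) : c *: (P^t* *m X *m P) = P^t* *m (c *: X) *m P.
  by rewrite -scalemxAr -scalemxAl.
rewrite /mode !sc -mulmxDl -mulmxDr; congr (_ *m _ *m _).
by apply/matrixP => i j; rewrite !mxE; case: eqP; rewrite ?mulr1n ?mulr0n ?mulr0 ?addr0.
Qed.

Lemma mode1 : mode (fun=> 1) = 1%:M.
Proof.
rewrite /mode (_ : diag_mx _ = 1%:M) ?mulmx1 ?spectral_left//.
by rewrite -diag_const_mx; congr diag_mx; apply/rowP => i; rewrite !mxE.
Qed.

Lemma mode_eigenval : mode (fun i => ((eigenval i)%:C)%C) = M.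
Proof.
have /hermitian_normalmx /orthomx_spectralP e := herm.
rewrite invmx_unitary in e; last exact: spectral_unitarymx.
apply: etrans (esym e); rewrite /mode.
have -> // : \row_i ((eigenval i)%:C)%C = spectral_diag M.
apply/rowP => i; rewrite !mxE /eigenval.
have /mxOverP /(_ 0 i) := hermitian_spectral_diag_real herm.
by move=> /RRe_real.
Qed.

Lemma contracts_mode f c : 0 <= c -> (forall i, sqmod (f i) <= c ^+ 2) ->
  contracts (mode f) c.
Proof.
move=> c0 fc; rewrite -[c]mul1r -[1 * c]mulr1; apply: contracts_mul.
  apply: contracts_mul; first by apply/contracts_unitary; rewrite trmxCK spectral_right.
  by apply: contracts_diag => // i; rewrite mxE.
by apply/contracts_unitary; rewrite spectral_left.
Qed.

Definition mxflow (t : R) : 'M[C]_n := mode (fun i => expi (t * eigenval i)).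

Lemma mxflow_expand t :
  mxflow t - (1%:M + (0 +i* t)%C *: M) =
  mode (fun i => expi (t * eigenval i) - (1 + (0 +i* (t * eigenval i))%C)).
Proof.
have -> : (fun i => expi (t * eigenval i) - (1 + (0 +i* (t * eigenval i))%C)) =
    (fun i => 1 * expi (t * eigenval i) +
       (-1) * (1 * 1 + (0 +i* t)%C * ((eigenval i)%:C)%C)).
  apply: funext => i; rewrite !mul1r mulN1r; congr (_ - (_ + _)).
  by apply/eqP; rewrite eq_complex /=; apply/andP; split; apply/eqP; ring.
rewrite mode_lin scale1r scaleN1r.
rewrite (mode_lin 1 (0 +i* t)%C (fun=> 1) (fun i => ((eigenval i)%:C)%C)).
by rewrite scale1r mode1 mode_eigenval.
Qed.

End Mode.
End Spectral.

(** * The matrices of a finite volume as a seminormed ring with flows *)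

Section MatrixFlow.
Context {R : realType} {L : choiceType} {q : L -> nat}.
Variable W : {fset L}.
Local Open Scope sesquilinear_scope.
Local Notation C := R[i].
Local Notation LW := (LConf q W).
Local Notation mat := 'M[C]_#|LW|.
Local Notation loc := (@local_op R L q W).

(** The norm is measured on the whole space of configurations, so extending a matrix to a larger
    volume does not change it. It is only a seminorm: it vanishes identically when some [q x] is
    0. *)
Definition mxnorm (M : mat) : R := fine (opnorm (loc M)).
Definition mxscalar (r : R) : mat := ((r%:C)%C)%:M.

Lemma mxnorm_bound (M : mat) : op_bound (loc M) (mxnorm M).
Proof.
have [c Mc] := contracts_exists M.
by apply/op_bound_opnorm/(le_lt_trans (opnorm_le (local_op_bound Mc))); exact: ltry.
Qed.

Lemma opnorm_local (M : mat) : opnorm (loc M) = (mxnorm M)%:E.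
Proof.
have [c Mc] := contracts_exists M.
rewrite fineK// ge0_fin_numE ?opnorm_ge0//.
by apply: (le_lt_trans (opnorm_le (local_op_bound Mc))); exact: ltry.
Qed.

Lemma mxnorm_le (M : mat) c : op_bound (loc M) c -> mxnorm M <= c.
Proof. by move=> /opnorm_le; rewrite opnorm_local lee_fin. Qed.

Lemma mxnorm_ge0 M : 0 <= mxnorm M.
Proof. by rewrite fine_ge0// opnorm_ge0. Qed.

Lemma op_bound_ext (T T' : @op R L q) c : T =2 T' -> op_bound T c -> op_bound T' c.
Proof.
by move=> TT'; have -> // : T = T'; apply: funext => psi; apply: funext => s.
Qed.

Lemma mxnormN_le M : mxnorm (- M) <= mxnorm M.
Proof.
have [c0 H] := mxnorm_bound M; apply: mxnorm_le; split=> // psi fpsi.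
have -> : loc (- M) psi = (fun s => - loc M psi s).
  by apply: funext => s; rewrite local_opN.
by rewrite l2norm_opp; exact: H.
Qed.

Lemma mxnormD_le M N : mxnorm (M + N) <= mxnorm M + mxnorm N.
Proof.
apply: mxnorm_le.
apply: (op_bound_le (lerD (lexx _) (mxnormN_le N))).
apply: op_bound_ext (op_bound_sub (mxnorm_bound M) (mxnorm_bound (- N))) => psi s.
by rewrite /subop local_opN opprK local_opD.
Qed.

Lemma mxnorm_is_ring_norm : is_ring_norm mxnorm mxscalar.
Proof.
split.
- exact: mxnorm_ge0.
- apply/le_anti; rewrite mxnorm_ge0 andbT; apply: mxnorm_le; split=> // psi _.
  rewrite mul0e (_ : loc 0 psi = fun=> 0); last by apply: funext => s; rewrite local_op0.
  by rewrite l2norm_le// expr0n; apply: energy_le => r _; rewrite big1// => s _; rewrite sqmod0.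
- exact: mxnormD_le.
- exact: mxnormN_le.
- move=> M N; apply: mxnorm_le; rewrite -[M * N]/(M *m N) local_opM.
  exact: op_bound_comp (mxnorm_bound M) (mxnorm_bound N).
- move=> r; apply/mxnorm_le/local_op_bound; rewrite /mxscalar -diag_const_mx.
  apply: contracts_diag => // i; rewrite mxE /sqmod /= expr0n addr0.
  by rewrite real_normK ?num_real.
- by move=> r M; rewrite /mxscalar -[_ * M]/(_ *m M) -[M * _]/(M *m _) scalar_mxC.
- by move=> r; rewrite /mxscalar rmorphN raddfN.
Qed.

Section Hamiltonian.
Variable M : mat.
Hypothesis herm : M \is hermsymmx.

Lemma mxflow_is_flow :
  is_flow mxnorm mxscalar (2 * \sum_i eigenval M i ^+ 2) ((0 +i* 1)%C *: M) (mxflow M).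
Proof.
have S0 : 0 <= \sum_i eigenval M i ^+ 2 by apply: sumr_ge0 => i _; exact: sqr_ge0.
split.
- apply: etrans (mode1 M); congr mode; apply: funext => i; rewrite mul0r expi0//.
- move=> x y; rewrite -[RHS]/(_ *m _) mode_mul; congr mode; apply: funext => i.
  by rewrite mulrDl expiD.
- move=> x; apply/mxnorm_le/local_op_bound/contracts_mode => // i.
  by rewrite sqmod_expi expr1n.
- move=> x.
  have -> : mxscalar x * ((0 +i* 1)%C *: M) = (0 +i* x)%C *: M.
    rewrite -[LHS]/(_ *m _) mul_scalar_mx scalerA; congr (_ *: _).
    by apply/eqP; rewrite eq_complex /=; apply/andP; split; apply/eqP; ring.
  rewrite -[1 : mat]/(1%:M) mxflow_expand//.
  apply/mxnorm_le/local_op_bound/contracts_mode => [|i].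
    by rewrite mulr_ge0 ?sqr_ge0// mulr_ge0.
  apply: le_trans (expi_expand _) _.
  have le1 : 2 * (x * eigenval M i) ^+ 2 <= 2 * (\sum_i eigenval M i ^+ 2) * x ^+ 2.
    rewrite exprMn -[leRHS]mulrA ler_pM2l// mulrC ler_wpM2r ?sqr_ge0//.
    by rewrite (bigD1 i)//= lerDl sumr_ge0// => j _; exact: sqr_ge0.
  have ge0 : 0 <= 2 * (x * eigenval M i) ^+ 2 by rewrite mulr_ge0 ?sqr_ge0.
  by apply: lerXn2r => //; rewrite nnegrE (le_trans ge0).
Qed.

Lemma local_op_iter k psi :
  iter k (loc M) psi = loc (mode M (fun i => ((eigenval M i)%:C)%C ^+ k)) psi.
Proof.
elim: k => [|k IH] /=; first by rewrite mode1 local_op1.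
rewrite IH -[LHS]/((loc M \o loc (mode M _)) psi) -local_opM.
by rewrite -[X in X *m _](mode_eigenval herm) mode_mul; congr (loc (mode M _) psi);
  apply: funext => i; rewrite exprS.
Qed.

Lemma local_op_mode f psi s : loc (mode M f) psi s =
  \sum_i f i * loc (mode M (fun j => (j == i)%:R)) psi s.
Proof.
have -> : mode M f = \sum_i f i *: mode M (fun j => (j == i)%:R).
  rewrite /mode; under eq_bigr do rewrite scalemxAl scalemxAr.
  rewrite -mulmx_suml -mulmx_sumr; congr (_ *m _ *m _).
  apply/matrixP => i j; rewrite summxE (bigD1 i)//= big1 => [|k ki].
    by rewrite !mxE eqxx; case: eqP => _; rewrite ?mulr1n ?mulr0n ?mulr1 ?mulr0 addr0.
  by rewrite !mxE eq_sym (negbTE ki) mul0rn mulr0.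
by rewrite local_op_sum; apply: eq_bigr => i _; rewrite local_opZ.
Qed.

(** At each configuration the power series splits into finitely many scalar exponential series, one
    per eigenvalue, with the values of the spectral projections as coefficients. *)
Lemma expop_local (t : R) : expop (0 +i* t)%C (loc M) = loc (mxflow M t).
Proof.
apply: funext => psi; apply: funext => s; rewrite /expop; apply: complex_cvg_clim.
rewrite local_op_mode.
set b := fun i => loc (mode M (fun j => (j == i)%:R)) psi s.
have -> : (fun n => \sum_(k < n) (0 +i* t)%C ^+ k / k`!%:R * iter k (loc M) psi s) =
   (fun n => \sum_i (\sum_(k < n) (0 +i* (t * eigenval M i))%C ^+ k / k`!%:R) * b i).
  apply: funext => n; under eq_bigr do rewrite local_op_iter local_op_mode mulr_sumr.
  rewrite exchange_big; apply: eq_bigr => i _; rewrite mulr_suml; apply: eq_bigr => k _.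
  rewrite !mulrA; congr (_ * _); rewrite mulrAC -exprMn; congr (_ ^+ _ / _).
  by apply/eqP; rewrite eq_complex /=; apply/andP; split; apply/eqP; ring.
apply: complex_cvg_sum => i; apply: complex_cvgMl.
under eq_fun do under eq_bigr do rewrite expi_term.
have sumE n (f g : nat -> R) : \sum_(k < n) (f k +i* g k)%C = ((series f n) +i* (series g n))%C.
  rewrite /series /=; elim: n => [|n IH]; first by rewrite big_ord0 !big_geq.
  by rewrite big_ord_recr /= IH !big_nat_recr.
under eq_fun do rewrite (sumE _ (cos_coeff _) (sin_coeff _)).
move: (t * eigenval M i) => x; split; rewrite /expi /=.
- by rewrite cos.unlock; exact: is_cvg_series_cos_coeff.
- by rewrite sin.unlock; exact: is_cvg_series_sin_coeff.
Qed.

End Hamiltonian.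
End MatrixFlow.

(** * Extending a matrix to a larger finite volume *)

Section Extension.
Context {R : realType} {L : choiceType} {q : L -> nat}.
Local Open Scope sesquilinear_scope.
Local Notation C := R[i].
Local Notation op := (@op R L q).
Context {F W : {fset L}}.
Hypothesis FW : (F `<=` W)%fset.
Implicit Types (u w : LConf q W) (v : LConf q F).

Definition lrestr u : LConf q F := finfun (fun x : F => u (fincl FW x)).

Definition loverride u v : LConf q W :=
  finfun (fun x : W => match boolP (val x \in F) with
    | AltTrue h => v (FSetSub h)
    | AltFalse _ => u x
    end).

Lemma restr_lrestr (s : Conf q) : lrestr (restr W s) = restr F s.
Proof. by apply/ffunP => x; rewrite !ffunE. Qed.

Lemma restr_loverride (s : Conf q) v : loverride (restr W s) v = restr W (override s v).
Proof.
by apply/ffunP => x; rewrite !ffunE.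
Qed.
Lemma loverride_in u v (x : W) (xF : val x \in F) : loverride u v x = v (FSetSub xF).
Proof.
by rewrite ffunE (alt_trueE _ _ _ xF).
Qed.

Lemma loverride_notin u v (x : W) : val x \notin F -> loverride u v x = u x.
Proof.
move=> xF.
by rewrite ffunE; exact: alt_falseE.
Qed.

Lemma lrestr_loverride u v : lrestr (loverride u v) = v.
Proof.
apply/ffunP => x; rewrite ffunE.
have xF : val (fincl FW x) \in F by exact: (valP x).
rewrite (loverride_in _ _ xF); move: xF; case: x => x xF' xF.
by rewrite (bool_irrelevance xF xF').
Qed.

Lemma loverride_lrestr u : loverride u (lrestr u) = u.
Proof.
apply/ffunP => x; have [xF|xF] := boolP (val x \in F); last by rewrite loverride_notin.
rewrite (loverride_in _ _ xF) ffunE; case: x xF => x xW xF.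
by rewrite /fincl /= (bool_irrelevance (fsubsetP FW _ _) xW).
Qed.

Lemma loverride_loverride u v v' : loverride (loverride u v) v' = loverride u v'.
Proof.
apply/ffunP => x; have [xF|xF] := boolP (val x \in F); last by rewrite !loverride_notin.
by rewrite !(loverride_in _ _ xF).
Qed.

Lemma override_loverride (s : Conf q) v :
  override s (loverride (restr W s) v) = override s v.
Proof.
rewrite restr_loverride; apply: conf_ext => x; have [xW|xW] := boolP (x \in W).
  by rewrite -[x]/(val (FSetSub xW)) override_in restrE.
rewrite !override_notin//; by apply: contra xW; exact: (fsubsetP FW).
Qed.

(* the matrix of [M (x) 1] on the sites of [W] *)
Definition mxext (M : 'M[C]_#|LConf q F|) : 'M[C]_#|LConf q W| :=
  \matrix_(i, j) (if enum_val j == loverride (enum_val i) (lrestr (enum_val j))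
    then M (enum_rank (lrestr (enum_val i))) (enum_rank (lrestr (enum_val j)))
    else 0).

Lemma local_op_ext M : local_op (mxext M) = local_op M :> op.
Proof.
apply: funext => psi; apply: funext => s; rewrite /local_op.
under eq_bigr => w _.
  rewrite mxE !enum_rankK (fun_if (fun z => z * psi (override s w))) mul0r.
  over.
rewrite -big_mkcond /= (reindex_onto (loverride (restr W s)) lrestr); last first.
  by move=> w /eqP.
apply: eq_big => v; first by rewrite lrestr_loverride !eqxx.
by move=> _; rewrite lrestr_loverride restr_lrestr override_loverride.
Qed.

Lemma mxext_herm M : M \is hermsymmx -> mxext M \is hermsymmx.
Proof.
move=> /is_hermitianmxP; rewrite expr0 scale1r => MM.
apply/is_hermitianmxP; rewrite expr0 scale1r; apply/matrixP => i j; rewrite !mxE.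
set u := enum_val i; set w := enum_val j.
have sym : (w == loverride u (lrestr w)) = (u == loverride w (lrestr u)).
  by apply/eqP/eqP => e; rewrite e loverride_loverride loverride_lrestr.
rewrite sym; case: ifP => _; last by rewrite conjC0.
by rewrite {1}MM !mxE.
Qed.

End Extension.

Lemma sum_le_esum {R : realType} {T : choiceType} (D : set T) (f : T -> \bar R) (r : seq T)
    (P : pred T) (g : T -> R) : uniq r ->
  (forall x, (0 <= f x)%E) ->
  (forall x, x \in r -> P x -> D x /\ ((g x)%:E <= f x)%E) ->
  ((\sum_(x <- r | P x) g x)%:E <= \esum_(x in D) f x)%E.
Proof.
move=> ur f0 H; apply: esum_ge; exists [set` [seq x <- r | P x]].
  split; first exact: finite_seq.
  by move=> x /=; rewrite mem_filter => /andP[Px xr]; have [] := H x xr Px.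
rewrite -fsbig_seq ?filter_uniq// big_filter -sumEFin.
rewrite big_seq_cond [leRHS]big_seq_cond; apply: lee_sum => x /andP[xr Px].
by have [] := H x xr Px.
Qed.

Lemma is_flow_le {R : realType} {T : pzRingType} {nrm : T -> R} {s : R -> T} K K' k U :
  K <= K' -> is_flow nrm s K k U -> is_flow nrm s K' k U.
Proof.
move=> KK' [U0 UD Un Ue]; split=> // x; apply: le_trans (Ue x) _.
by rewrite ler_wpM2r ?sqr_ge0.
Qed.

(** * Truncated Hamiltonians in a finite volume *)

Section FiniteVolume.
Context {R : realType} {d : nat} {L : choiceType} {q : L -> nat}.
Local Open Scope sesquilinear_scope.
Variables (pos : L -> 'rV[R]_d) (H : @interaction R L q) (V W : {fset L}).
Hypothesis VW : (V `<=` W)%fset.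
Hypothesis Hsa : self_adjoint H.
Local Notation C := R[i].
Local Notation mat := 'M[C]_#|LConf q W|.
Local Notation loc := (@local_op R L q W).

Definition mxlift (F : {fset L}) (M : 'M[C]_#|LConf q F|) : mat :=
  match boolP (F `<=` W)%fset with
  | AltTrue h => mxext h M
  | AltFalse _ => 0
  end.

Lemma mxliftE F (M : 'M[C]_#|LConf q F|) (FW : (F `<=` W)%fset) : mxlift M = mxext FW M.
Proof.
exact: alt_trueE.
Qed.

Lemma mxlift0 F (M : 'M[C]_#|LConf q F|) : ~~ (F `<=` W)%fset -> mxlift M = 0.
Proof.
move=> FW.
exact: alt_falseE.
Qed.

Lemma local_op_lift F (M : 'M[C]_#|LConf q F|) : (F `<=` W)%fset ->
  loc (mxlift M) = local_op M.
Proof. by move=> FW; rewrite mxliftE local_op_ext. Qed.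

Definition hterm (Z : {fset L}) : mat := mxlift (H Z).
Definition kterm (Z : {fset L}) : mat := (0 +i* 1)%C *: hterm Z.
Definition ham (P : pred {fset L}) : mat := \sum_(Z <- fpowerset V | P Z) hterm Z.
Definition site_support (X : {fset L}) (m : mat) : Prop :=
  exists M : 'M[C]_#|LConf q X|, loc m = local_op M.

Lemma volume_sub Z : Z \in fpowerset V -> (Z `<=` W)%fset.
Proof. by rewrite fpowersetE => ZV; exact: fsubset_trans ZV VW. Qed.

Lemma site_support_lift F (M : 'M[C]_#|LConf q F|) :
  (F `<=` W)%fset -> site_support F (mxlift M).
Proof. by move=> FW; exists M; exact: local_op_lift. Qed.

Lemma site_support_comm X Y a b : site_support X a -> site_support Y b ->
  [disjoint X & Y]%fset -> mxnorm (comm a b) = 0.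
Proof.
move=> [M Ma] [N Nb] XY; apply/le_anti; rewrite mxnorm_ge0 andbT.
apply: mxnorm_le; split=> // psi _; rewrite mul0e.
rewrite (_ : loc (comm a b) psi = fun=> 0).
  rewrite l2norm_le// expr0n; apply: energy_le => r _.
  by rewrite big1// => s _; rewrite sqmod0.
apply: funext => s; rewrite /comm -[a * b]/(a *m b) -[b * a]/(b *m a).
by rewrite local_opD local_opN !local_opM Ma Nb (local_op_disjoint _ _ XY) subrr.
Qed.

Lemma site_support_kterm Z : Z \in fpowerset V -> site_support Z (kterm Z).
Proof.
move=> /volume_sub ZW; exists ((0 +i* 1)%C *: H Z).
apply: funext => psi; apply: funext => s.
by rewrite !local_opZ local_op_lift.
Qed.

Lemma kterm_norm Z : Z \in fpowerset V ->
  ((mxnorm (kterm Z))%:E <= opnorm (local_op (H Z)))%E.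
Proof.
move=> /volume_sub ZW; rewrite -(local_op_lift _ ZW) opnorm_local lee_fin.
have [c0 h] := mxnorm_bound (mxlift (H Z)).
apply: mxnorm_le; split=> // psi fpsi; apply: le_trans (h _ fpsi).
have -> : loc (kterm Z) psi = fun s => (0 +i* 1)%C * loc (hterm Z) psi s.
  by apply: funext => s; rewrite local_opZ.
rewrite /l2norm le_eqVlt; apply/orP; left; apply/eqP; congr (_ `^ _)%E.
apply: eq_esum => s _; rewrite -!/(sqmod _) sqmodM; congr EFin.
by rewrite {1}/sqmod /= expr0n expr1n add0r mul1r.
Qed.

Lemma ham_herm P : ham P \is hermsymmx.
Proof.
apply/is_hermitianmxP; rewrite expr0 scale1r /ham.
elim/big_rec: _ => [|Z M _ IH]; first by rewrite trmx0 map_mx0.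
rewrite linearD /= map_mxD -IH; congr (_ + _).
rewrite /hterm; have [ZW|ZW] := boolP (Z `<=` W)%fset.
  by have /is_hermitianmxP := mxext_herm ZW (Hsa Z); rewrite expr0 scale1r mxliftE.
by rewrite mxlift0// trmx0 map_mx0.
Qed.

Lemma kterm_sum P : \sum_(Z <- fpowerset V | P Z) kterm Z = (0 +i* 1)%C *: ham P.
Proof. by rewrite /ham scaler_sumr. Qed.

(** A truncation depends only on which of the finitely many subsets of [V] it selects; the sum of
    the error constants over all these selections is therefore a common constant. *)
Lemma uniform_flow : exists K, forall P : pred {fset L},
  is_flow (@mxnorm R L q W) (@mxscalar R L q W) K
    (\sum_(Z <- fpowerset V | P Z) kterm Z) (mxflow (ham P)).
Proof.
pose err (P : pred {fset L}) : R := 2 * \sum_i eigenval (ham P) i ^+ 2.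
have err0 P : 0 <= err P by rewrite mulr_ge0// sumr_ge0// => i _; exact: sqr_ge0.
exists (\sum_(F <- fpowerset (fpowerset V)) err (mem F)) => P.
rewrite kterm_sum; apply: is_flow_le (mxflow_is_flow (ham_herm P)).
rewrite -/(err P).
pose F := [fset Z in fpowerset V | P Z]%fset.
have FP : F \in fpowerset (fpowerset V).
  by rewrite fpowersetE; apply/fsubsetP => Z; rewrite !inE => /andP[].
have -> : err P = err (mem F).
  suff hamE : ham P = ham (mem F) by rewrite /err hamE.
  rewrite /ham big_seq_cond [RHS]big_seq_cond.
  by apply: eq_bigl => Z; rewrite !inE /=; case: (Z \in _).
by rewrite (big_rem F)//= lerDl sumr_ge0.
Qed.

Lemma finite_hamiltonianE : finite_hamiltonian H V = loc (ham predT).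
Proof.
apply: funext => psi; apply: funext => s; rewrite /finite_hamiltonian local_op_sum.
by rewrite big_seq [RHS]big_seq; apply: eq_bigr => Z /volume_sub ZW; rewrite local_op_lift.
Qed.

Lemma finite_evolutionE t A : finite_evolution H V t A =
  loc (mxflow (ham predT) t) \o A \o loc (mxflow (ham predT) (- t)).
Proof.
by rewrite /finite_evolution finite_hamiltonianE !(expop_local (ham_herm predT)).
Qed.

Lemma range_tail_sum (J alpha r : R) x : 0 < r ->
  (range_tail H pos r <= (J * r `^ (- alpha))%:E)%E ->
  \sum_(Z <- fpowerset V | (x \in Z) && (r <= diam pos Z)) mxnorm (kterm Z)
    <= J * r `^ (- alpha).
Proof.
move=> r0; rewrite -lee_fin => /(le_trans _); apply.
apply: le_trans (ereal_sup_ubound _); last by exists x.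
apply: sum_le_esum => // [Z|Z ZV /andP[xZ rZ]]; first exact: opnorm_ge0.
by split => //; exact: kterm_norm.
Qed.

(** The cardinality of [Z] counts the sites [y] of [Z]; exchanging the two sums turns the left side
    into part of the double sum that defines the total strength. *)
Lemma total_strength_sum x : (total_strength H < +oo)%E ->
  \sum_(Z <- fpowerset V | x \in Z) mxnorm (kterm Z) * #|` Z|%:R
    <= fine (total_strength H).
Proof.
move=> fin.
have sum0 : (0 <= total_strength H)%E.
  apply: le_trans (ereal_sup_ubound _); last by exists x.
  by apply: esum_ge0 => y _; apply: esum_ge0 => Z _; exact: opnorm_ge0.
rewrite -lee_fin fineK ?ge0_fin_numE//.
apply: le_trans (ereal_sup_ubound _); last by exists x.
have -> : \sum_(Z <- fpowerset V | x \in Z) mxnorm (kterm Z) * #|` Z|%:R =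
    \sum_(y <- V) \sum_(Z <- fpowerset V | (x \in Z) && (y \in Z)) mxnorm (kterm Z).
  under [RHS]eq_bigr do rewrite big_mkcondr.
  rewrite exchange_big big_seq_cond [RHS]big_seq_cond; apply: eq_bigr => Z /andP[ZV xZ].
  rewrite -big_mkcond /= big_const_seq iter_addr_0 mulr_natr; congr (_ *+ _).
  rewrite -size_filter; apply/perm_size/uniq_perm; rewrite ?fset_uniq ?filter_uniq//.
  move=> y; rewrite mem_filter; case: (boolP (y \in Z)) => //= yZ.
  by apply/esym; move: ZV; rewrite fpowersetE => /fsubsetP; apply.
apply: sum_le_esum => // [y|y yV _].
  by apply: esum_ge0 => Z _; exact: opnorm_ge0.
split => //; apply: sum_le_esum => // [Z|Z ZV /andP[xZ yZ]]; first exact: opnorm_ge0.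
by split => //; exact: kterm_norm.
Qed.

End FiniteVolume.

(** * Passage to the infinite volume *)

Section Perturbation.
Context {R : realType} {L : choiceType} {q : L -> nat}.
Local Notation op := (@op R L q).
Implicit Types T S : op.

Definition addop T S : op := fun psi s => T psi s + S psi s.
Definition op_linear T : Prop :=
  forall phi psi s, T (fun s => phi s - psi s) s = T phi s - T psi s.

Lemma op_eq T T' : T =2 T' -> T = T'.
Proof. by move=> TT'; apply: funext => psi; apply: funext => s. Qed.

Lemma op_bound_add T S a b : op_bound T a -> op_bound S b -> op_bound (addop T S) (a + b).
Proof.
move=> [a0 Ta] [b0 Sb]; split; first exact: addr_ge0.
move=> psi fpsi; apply: le_trans (l2norm_triangle (T psi) (S psi)) _.
rewrite EFinD ge0_muleDl ?lee_fin//.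
by apply: leeD; [exact: Ta|exact: Sb].
Qed.

Lemma op_bound_opnorm_le T c : (opnorm T <= c%:E)%E -> op_bound T c.
Proof.
move=> Tc; have fT : (opnorm T < +oo)%E by apply: le_lt_trans Tc _; exact: ltry.
apply: op_bound_le (op_bound_opnorm fT).
by rewrite -lee_fin fineK// ge0_fin_numE ?opnorm_ge0.
Qed.

(** TB - BT = (T-E)B + E(B-F) + [E,F] - (B-F)T - F(T-E). The splitting is arranged so that only [E]
    and [F] are applied to differences: an element of [op], in particular a norm limit, need not be
    linear. *)
Lemma commutator_perturb (T B E F : op) (tau b x y e1 e2 k : R) :
  op_bound T tau -> op_bound B b -> op_bound E x -> op_bound F y ->
  op_bound (subop T E) e1 -> op_bound (subop B F) e2 ->
  op_linear E -> op_linear F -> op_bound (commutator E F) k ->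
  op_bound (commutator T B) (e1 * b + x * e2 + k + (e2 * tau + y * e1)).
Proof.
move=> HT HB HE HF HTE HBF linE linF HEF.
have h1 := op_bound_add (op_bound_comp HTE HB) (op_bound_comp HE HBF).
have h2 := op_bound_add (op_bound_comp HBF HT) (op_bound_comp HF HTE).
have := op_bound_sub (op_bound_add h1 HEF) h2.
suff -> : commutator T B = subop (addop (addop (subop T E \o B) (E \o subop B F)) (commutator E F))
  (addop (subop B F \o T) (F \o subop T E)) by [].
apply: op_eq => psi s; rewrite /commutator /subop /addop /=.
have -> : E (fun s0 => B psi s0 - F psi s0) s = E (B psi) s - E (F psi) s by exact: linE.
have -> : F (fun s0 => T psi s0 - E psi s0) s = F (T psi) s - F (E psi) s by exact: linF.
by ring.
Qed.

Lemma local_op_op_linear F (M : 'M[R[i]]_#|LConf q F|) : op_linear (local_op M).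
Proof. by move=> phi psi s; exact: local_op_linear. Qed.

Lemma supported_local (X : {fset L}) (A : op) (e : R) : 0 < e ->
  supported [set` X] A ->
  exists M : 'M[R[i]]_#|LConf q X|, op_bound (subop A (local_op M)) e.
Proof.
move=> e0 /(_ e e0) [F [FX [M AM]]].
have sub : (F `<=` X)%fset by apply/fsubsetP => x xF; exact: FX.
by exists (mxlift X M); rewrite local_op_lift//; exact: op_bound_opnorm_le.
Qed.

Lemma supported_opnorm (X : set L) (A : op) : supported X A -> (opnorm A < +oo)%E.
Proof.
move=> /(_ 1 ltr01) [F [_ [M AM]]].
have h := op_bound_add (op_bound_opnorm_le AM) (mxnorm_bound M).
have -> : A = addop (subop A (local_op M)) (local_op M).
  by apply: op_eq => psi s; rewrite /addop /subop subrK.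
by apply: le_lt_trans (opnorm_le h) _; exact: ltry.
Qed.

Lemma op_bound_approx (A A' : op) a e : op_bound A a -> op_bound (subop A A') e ->
  op_bound A' (a + e).
Proof.
move=> ha he; have -> : A' = subop A (subop A A'); last exact: op_bound_sub.
by apply: op_eq => psi s; rewrite /subop opprB addrCA subrr addr0.
Qed.

Lemma commutator_zero (B : op) : (opnorm B < +oo)%E ->
  op_bound (commutator (fun _ _ => 0) B) 0.
Proof.
move=> /op_bound_opnorm [b0 hB]; split=> // psi fpsi; rewrite mul0e.
have l0 : l2norm (fun _ : Conf q => 0 : R[i]) = 0%E.
  apply/le_anti; rewrite l2norm_ge0 andbT l2norm_le// expr0n.
  by apply: energy_le => r _; rewrite big1// => s _; rewrite sqmod0.
have := hB (fun=> 0); rewrite l0 mule0 => /(_ (ltry _)).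
rewrite (_ : commutator _ B psi = fun s => - B (fun=> 0) s) ?l2norm_opp//.
by apply: funext => s; rewrite /commutator /subop /= sub0r.
Qed.

End Perturbation.

(** * From finite volumes to the infinite-volume dynamics *)

Section Assembly.
Context {R : realType} {d : nat} {L : choiceType} {q : L -> nat}.
Variables (pos : L -> 'rV[R]_d) (H : @interaction R L q).
Variables (sigma alpha J eta Cl : R) (ns M : nat).
Hypothesis Hsa : self_adjoint H.
Hypothesis J0 : 0 <= J.
Hypothesis sigma0 : 0 < sigma.
Hypothesis sigma1 : sigma < 1.
Hypothesis eta0 : 0 < eta.
Hypothesis eta1 : eta <= 1.
Hypothesis Cl1 : 1 <= Cl.
Hypothesis exponents : d%:R + 1 - sigma <= sigma * alpha.
Hypothesis tail : forall r : R, 0 < r -> (range_tail H pos r <= (J * r `^ (- alpha))%:E)%E.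
Hypothesis strength : (total_strength H < +oo)%E.
Hypothesis lattice : forall (V : {fset L}) x (l : R), 1 <= l ->
  \sum_(z <- V) tail_weight l (d%:R + eta) (dist pos x z) <= Cl * l `^ d%:R.
Hypothesis ns0 : (0 < ns)%N.
Hypothesis nsM : (ns <= M)%N.
Hypothesis le_ns : sigma * d%:R <= ns%:R * (sigma * alpha - d%:R).
Hypothesis le_eta : (2 * ns%:R + 5) * eta <= 1 - sigma.

Local Notation v := (8 * Num.max J (fine (total_strength H))).
Local Notation C3 := (@weight_constant R d eta
  (iter M.+1 (@next_constant R d sigma eta Cl) 2) * Cl).

Definition envelope (X : {fset L}) (r t : R) : R :=
  2 * #|` X|%:R * expR (v * t - r `^ (1 - sigma)) +
  C3 * (v * t + (v * t) `^ (1 + d%:R / (1 - sigma))) * #|` X|%:R ^+ ns.+2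
    / r `^ (sigma * alpha).

(** The ring consists of the matrices on the union of [V], [X] and [Y], so that both observables
    live in it, while the Hamiltonian is that of [V]. Hence [Y] may reach outside the volume of the
    dynamics. *)
Lemma local_bound (V X Y : {fset L}) (A : 'M[R[i]]_#|LConf q X|)
    (B : 'M[R[i]]_#|LConf q Y|) (t r : R) :
  X != fset0 -> Y != fset0 -> 0 <= t -> 1 <= r ->
  (forall x y, x \in X -> y \in Y -> r <= dist pos x y) ->
  let U := local_op (mxflow (ham H V (V `|` X `|` Y)%fset predT) t) in
  let U' := local_op (mxflow (ham H V (V `|` X `|` Y)%fset predT) (- t)) in
  op_bound (commutator (U \o local_op A \o U') (local_op B))
    (mxnorm (mxlift (V `|` X `|` Y)%fset A) * mxnorm (mxlift (V `|` X `|` Y)%fset B)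
      * envelope X r t).
Proof.
move=> X0 Y0 t0 r1 far; set W := (V `|` X `|` Y)%fset => U U'.
have VW : (V `<=` W)%fset by rewrite /W -fsetUA fsubsetUl.
have XW : (X `<=` W)%fset by rewrite /W fsetUAC fsubsetUr.
have YW : (Y `<=` W)%fset by rewrite /W fsubsetUr.
have [K FU] := uniform_flow V W Hsa.
have v1 : 2 * J <= v.
  have : J <= Num.max J (fine (total_strength H)) by rewrite le_max lexx.
  by move: (Num.max _ _) => w; have := J0; lra.
have v2 : 8 * fine (total_strength H) <= v by rewrite ler_pM2l// le_max lexx orbT.
have h1 Z : Z \in fpowerset V -> (Z `<=` V)%fset by rewrite fpowersetE.
have h2 x r' : 0 < r' -> \sum_(Z <- fpowerset V | (x \in Z) && (r' <= diam pos Z))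
    mxnorm (kterm H W Z) <= J * r' `^ (- alpha).
  by move=> r'0; apply: range_tail_sum => //; exact: tail.
have h3 x : \sum_(Z <- fpowerset V | x \in Z) mxnorm (kterm H W Z) * #|` Z|%:R
    <= fine (total_strength H) by exact: total_strength_sum.
have h4 x : x \in X -> r <= fdist pos Y x.
  by move=> xX; have [y yY ->] := fdist_attained pos x Y0; exact: far.
have h5 Z : Z \in fpowerset V -> site_support Z (kterm H W Z).
  by move=> ZV; exact: (site_support_kterm H VW).
have h6 : site_support X (mxlift W A) by exact: site_support_lift.
have h7 : site_support Y (mxlift W B) by exact: site_support_lift.
have bound := iterated_bound (mxnorm_is_ring_norm W)
  (@site_support_comm R L q W) h5 FU h1 J0 v2 v1 sigma0 sigma1
  eta0 eta1 Cl1 exponents h2 h3 (lattice V) X0 h6 ns0 nsM le_ns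
  le_eta predT t0 r1 h7 Y0 h4.
apply: op_bound_le bound _.
have -> : commutator (U \o local_op A \o U') (local_op B) =
   local_op (comm (evolve (mxflow (ham H V W predT)) t (mxlift W A)) (mxlift W B)).
  have evE : local_op (evolve (mxflow (ham H V W predT)) t (mxlift W A)) = U \o local_op A \o U'.
    rewrite /U /U' /evolve; move: (mxflow _ t) (mxflow _ (- t)) => u u'.
    by rewrite -[u * _ * u']/(u *m _ *m u') !local_opM (local_op_lift A XW).
  rewrite -evE -(local_op_lift B YW).
  move: (evolve _ _ _) (mxlift W B) => M1 M2; apply: op_eq => psi s.
  by rewrite /comm -[M1 * M2]/(M1 *m M2) -[M2 * M1]/(M2 *m M1) local_opD local_opN !local_opM.
exact: mxnorm_bound.
Qed.

Lemma envelope_ge0 X r t : 0 <= t -> 0 <= envelope X r t.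
Proof.
move=> t0; have v0 : 0 <= v by rewrite mulr_ge0// le_max J0.
have Cl0 : 0 <= Cl by exact: le_trans Cl1.
have w0 c : 0 <= c -> 0 <= @weight_constant R d eta c.
  by move=> c0; apply: addr_ge0 => //; rewrite addr_ge0// !mulr_ge0// powR_ge0.
have c0 m : 0 <= iter m (@next_constant R d sigma eta Cl) 2.
  elim: m => [|m IH] //=; rewrite /next_constant.
  apply: addr_ge0; last by rewrite mulr_ge0 ?w0.
  by rewrite addr_ge0// !mulr_ge0// powR_ge0.
have vt0 : 0 <= v * t by exact: mulr_ge0.
apply: addr_ge0; first by rewrite !mulr_ge0// expR_ge0.
apply: divr_ge0; last exact: powR_ge0.
apply: mulr_ge0; last exact: exprn_ge0.
apply: mulr_ge0; first by apply: mulr_ge0 => //; exact: w0.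
by apply: addr_ge0 => //; exact: powR_ge0.
Qed.

(** Up to e, [A] is a matrix on [X], [B] a matrix on a finite part of [Y], and the limit a
    finite-volume evolution. The finite bound is uniform in all these choices, so e can tend to
    0. *)
Lemma evolution_bound (X : {fset L}) (Y : set L) (A B : @op R L q) (t r : R) :
  X != fset0 -> Y !=set0 -> 0 <= t -> 1 <= r ->
  (forall x y, x \in X -> Y y -> r <= dist pos x y) ->
  supported [set` X] A -> supported Y B ->
  (opnorm (commutator (evolution H t A) B) <=
    opnorm A * opnorm B * (envelope X r t)%:E)%E.
Proof.
move=> X0 [y0 Yy0] t0 r1 far suppA suppB.
have fA := supported_opnorm suppA; have fB := supported_opnorm suppB.
have fAn : opnorm A \is a fin_num by rewrite ge0_fin_numE ?opnorm_ge0.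
have fBn : opnorm B \is a fin_num by rewrite ge0_fin_numE ?opnorm_ge0.
have env0 := envelope_ge0 X r t0.
(* without a limit [evolution] is the zero operator *)
rewrite /evolution; case: xgetP => [T _ limT|_]; last first.
  apply: le_trans (opnorm_le (commutator_zero fB)) _.
  by rewrite !mule_ge0 ?opnorm_ge0// lee_fin.
rewrite -(fineK fAn) -(fineK fBn) -!EFinM.
have hA := op_bound_opnorm fA; have hB := op_bound_opnorm fB.
set na := fine (opnorm A) in hA *; set nb := fine (opnorm B) in hB *.
have na0 : 0 <= na by case: hA.
have nb0 : 0 <= nb by case: hB.
set K := envelope X r t in env0 *.
(* The error of [commutator_perturb] with every e^2 replaced by e, divided by e; the slack is (1 -
   e) e (K + 6). *)
set Q := 2 * nb + (na + 1) + K * (na + nb + 1) + (na + 3) + 2 * (nb + 1).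
have Q0 : 0 < Q by rewrite /Q; nra.
have approx e : 0 < e <= 1 ->
    op_bound (commutator T B) (na * nb * K + e * Q).
  move=> /andP[e0 e1].
  have [MA hMA] := supported_local e0 suppA.
  have [F [FY [MB /op_bound_opnorm_le hMB]]] := suppB e e0.
  have [V /(_ V (fsubset_refl _)) /op_bound_opnorm_le hT] := limT e e0.
  (* [F] may be empty, for instance when [B] is a scalar; adding [y0] gives a nonempty support
     inside [Y]. *)
  pose Yf := (y0 |` F)%fset; pose MB' := mxlift Yf MB.
  have FYf : (F `<=` Yf)%fset by exact: fsubsetU1.
  have Yf0 : Yf != fset0 by apply/fset0Pn; exists y0; rewrite !inE eqxx.
  have farf x y : x \in X -> y \in Yf -> r <= dist pos x y.
    move=> xX; rewrite !inE => /predU1P[->|yF]; first exact: far.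
    by apply: far => //; exact: FY.
  have hMB' : op_bound (subop B (local_op MB')) e by rewrite local_op_lift.
  pose W := (V `|` X `|` Yf)%fset.
  have VW : (V `<=` W)%fset by rewrite /W -fsetUA fsubsetUl.
  have XW : (X `<=` W)%fset by rewrite /W fsetUAC fsubsetUr.
  have YW : (Yf `<=` W)%fset by rewrite /W fsubsetUr.
  pose U := local_op (mxflow (ham H V W predT) t) : @op R L q.
  pose U' := local_op (mxflow (ham H V W predT) (- t)) : @op R L q.
  pose E := U \o local_op MA \o U'.
  have herm := ham_herm V W Hsa predT.
  have U1 s : op_bound (local_op (mxflow (ham H V W predT) s) : @op R L q) 1.
    apply/local_op_bound/contracts_mode => // i; rewrite sqmod_expi expr1n//.
  have bA : op_bound (local_op MA) (na + e) by exact: op_bound_approx hMA.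
  have bB : op_bound (local_op MB') (nb + e) by exact: op_bound_approx hMB'.
  have bE : op_bound E (na + e).
    rewrite -[na + e]mul1r -[1 * _]mulr1.
    exact: op_bound_comp (op_bound_comp (U1 t) bA) (U1 (- t)).
  have bTE : op_bound (subop T E) (2 * e).
    have h : op_bound (subop (finite_evolution H V t A) E) e.
      rewrite (finite_evolutionE VW Hsa) -/U -/U' -[e]mul1r -[1 * _]mulr1.
      have -> : subop (U \o A \o U') E = U \o subop A (local_op MA) \o U'.
        apply: op_eq => psi s; rewrite /E /subop /=; apply: esym.
        exact: local_op_op_linear.
      exact: op_bound_comp (op_bound_comp (U1 t) hMA) (U1 (- t)).
    rewrite mulr2n mulrDl mul1r.
    have -> : subop T E = addop (subop T (finite_evolution H V t A))
        (subop (finite_evolution H V t A) E).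
      by apply: op_eq => psi s; rewrite /addop /subop addrA subrK.
    exact: op_bound_add.
  have bT : op_bound T (na + e + 2 * e).
    have -> : T = addop E (subop T E).
      by apply: op_eq => psi s; rewrite /addop /subop addrCA subrr addr0.
    exact: op_bound_add.
  have linE : op_linear E.
    move=> phi psi s; rewrite /E /=.
    have -> : U' (fun s0 => phi s0 - psi s0) = fun s0 => U' phi s0 - U' psi s0.
      by apply: funext => s0; exact: local_op_op_linear.
    have -> : local_op MA (fun s0 => U' phi s0 - U' psi s0) =
        fun s0 => local_op MA (U' phi) s0 - local_op MA (U' psi) s0.
      by apply: funext => s0; exact: local_op_op_linear.
    exact: local_op_op_linear.
  have bEF : op_bound (commutator E (local_op MB')) ((na + e) * (nb + e) * K).
    apply: op_bound_le (local_bound V MA MB' X0 Yf0 t0 r1 farf).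
    rewrite -/K ler_wpM2r// ler_pM ?mxnorm_ge0//.
      by apply: mxnorm_le; rewrite local_op_lift.
    by apply: mxnorm_le; rewrite local_op_lift.
  have := commutator_perturb bT hB bE bB bTE hMB' linE (@local_op_op_linear _ _ _ _ _) bEF.
  apply: op_bound_le; rewrite /Q -subr_ge0.
  rewrite [X in 0 <= X](_ : _ = (1 - e) * e * (K + 6)); last by ring.
  apply: mulr_ge0; last exact: addr_ge0.
  by apply: mulr_ge0; [rewrite subr_ge0|exact: ltW].
apply/lee_addgt0Pr => e e0.
have e'1 : 0 < Num.min 1 (e / Q) <= 1.
  by rewrite lt_min ltr01 divr_gt0//= ge_min lexx.
apply: le_trans (opnorm_le (approx _ e'1)) _.
rewrite -EFinD lee_fin lerD2l -ler_pdivlMr// ge_min lexx orbT//.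
Qed.

End Assembly.

Theorem theorem1 (R : realType) (d : nat) (L : choiceType)
    (pos : L -> 'rV[R]_d) (sigma : R) :
  unit_separated pos -> 0 < sigma < 1 ->
  exists C1 C2 C3 : R, [/\ 0 < C1, 0 < C2, 0 < C3 &
  forall (q : L -> nat) (H : @interaction R L q) (J alpha : R),
    self_adjoint H ->
    d%:R < alpha ->
    (forall r : R, 0 < r -> (range_tail H pos r <= (J * r `^ (- alpha))%:E)%E) ->
    (total_strength H < +oo)%E ->
    (d%:R + 1) / (alpha + 1) < sigma ->
    let v := C2 * Num.max J (fine (total_strength H)) in
    let nstar : int := Num.ceil (sigma * d%:R / (sigma * alpha - d%:R)) in
    forall X : {fset L}, X != fset0 ->
    exists G : R -> R,
      (forall tau : R, 0 <= tau ->
         0 <= G tau <= C3 * (tau + tau `^ (1 + d%:R / (1 - sigma)))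
                          * (#|` X|%:R : R) ^ (nstar + 2)) /\
      forall (Y : set L) (A B : @op R L q) (t : R),
        Y !=set0 ->
        let r := set_dist pos [set` X] Y in
        0 < r ->
        supported [set` X] A -> supported Y B ->
        0 <= t ->
        (opnorm (commutator (evolution H t A) B) <=
         opnorm A * opnorm B *
         (2 * #|` X|%:R * expR (v * t - r `^ (1 - sigma))
          + C1 * (G (v * t) / r `^ (sigma * alpha)))%:E)%E].
Proof.
move=> sep /andP[sigma0 sigma1].
have s1 : 0 < 1 - sigma by rewrite subr_gt0.
have dR0 : 0 <= d%:R :> R by [].
(* Every admissible [alpha] has [sigma * alpha - d >= 1 - sigma], so [nstar] is at most [M]. Thus
   [eta], [Cl] and [C3] can be fixed before [alpha] is known, and (2 nstar + 5) eta <= 1 - sigma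
   still holds. *)
pose M := `|Num.ceil (sigma * d%:R / (1 - sigma))|%N.
have M5 : 0 < 2 * M%:R + 5 :> R by rewrite ltr_wpDl// mulr_ge0.
pose eta : R := (1 - sigma) / (2 * M%:R + 5).
have eta0 : 0 < eta by rewrite divr_gt0.
have eta1 : eta <= 1.
  rewrite ler_pdivrMr// mul1r; have : 0 <= M%:R :> R by [].
  by lra.
have [Cl Cl1 lattice] := sum_tail_weight sep eta0.
pose C3 := @weight_constant R d eta (iter M.+1 (@next_constant R d sigma eta Cl) 2) * Cl.
have C30 : 0 < C3.
  apply: mulr_gt0; last exact: lt_le_trans Cl1.
  have w2 c : 0 <= c -> 2 <= @weight_constant R d eta c.
    by move=> c0; rewrite /weight_constant -addrA lerDl addr_ge0// !mulr_ge0// powR_ge0.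
  have c0 m : 0 <= iter m (@next_constant R d sigma eta Cl) 2.
    elim: m => [|m IH] //=; rewrite /next_constant.
    apply: addr_ge0; first by rewrite addr_ge0// !mulr_ge0// powR_ge0.
    by apply: mulr_ge0; [exact: le_trans (w2 _ IH)|exact: le_trans Cl1].
  exact: lt_le_trans (w2 _ (c0 M.+1)).
(* The 8 is the Lieb-Robinson velocity factor, 2 times the bound 4 for e. The whole constant is put
   into [G], chosen equal to its allowed maximum, which leaves 1 for the first constant. *)
exists 1, 8, C3; split=> // q H J alpha Hsa d_alpha tail strength le_sigma v nstar X X0.
have alpha0 : 0 < alpha + 1 by rewrite addr_gt0// (le_lt_trans dR0).
have exponents : d%:R + 1 - sigma <= sigma * alpha.
  by move: le_sigma; rewrite ltr_pdivrMr// mulrDr mulr1 => /ltW; lra.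
have D0 : 1 - sigma <= sigma * alpha - d%:R by lra.
have Dgt0 : 0 < sigma * alpha - d%:R by exact: lt_le_trans D0.
have [x0 x0X] : exists x, x \in X by exact/fset0Pn.
have J0 : 0 <= J.
  rewrite -lee_fin; apply: le_trans (_ : (range_tail H pos 1 <= _)%E).
    apply: le_trans (ereal_sup_ubound _); last by exists x0.
    by apply: esum_ge0 => Z _; exact: opnorm_ge0.
  by have := tail 1 ltr01; rewrite powR1 mulr1.
have x_ge0 : 0 <= sigma * d%:R / (sigma * alpha - d%:R).
  by rewrite divr_ge0 ?(ltW Dgt0)// mulr_ge0 ?(ltW sigma0).
have nstar0 : 0 <= nstar.
  by rewrite /nstar ceil_ge0 (lt_le_trans _ x_ge0).
pose ns := `|nstar|%N.
have nsE : nstar = ns%:Z by rewrite /ns gez0_abs.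
have powE : (#|` X|%:R : R) ^ (nstar + 2) = #|` X|%:R ^+ ns.+2.
  by rewrite nsE -[ns.+2]addn2 exprnP PoszD.
exists (fun tau => C3 * (tau + tau `^ (1 + d%:R / (1 - sigma))) * (#|` X|%:R : R) ^ (nstar + 2)).
split=> [tau tau0|Y A B t Y0 r r0 suppA suppB t0].
  rewrite lexx andbT powE mulr_ge0 ?exprn_ge0// mulr_ge0 ?(ltW C30)//.
  by rewrite addr_ge0 ?powR_ge0.
have le_dist x y : x \in X -> Y y -> r <= dist pos x y.
  move=> xX Yy; apply: ge_inf; last by exists (x, y).
  by exists 0 => _ [p _ <-]; exact: dist_ge0.
(* In dimension 0 all distances vanish, against [0 < r]. For d > 0 the round count [ns] is positive,
   as [deficit_eq0] requires. *)
have [d0|dpos] := posnP d.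
  case: Y0 => y Yy; move: r0; rewrite ltNge => /negP[].
  apply: le_trans (le_dist x0 y x0X Yy) _; rewrite /dist big1 ?sqrtr0// => i.
  by exfalso; move: i; rewrite d0 => -[].
have r1 : 1 <= r.
  case: Y0 => y Yy; apply: lb_le_inf; first by exists (dist pos x0 y), (x0, y).
  move=> _ [[x z] [/= xX Yz] <-]; apply: sep; apply: contraTneq r0 => xz.
  rewrite -leNgt; apply: le_trans (le_dist x z xX Yz) _.
  by rewrite xz /dist big1 ?sqrtr0// => i _; rewrite subrr expr0n.
have ns0 : (0 < ns)%N.
  rewrite /ns absz_gt0 gt_eqF// ceil_gt0 divr_gt0// mulr_gt0// ltr0n//.
have le_ns : sigma * d%:R <= ns%:R * (sigma * alpha - d%:R).
  rewrite -ler_pdivrMr//; have := ceil_ge (sigma * d%:R / (sigma * alpha - d%:R)).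
  by rewrite -/nstar nsE.
have nsM : (ns <= M)%N.
  rewrite -lez_nat /M gez0_abs; last first.
    by rewrite ceil_ge0 (lt_le_trans (ltrN10 _))// divr_ge0 ?(ltW s1)// mulr_ge0 ?(ltW sigma0).
  rewrite -nsE; apply: le_ceil.
  by rewrite ler_wpM2l ?mulr_ge0 ?(ltW sigma0)// lef_pV2.
have le_eta : (2 * ns%:R + 5) * eta <= 1 - sigma.
  rewrite /eta mulrA ler_pdivrMr// mulrC ler_wpM2l ?(ltW s1)//.
  by rewrite lerD2r ler_pM2l// ler_nat.
apply: le_trans (evolution_bound Hsa J0 sigma0 sigma1 eta0 eta1 Cl1 exponents tail strength
  lattice ns0 nsM le_ns le_eta X0 Y0 t0 r1 le_dist suppA suppB) _.
rewrite le_eqVlt; apply/orP; left; apply/eqP; congr (_ * _%:E)%E.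
by rewrite /envelope powE mul1r.
Qed.
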